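(* Let $k$ be a field of characteristic $0$. The local Fourier transform functors $\mathcal{F}(0,\infty)$ and $\mathcal{F}(\infty,0)$ are inverses and define equivalences of categories $$\{k((t))\text{-connections with no horizontal sections}\}\ \leftrightarrow\ \{k((z'))\text{-connections with no horizontal sections and slopes}<1\}.$$
   Context: A connection on $k((u))$ is a finite-dimensional $k((u))$-vector space $M$ with an action of $\partial_u$ satisfying the Leibniz rule; $M^\nabla=\ker\partial_u$ is the space of horizontal sections, and ''no horizontal sections'' means $M^\nabla=(0)$. Slopes are the usual slopes of a formal connection. For a $k$-vector space $V$, $V((u'))$ denotes formal Laurent series in $u'$ with coefficients in $V$. Good lattice pair for a connection $M$ on $k((u))$: $k[[u]]$-lattices $\mathcal{V}\subset\mathcal{W}\subset M$ such that $u\partial_u\mathcal{V}\subset\mathcal{W}$ and the inclusion of two-term complexes $(\mathcal{V}\xrightarrow{\partial_u}\frac1u\mathcal{W})\subset(M\xrightarrow{\partial_u}M)$ is a quasi-isomorphism. $\mathcal{F}(0,\infty)$: for $M$ a connection on $k((t))$ with $M^\nabla=(0)$ and $(\mathcal{V},\mathcal{W})$ any good lattice pair, $$\mathcal{F}(0,\infty)(M)=\mathrm{coker}\Big(\mathcal{V}((z'))\xrightarrow{z'\partial_t+1}\tfrac1t\mathcal{W}((z'))\Big),$$ a connection on $k((z'))$, where $z'^2\partial_{z'}$ is induced by $z'^2\partial_{z'}-t$ on $\frac1t\mathcal{W}((z'))$. It is independent of the good lattice pair. $\mathcal{F}(\infty,0)$: for $M$ a connection on $k((z))$ with $M^\nabla=(0)$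 and all slopes $<1$, choose a good lattice pair $(\mathcal{V},\mathcal{W})$ with $z^2\partial_z\mathcal{V}\subset\mathcal{V}$; then $$\mathcal{F}(\infty,0)(M)=\mathrm{coker}\Big(\mathcal{V}((t'))\xrightarrow{-z^2\partial_z+t'}\mathcal{V}((t'))\Big),$$ a connection on $k((t'))$. Cokernels for different such $\mathcal{V}$ are identified by the isomorphisms induced by inclusions of lattices, and $\partial_{t'}$ is induced by $\partial_{t'}+\frac1z:\mathcal{V}((t'))\to\frac1z\mathcal{V}((t'))$. In the claim, $z$ is renamed $z'$ and $t'$ is renamed $t$ so that the functors can be composed.
   Formalization: With the stated sign conventions the composites of the two transforms are pullback along t ↦ −t (resp. z' ↦ −z'), not the identity (∂_t e = t^{-2}e is a counterexample), so ''inverses'' is proved after the sign change t' = −t; both functors are still shown to be equivalences. *)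

(* Defs.v *)
From HB Require Import structures.
From mathcomp Require Import all_boot all_order all_algebra.
From mathcomp Require Import zify.
From mathcomp Require Import boolp classical_sets fsbigop.
Set Implicit Arguments. Unset Strict Implicit. Unset Printing Implicit Defensive.
Import Order.TTheory GRing.Theory Num.Theory.
Local Open Scope classical_set_scope.
Local Open Scope ring_scope.

(* V((u)): formal Laurent series with coefficients in V. The variable is not   *)
(* part of the type: k((t)), k((z')), ... are all [laurent k].                 *)
Record laurent (V : zmodType) := Laurent {
  coef :> int -> V;
  coef_bounded : exists N : int, forall n : int, n < N -> coef n = 0 }.

HB.instance Definition _ (V : zmodType) := gen_eqMixin (laurent V).
HB.instance Definition _ (V : zmodType) := gen_choiceMixin (laurent V).

Lemma laurentP (V : zmodType) (x y : laurent V) : (forall n, x n = y n) -> x = y.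
Proof.
case: x y => [x hx] [y hy] /= e; have {}e : x = y by apply/funext.
by subst y; congr Laurent; apply: Prop_irrelevance.
Qed.

Section Zmod.
Variable V : zmodType.
Implicit Types x y z : laurent V.

Fact zero_bounded : exists N : int, forall n : int, n < N -> (0 : V) = 0.
Proof. by exists 0. Qed.
Definition lzero : laurent V := @Laurent V (fun=> 0) zero_bounded.

Fact add_bounded x y : exists N : int, forall n : int, n < N -> x n + y n = 0.
Proof.
have [N hN] := coef_bounded x; have [M hM] := coef_bounded y.
exists (Order.min N M) => n; rewrite lt_min => /andP[h1 h2].
by rewrite hN // hM // addr0.
Qed.
Definition ladd x y : laurent V := Laurent (add_bounded x y).

Fact opp_bounded x : exists N : int, forall n : int, n < N -> - x n = 0.
Proof. by have [N hN] := coef_bounded x; exists N => n /hN ->; rewrite oppr0. Qed.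
Definition lopp x : laurent V := Laurent (opp_bounded x).

Fact laddA : associative ladd.
Proof. by move=> x y z; apply: laurentP => n /=; rewrite addrA. Qed.
Fact laddC : commutative ladd.
Proof. by move=> x y; apply: laurentP => n /=; rewrite addrC. Qed.
Fact ladd0 : left_id lzero ladd.
Proof. by move=> x; apply: laurentP => n /=; rewrite add0r. Qed.
Fact laddN : left_inverse lzero lopp ladd.
Proof. by move=> x; apply: laurentP => n /=; rewrite addNr. Qed.

HB.instance Definition _ :=
  GRing.isZmodule.Build (laurent V) laddA laddC ladd0 laddN.

Lemma coef0 n : (0 : laurent V) n = 0. Proof. by []. Qed.
Lemma coefD x y n : (x + y) n = x n + y n. Proof. by []. Qed.
Lemma coefN x n : (- x) n = - x n. Proof. by []. Qed.

End Zmod.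

Section Scale.
Variables (k : fieldType) (V : lmodType k).
Implicit Types (f g : laurent k) (x y : laurent V).

(* The sum has finite support, both series being bounded below. *)
Definition conv f x (n : int) : V := \sum_(i \in [set: int]) f i *: x (n - i).

Lemma convE f x n (s : seq int) : uniq s ->
  (forall i, i \notin s -> f i *: x (n - i) = 0) ->
  conv f x n = \sum_(i <- s) f i *: x (n - i).
Proof.
move=> us hs; rewrite /conv [RHS]fsbig_seq //; apply/esym/fsbig_widen => //.
by move=> i [_ /negP]; apply: hs.
Qed.

Definition zrange (a b : int) : seq int :=
  [seq a + (j%:Z) | j <- iota 0 `|Num.max (0%R : int) (b - a + 1)%R|%N].

Lemma zrange_uniq a b : uniq (zrange a b).
Proof. by rewrite map_inj_uniq ?iota_uniq // => i j /addrI []. Qed.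

Lemma mem_zrange a b i : (i \in zrange a b) = (a <= i <= b).
Proof.
apply/mapP/andP => [[j]|[h1 h2]].
  rewrite mem_iota add0n /= => hj ->.
  move: hj; rewrite -ltz_nat gez0_abs ?le_max ?lexx // lt_max.
  rewrite ltNge lez_nat leq0n /= => hj; rewrite lerDl; split => //.
  by move: hj; rewrite ltzD1 lerBrDl.
exists `|i - a|%N; last by rewrite gez0_abs ?subr_ge0 //; rewrite (addrC a (i - a)) subrK.
rewrite mem_iota add0n leq0n /= -ltz_nat !gez0_abs ?le_max ?lexx ?subr_ge0 //.
by rewrite lt_max ltzD1 lerD2r h2 orbT.
Qed.

Lemma convEr f x n N M : (forall i, i < N -> f i = 0) ->
  (forall i, i < M -> x i = 0) ->
  conv f x n = \sum_(i <- zrange N (n - M)) f i *: x (n - i).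
Proof.
move=> hN hM; apply: convE (zrange_uniq _ _) _ => i.
rewrite mem_zrange negb_and -!ltNge => /orP[/hN ->|h]; first by rewrite scale0r.
by rewrite hM ?scaler0 // ltrBlDl -ltrBlDr.
Qed.

Fact conv_bounded f x : exists N : int, forall n : int, n < N -> conv f x n = 0.
Proof.
have [N hN] := coef_bounded f; have [M hM] := coef_bounded x.
exists (N + M) => n hn; rewrite (convEr _ hN hM) big1_seq // => i /andP[_].
rewrite mem_zrange => /andP[h1 h2]; have := le_trans h1 h2.
by rewrite lerBrDr leNgt hn.
Qed.
Definition lscale f x : laurent V := Laurent (conv_bounded f x).

Lemma lscaleDr f : {morph lscale f : x y / x + y}.
Proof.
move=> x y; have [N hN] := coef_bounded f.
have [M hM] := coef_bounded x; have [M' hM'] := coef_bounded y.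
have h1 i : i < Num.min M M' -> x i = 0 by rewrite lt_min => /andP[/hM].
have h2 i : i < Num.min M M' -> y i = 0 by rewrite lt_min => /andP[_ /hM'].
have h3 i : i < Num.min M M' -> (x + y) i = 0.
  by move=> h; rewrite coefD h1 // h2 // addr0.
apply: laurentP => n; rewrite coefD /= (convEr _ hN h1) (convEr _ hN h2) (convEr _ hN h3).
by rewrite -big_split; apply: eq_bigr => i _; rewrite coefD scalerDr.
Qed.

Lemma lscaleDl x : {morph lscale^~ x : f g / f + g}.
Proof.
move=> f g; have [N hN] := coef_bounded x.
have [M hM] := coef_bounded f; have [M' hM'] := coef_bounded g.
have h1 i : i < Num.min M M' -> f i = 0 by rewrite lt_min => /andP[/hM].
have h2 i : i < Num.min M M' -> g i = 0 by rewrite lt_min => /andP[_ /hM'].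
have h3 i : i < Num.min M M' -> (f + g) i = 0.
  by move=> h; rewrite coefD h1 // h2 // addr0.
apply: laurentP => n; rewrite coefD /= (convEr _ h1 hN) (convEr _ h2 hN) (convEr _ h3 hN).
by rewrite -big_split; apply: eq_bigr => i _; rewrite coefD scalerDl.
Qed.

End Scale.

Section Assoc.
Variables (k : fieldType) (V : lmodType k).
Implicit Types (f g : laurent k) (x y : laurent V).

Lemma lscaleA f g x :
  lscale f (lscale g x) = @lscale k V (@lscale k k^o f g) x.
Proof.
have [Nf hf] := coef_bounded f; have [Ng hg] := coef_bounded g.
have [Nx hx] := coef_bounded x.
have cf0 (W : lmodType k) (a : laurent k) (b : laurent W) Na Nb : (forall i, i < Na -> a i = 0) ->
    (forall i, i < Nb -> b i = 0) -> forall i, i < Na + Nb -> lscale a b i = 0.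
  move=> ha hb n hn /=; rewrite (convEr _ ha hb) big1_seq // => i /andP[_].
  rewrite mem_zrange => /andP[h1 h2]; have := le_trans h1 h2.
  by rewrite lerBrDr leNgt hn.
have hgx := cf0 _ _ _ _ _ hg hx.
have hfg := cf0 k^o f g _ _ hf hg.
apply: laurentP => n; rewrite /= (convEr _ hf hgx) (@convEr k V _ _ _ _ _ hfg hx) /=.
set s := zrange Nf _; set t := zrange (Nf + Ng) _.
transitivity (\sum_(i <- s) \sum_(l <- t) f i *: (g (l - i) *: x (n - l))).
  apply: eq_big_seq => i; rewrite mem_zrange => /andP[i1 i2].
  rewrite (@convE _ _ g x (n - i) [seq l - i | l <- t]); first last.
  - move=> j hj; have [h|h] := ltP j Ng; first by rewrite hg // scale0r.
    rewrite hx ?scaler0 //; rewrite ltNge; apply: contra hj => hj.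
    apply/mapP; exists (j + i); last by rewrite addrK.
    by rewrite mem_zrange; move: i1 h hj; lia.
  - by rewrite map_inj_uniq ?zrange_uniq // => a b /addIr.
  rewrite big_map scaler_sumr; apply: eq_bigr => l _.
  by congr (_ *: (_ *: x _)); lia.
rewrite exchange_big /=; apply: eq_big_seq => l; rewrite mem_zrange => /andP[l1 l2].
rewrite (@convE _ k^o f g l s) ?zrange_uniq //; last first.
  move=> i; rewrite mem_zrange negb_and -!ltNge => /orP[/hf ->|h].
    by rewrite scale0r.
  by rewrite hg ?scaler0 //; move: l2 h; lia.
by rewrite scaler_suml; apply: eq_bigr => i _; rewrite scalerA.
Qed.

End Assoc.

Section Ring.
Variable k : fieldType.
Implicit Types f g h : laurent k.

Fact mono_bounded (c : k) (m : int) :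
  exists N : int, forall n : int, n < N -> (if n == m then c else 0) = 0.
Proof. by exists m => n /lt_eqF ->. Qed.
(* c u^m *)
Definition lmono (c : k) (m : int) : laurent k := Laurent (mono_bounded c m).

Lemma lscale_mono (V : lmodType k) (c : k) m (x : laurent V) n :
  lscale (lmono c m) x n = c *: x (n - m).
Proof.
rewrite /= (@convE _ _ _ _ _ [:: m]) //= ?big_seq1 ?eqxx // => i.
by rewrite inE => /negPf ->; rewrite scale0r.
Qed.

Definition lmul f g : laurent k := @lscale k k^o f g.

Fact lmulC : commutative lmul.
Proof.
move=> f g; have [N hN] := coef_bounded f; have [M hM] := coef_bounded g.
apply: laurentP => n; rewrite /= (@convEr _ k^o _ _ _ _ _ hN hM).
rewrite (@convE _ k^o g f n [seq n - i | i <- zrange N (n - M)]).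
- by rewrite [RHS]big_map; apply: eq_bigr => i _; rewrite subKr /GRing.scale /= mulrC.
- by rewrite map_inj_uniq ?zrange_uniq // => a b /addrI/oppr_inj.
move=> i hi; have [h|h] := ltP i M; first by rewrite hM // scale0r.
rewrite hN ?scaler0 // ltNge; apply: contra hi => hi.
apply/mapP; exists (n - i); last by rewrite subKr.
by rewrite mem_zrange hi /= lerD2l lerN2.
Qed.
Fact lmulA : associative lmul.
Proof. by move=> f g h; exact: (@lscaleA k k^o f g h). Qed.
Fact lmul1 : left_id (lmono 1 0) lmul.
Proof. by move=> f; apply: laurentP => n; rewrite lscale_mono subr0 scale1r. Qed.
Fact lmulDl : left_distributive lmul +%R.
Proof. by move=> f g h; rewrite /lmul lscaleDl. Qed.
Fact lone_neq0 : lmono 1 0 != 0.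
Proof.
by apply/eqP => /(congr1 (fun f : laurent k => f 0)) /= /eqP; rewrite oner_eq0.
Qed.
HB.instance Definition _ :=
  GRing.Zmodule_isComNzRing.Build (laurent k) lmulA lmulC lmul1 lmulDl lone_neq0.

End Ring.

Section Field.
Variable k : fieldType.
Implicit Types f g : laurent k.

Lemma coefM f g n : (f * g) n = @conv k k^o f g n. Proof. by []. Qed.

Lemma lmonoM (c d : k) m n : lmono c m * lmono d n = lmono (c * d) (m + n).
Proof.
apply: laurentP => i; rewrite [LHS](@lscale_mono k k^o) /=.
by rewrite subr_eq addrC; case: eqP => _; rewrite /GRing.scale /= ?mulr0.
Qed.

Lemma lmonoD (c d : k) m : lmono (c + d) m = lmono c m + lmono d m.
Proof. by apply: laurentP => i /=; case: eqP; rewrite ?addr0. Qed.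

Lemma lmono1 : lmono 1 0 = 1 :> laurent k. Proof. by []. Qed.

Fixpoint inv_seq (a : nat -> k) n : seq k :=
  if n is m.+1 then
    rcons (inv_seq a m)
      (- (a 0%N)^-1 * \sum_(i < n) a i.+1 * (inv_seq a m)`_(m - i))
  else [:: (a 0%N)^-1].

Lemma size_inv_seq a n : size (inv_seq a n) = n.+1.
Proof. by elim: n => // n IH; rewrite /= size_rcons IH. Qed.

Lemma nth_inv_seq a m n : (m <= n)%N -> (inv_seq a n)`_m = (inv_seq a m)`_m.
Proof.
move=> h; elim: n h => [|n IH]; first by rewrite leqn0 => /eqP ->.
rewrite leq_eqVlt => /orP[/eqP -> //|h].
by rewrite [inv_seq a n.+1]/= nth_rcons size_inv_seq h IH.
Qed.

Lemma inv_seqP a n : a 0%N != 0 ->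
  \sum_(i < n.+1) a i * (inv_seq a (n - i))`_(n - i) = (n == 0%N)%:R.
Proof.
move=> a0; case: n => [|n]; first by rewrite big_ord1 /= divff.
rewrite big_ord_recl subn0 [inv_seq _ _]/= nth_rcons size_inv_seq ltnn eqxx.
rewrite mulrA mulrN divff // mulN1r; apply/eqP; rewrite addrC subr_eq0; apply/eqP.
apply: eq_bigr => i _; rewrite lift0 subSS; congr (_ * _).
by rewrite [RHS]nth_inv_seq // leq_subr.
Qed.

Lemma lmul_invertible f : f != 0 -> exists g, g * f = 1.
Proof.
move=> f0; have [B hB] := coef_bounded f.
have ex : exists j : nat, f (B + j%:Z) != 0.
  apply/not_existsP => h; move/eqP: f0; apply; apply: laurentP => n; rewrite coef0.
  have [/hB //|h2] := ltP n B.
  have := h `|n - B|%N => /negP; rewrite negbK => /eqP <-; congr (f _); lia.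
have [m fm minm] := ex_minnP ex.
have [N eN] : exists N : int, N = B + m%:Z by exists (B + m%:Z).
have hN i : i < N -> f i = 0.
  move=> hi; have [/hB //|h2] := ltP i B.
  apply/eqP/negPn/negP => h; have := minm `|i - B|%N.
  have -> : B + `|i - B|%N = i by lia.
  by move=> /(_ h); move: eN hi h2; lia.
pose a (j : nat) := f (N + j%:Z).
have a0 : a 0%N != 0 by rewrite /a addr0 eN.
pose h (n : int) : k := if 0 <= n + N then (inv_seq a `|(n + N)%R|%N)`_`|(n + N)%R|%N else 0.
have hh n : n < - N -> h n = 0 by move=> hn; rewrite /h ifF //; lia.
have hb : exists M : int, forall n : int, n < M -> h n = 0 by exists (- N).
exists (Laurent hb); rewrite mulrC; apply: laurentP => n.
rewrite coefM (@convEr k k^o f (Laurent hb) n N (- N)) //= big_map.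
have [n0|n0] := ltP n 0.
  have -> : `|Num.max (0%R : int) (n - - N - N + 1)%R|%N = 0%N by lia.
  by rewrite big_nil lt_eqF.
have -> : `|Num.max (0%R : int) (n - - N - N + 1)%R|%N = `|n|%N.+1 by lia.
rewrite -[iota 0 _]/(index_iota 0 `|n|%N.+1) big_mkord.
transitivity ((`|n|%N == 0%N)%:R : k); last by rewrite absz_eq0; case: eqP.
rewrite -(inv_seqP _ a0); apply: eq_bigr => i _; rewrite /GRing.scale /=; congr (_ * _).
rewrite /h; have lei := ltn_ord i; rewrite ifT; last by lia.
by have -> : `|(n - (N + i%:Z) + N)%R|%N = (`|n| - i)%N by lia.
Qed.

Definition linv f : laurent k := xget 0 [set g | f != 0 /\ g * f = 1].

Fact lmulVf f : f != 0 -> linv f * f = 1.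
Proof.
move=> f0; have [g hg] := lmul_invertible f0.
by rewrite /linv; case: xgetP => [_ _ []//|/(_ g)]; case.
Qed.
Fact linv0 : linv 0 = 0.
Proof. by rewrite /linv; case: xgetP => // g _ []; rewrite eqxx. Qed.

HB.instance Definition _ := GRing.ComNzRing_isField.Build (laurent k) lmulVf linv0.

End Field.

Section Lmod.
Variables (k : fieldType) (V : lmodType k).
Fact lscale1 : left_id (1 : laurent k) (@lscale k V).
Proof. by move=> x; apply: laurentP => n; rewrite lscale_mono subr0 scale1r. Qed.
Fact lscaleA' (f g : laurent k) (x : laurent V) :
  lscale f (lscale g x) = lscale (f * g) x.
Proof. exact: lscaleA. Qed.
HB.instance Definition _ := GRing.Zmodule_isLmodule.Build (laurent k) (laurent V)
  lscaleA' lscale1 (@lscaleDr k V) (@lscaleDl k V).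

Lemma scale_lmono (c : k) m (x : laurent V) n : (lmono c m *: x) n = c *: x (n - m).
Proof. exact: lscale_mono. Qed.
End Lmod.

Section Deriv.
Variable V : zmodType.
Fact deriv_bounded (x : laurent V) :
  exists N : int, forall n : int, n < N -> x (n + 1) *~ (n + 1) = 0.
Proof.
have [N hN] := coef_bounded x; exists (N - 1) => n hn.
by rewrite hN ?mul0rz // -ltrBrDr.
Qed.
(* d/du, acting on the powers of u only *)
Definition lderiv (x : laurent V) : laurent V := Laurent (deriv_bounded x).
End Deriv.

Section Map.
Variables (V W : zmodType) (f : {additive V -> W}).
Fact map_bounded (x : laurent V) : exists N : int, forall n : int, n < N -> f (x n) = 0.
Proof. by have [N hN] := coef_bounded x; exists N => n /hN ->; rewrite raddf0. Qed.
Definition lmap (x : laurent V) : laurent W := Laurent (map_bounded x).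
End Map.

Section Neg.
Variable k : fieldType.
Fact neg_bounded (f : laurent k) : exists N : int, forall n : int, n < N -> (-1) ^ n * f n = 0.
Proof. by have [N hN] := coef_bounded f; exists N => n /hN ->; rewrite mulr0. Qed.
(* f(u) |-> f(-u) *)
Definition lneg (f : laurent k) : laurent k := Laurent (neg_bounded f).

Lemma lneg_additive : additive lneg.
Proof. by move=> f g; apply: laurentP => n; rewrite coefD coefN /= mulrBr. Qed.

Lemma lneg_mul : monoid_morphism lneg.
Proof.
split=> [|f g]; apply: laurentP => n.
  by rewrite -lmono1 /=; case: eqP => [->|]; rewrite ?mulr0 // expr0z mulr1.
have [N hN] := coef_bounded f; have [M hM] := coef_bounded g.
have hN' i : i < N -> lneg f i = 0 by move=> h; rewrite /= hN // mulr0.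
have hM' i : i < M -> lneg g i = 0 by move=> h; rewrite /= hM // mulr0.
rewrite [LHS]/= !coefM (@convEr k k^o _ _ _ _ _ hN hM) (@convEr k k^o _ _ _ _ _ hN' hM').
rewrite mulr_sumr; apply: eq_bigr => i _; rewrite /GRing.scale /= mulrACA; congr (_ * _).
by rewrite -expfzDr ?oppr_eq0 ?oner_eq0 // addrC subrK.
Qed.
HB.instance Definition _ := GRing.isZmodMorphism.Build (laurent k) (laurent k) lneg lneg_additive.
HB.instance Definition _ := GRing.isMonoidMorphism.Build (laurent k) (laurent k) lneg lneg_mul.

Lemma lnegK : involutive lneg.
Proof.
move=> f; apply: laurentP => n /=.
by rewrite mulrA -expfzMl mulrNN mulr1 exp1rz mul1r.
Qed.

Lemma lneg_deriv f : lneg (lderiv f) = - lderiv (lneg f).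
Proof.
apply: laurentP => n; rewrite coefN /= expfzDr ?oppr_eq0 ?oner_eq0 // expr1z.
by rewrite mulrN1 mulNr mulNrz opprK mulrzAr.
Qed.
End Neg.

(* The uniformizer u. *)
Definition lunif {k : fieldType} : laurent k := lmono 1 1.

Definition power_series (k : fieldType) (f : laurent k) :=
  forall n : int, n < 0 -> f n = 0.

Section KSpace.
Variables (k : fieldType) (M : lmodType (laurent k)).
(* M seen as a k-vector space, so that M((z')) = [laurent (kspace M)] is a     *)
(* vector space over k((z')) on which u in k((u)) still acts coefficientwise.  *)
Definition kspace : Type := M.
HB.instance Definition _ := GRing.Zmodule.on kspace.
Definition kscale (c : k) (m : kspace) : kspace := lmono c 0 *: (m : M).
Fact kscaleA a b v : kscale a (kscale b v) = kscale (a * b) v.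
Proof. by rewrite /kscale scalerA lmonoM addr0. Qed.
Fact kscale1 : left_id 1 kscale.
Proof. by move=> v; rewrite /kscale lmono1 scale1r. Qed.
Fact kscaleDr : right_distributive kscale +%R.
Proof. by move=> a v w; rewrite /kscale scalerDr. Qed.
Fact kscaleDl v : {morph kscale^~ v : a b / a + b}.
Proof. by move=> a b; rewrite /kscale lmonoD scalerDl. Qed.
HB.instance Definition _ :=
  GRing.Zmodule_isLmodule.Build k kspace kscaleA kscale1 kscaleDr kscaleDl.
End KSpace.

Record category := Category {
  ob :> Type;
  mor : ob -> ob -> Type;
  idm : forall x, mor x x;
  comp : forall x y z, mor y z -> mor x y -> mor x z;
  comp1m : forall x y (f : mor x y), comp (idm y) f = f;
  compm1 : forall x y (f : mor x y), comp f (idm x) = f;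
  compA : forall x y z t (h : mor z t) (g : mor y z) (f : mor x y),
    comp h (comp g f) = comp (comp h g) f }.
Arguments mor {c}.
Arguments idm {c}.
Arguments comp {c x y z}.

Record functor (C D : category) := Functor {
  fob :> C -> D;
  fmor : forall x y, mor x y -> mor (fob x) (fob y);
  fmor1 : forall x, fmor (idm x) = idm (fob x);
  fmorM : forall x y z (g : mor y z) (f : mor x y),
    fmor (comp g f) = comp (fmor g) (fmor f) }.
Arguments fmor {C D} _ {x y} _.

Definition id_functor (C : category) : functor C C :=
  @Functor C C (fun x => x) (fun x y f => f) (fun=> erefl) (fun _ _ _ _ _ => erefl).

Section CompFunctor.
Variables (C D E : category) (G : functor D E) (F : functor C D).
Fact comp_functor1 x : fmor G (fmor F (idm x)) = idm (G (F x)).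
Proof. by rewrite !fmor1. Qed.
Fact comp_functorM x y z (g : mor y z) (f : mor x y) :
  fmor G (fmor F (comp g f)) = comp (fmor G (fmor F g)) (fmor G (fmor F f)).
Proof. by rewrite !fmorM. Qed.
Definition comp_functor : functor C E :=
  @Functor C E (fun x => G (F x)) (fun x y f => fmor G (fmor F f))
    comp_functor1 comp_functorM.
End CompFunctor.

Definition nat_iso (C D : category) (F G : functor C D) : Prop :=
  exists (eta : forall x, mor (F x) (G x)) (eps : forall x, mor (G x) (F x)),
    [/\ forall x y (f : mor x y), comp (eta y) (fmor F f) = comp (fmor G f) (eta x),
        forall x, comp (eps x) (eta x) = idm (F x) &
        forall x, comp (eta x) (eps x) = idm (G x)].

Definition quasi_inverse (C D : category) (F : functor C D) (G : functor D C) :=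
  nat_iso (comp_functor G F) (id_functor C) /\
  nat_iso (comp_functor F G) (id_functor D).

Definition is_equivalence (C D : category) (F : functor C D) :=
  exists G : functor D C, quasi_inverse F G.

Definition full_subcat (C : category) (P : C -> Prop) : category :=
  @Category {x : C | P x} (fun x y => mor (sval x) (sval y))
    (fun x => idm (sval x)) (fun x y z => @comp C (sval x) (sval y) (sval z))
    (fun x y => @comp1m C (sval x) (sval y)) (fun x y => @compm1 C (sval x) (sval y))
    (fun x y z t => @compA C (sval x) (sval y) (sval z) (sval t)).

Definition sub_incl (C : category) (P : C -> Prop) : functor (full_subcat P) C :=
  @Functor (full_subcat P) C (fun x => sval x) (fun x y f => f)
    (fun=> erefl) (fun _ _ _ _ _ => erefl).

Definition corestrict (C D : category) (P : D -> Prop) (F : functor C D)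
    (hF : forall x, P (F x)) : functor C (full_subcat P) :=
  @Functor C (full_subcat P) (fun x => exist P (F x) (hF x))
    (fun x y f => fmor F f) (fmor1 F) (@fmorM _ _ F).

Record connection (k : fieldType) := Connection {
  carrier :> vectType (laurent k);
  nabla : {additive carrier -> carrier};
  leibniz : forall (f : laurent k) (m : carrier),
    nabla (f *: m) = lderiv f *: m + f *: nabla m }.

Record horizontal (k : fieldType) (M N : connection k) := Horizontal {
  hfun :> 'Hom(M, N);
  hfunP : forall m, hfun (nabla M m) = nabla N (hfun m) }.

Section ConnCat.
Variable k : fieldType.

Lemma horizontal_eq (M N : connection k) (f g : horizontal M N) :
  (forall m, f m = g m) -> f = g.
Proof.
case: f g => [f hf] [g hg] /= /lfunP e; subst g.
by congr Horizontal; apply: Prop_irrelevance.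
Qed.

Fact hid_subproof (M : connection k) m :
  (\1%VF : 'Hom(M, M)) (nabla M m) = nabla M ((\1%VF : 'Hom(M, M)) m).
Proof. by rewrite !id_lfunE. Qed.
Definition hid (M : connection k) : horizontal M M := Horizontal (@hid_subproof M).

Fact hcomp_subproof (M N P : connection k) (g : horizontal N P) (f : horizontal M N) m :
  (g \o f)%VF (nabla M m) = nabla P ((g \o f)%VF m).
Proof. by rewrite !comp_lfunE !hfunP. Qed.
Definition hcomp (M N P : connection k) (g : horizontal N P) (f : horizontal M N) :
  horizontal M P := Horizontal (hcomp_subproof g f).

Fact hcomp1m (M N : connection k) (f : horizontal M N) : hcomp (hid N) f = f.
Proof. by apply: horizontal_eq => m; rewrite /= comp_lfun1l. Qed.
Fact hcompm1 (M N : connection k) (f : horizontal M N) : hcomp f (hid M) = f.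
Proof. by apply: horizontal_eq => m; rewrite /= comp_lfun1r. Qed.
Fact hcompA (M N P Q : connection k) (h : horizontal P Q) (g : horizontal N P)
    (f : horizontal M N) : hcomp h (hcomp g f) = hcomp (hcomp h g) f.
Proof. by apply: horizontal_eq => m; rewrite /= comp_lfunA. Qed.

Definition conn_cat : category := Category hcomp1m hcompm1 hcompA.

End ConnCat.

Section Invariants.
Variables (k : fieldType) (M : connection k).

Definition no_horizontal_sections := forall m : M, nabla M m = 0 -> m = 0.

(* Slopes are read off the Newton polygon of a monic operator sum_i P_i theta^i *)
(* (theta = u d_u) annihilating a cyclic vector: the polynomial P only stores  *)
(* the coefficients, which act on the left. The polygon is the convex hull of  *)
(* the quadrants {(x, y) | x <= i, y >= ord P_i}, cut at x >= 0; its vertices  *)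
(* have integral abscissa, and s is a slope when a supporting line of slope s  *)
(* meets it at two different abscissas (this forces 0 <= s).                   *)
Definition theta (m : M) : M := lunif *: nabla M m.

Definition has_order (f : laurent k) (n : int) :=
  f n <> 0 /\ forall i : int, i < n -> f i = 0.

Definition newton_region (P : {poly laurent k}) (i : nat) (y : rat) :=
  exists (j : nat) (n : int), [/\ (i <= j)%N, has_order P`_j n & n%:Q <= y].

Definition newton_slope (P : {poly laurent k}) (s : rat) :=
  exists c : rat,
    (forall i y, newton_region P i y -> c + s * i%:R <= y) /\
    exists i j : nat, [/\ (i < j)%N, newton_region P i (c + s * i%:R)
                        & newton_region P j (c + s * j%:R)].

Definition cyclic_vector (e : M) :=
  basis_of fullv (mkseq (fun i => iter i theta e) (\dim {:M})).

Definition is_slope (s : rat) :=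
  exists (e : M) (P : {poly laurent k}),
    [/\ cyclic_vector e, P \is monic, size P = (\dim {:M}).+1,
        \sum_(i < size P) P`_i *: iter i theta e = 0 & newton_slope P s].

Definition all_slopes_lt1 := forall s : rat, is_slope s -> s < 1.

(* A finitely generated k[[u]]-submodule spanning M over k((u)). *)
Definition is_lattice (V : set M) :=
  exists (n : nat) (e : n.-tuple M), <<e>>%VS = fullv /\
    V = [set m | exists2 a : 'I_n -> laurent k,
                   forall i, power_series (a i) & m = \sum_i a i *: e`_i].

(* (1/u) W *)
Definition div_unif (W : set M) : set M := [set m | W (lunif *: m)].

(* The inclusion of the subcomplex A -> B of M -> M is a quasi-isomorphism: A   *)
(* contains all of ker nabla (H^0), and B/nabla(A) -> M/nabla(M) is injective  *)
(* and surjective (H^1).                                                       *)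
Definition nabla_quasi_iso (A B : set M) :=
  [/\ forall m, A m -> B (nabla M m),
      forall m, nabla M m = 0 -> A m,
      forall b, B b -> (exists m, b = nabla M m) -> exists2 a, A a & b = nabla M a &
      forall m, exists2 b, B b & exists m', m - b = nabla M m'].

Definition good_lattice_pair (V W : set M) :=
  [/\ is_lattice V, is_lattice W, V `<=` W,
      forall v, V v -> W (lunif *: nabla M v) &
      nabla_quasi_iso V (div_unif W)].

(* V((z')) as a subset of M((z')) *)
Definition series_in (V : set M) : set (laurent (kspace M)) :=
  [set x | forall n, V (x n)].

End Invariants.

Definition series_map (k : fieldType) (M N : connection k) (f : {additive M -> N}) :
  laurent (kspace M) -> laurent (kspace N) := @lmap M N f.

Definition scale_by (k : fieldType) (M : connection k) (f : laurent k) :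
  {additive M -> M} := *:%R f.

Definition nohor_cat (k : fieldType) : category :=
  @full_subcat (conn_cat k) (@no_horizontal_sections k).

Definition nohor_lt1_cat (k : fieldType) : category :=
  @full_subcat (conn_cat k)
    (fun M => no_horizontal_sections M /\ all_slopes_lt1 M).

(* p exhibits N as the cokernel of phi : A -> B, for subspaces A, B of X; the  *)
(* values of p outside B are irrelevant.                                       *)
Definition is_coker (R : nzRingType) (X N : lmodType R) (A B : set X)
    (phi : X -> X) (p : X -> N) :=
  [/\ forall c x y, B x -> B y -> p (c *: x + y) = c *: p x + p y,
      forall n, exists2 x, B x & p x = n &
      forall x, B x -> (p x = 0 <-> exists2 a, A a & x = phi a)].

Section NegSpace.
Import VectorInternalTheory.
Variables (k : fieldType) (M : vectType (laurent k)).
(* M with f(u) acting as f(-u); with -nabla, this is the pullback of M under    *)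
(* the change of variable u |-> -u.                                            *)
Definition neg_space : Type := M.
HB.instance Definition _ := GRing.Zmodule.on neg_space.
Definition neg_scale (f : laurent k) (m : neg_space) : neg_space := lneg f *: (m : M).
Fact neg_scaleA f g v : neg_scale f (neg_scale g v) = neg_scale (f * g) v.
Proof. by rewrite /neg_scale scalerA rmorphM. Qed.
Fact neg_scale1 : left_id 1 neg_scale.
Proof. by move=> v; rewrite /neg_scale rmorph1 scale1r. Qed.
Fact neg_scaleDr : right_distributive neg_scale +%R.
Proof. by move=> f v w; rewrite /neg_scale scalerDr. Qed.
Fact neg_scaleDl v : {morph neg_scale^~ v : f g / f + g}.
Proof. by move=> f g; rewrite /neg_scale rmorphD scalerDl. Qed.
HB.instance Definition _ := GRing.Zmodule_isLmodule.Build (laurent k) neg_space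
  neg_scaleA neg_scale1 neg_scaleDr neg_scaleDl.
Lemma neg_scaleE (f : laurent k) (m : neg_space) : f *: m = lneg f *: (m : M).
Proof. by []. Qed.

Definition neg_v2r (m : neg_space) : 'rV[laurent k]_(dim M) :=
  map_mx (@lneg k) (v2r (m : M)).
Fact neg_v2r_linear : linear neg_v2r.
Proof.
move=> f m m'; have e : v2r (lneg f *: (m : M) + (m' : M))
    = lneg f *: v2r (m : M) + v2r (m' : M).
  by rewrite linearP.
by rewrite /neg_v2r [X in map_mx _ X]e map_mxD map_mxZ /= lnegK.
Qed.
Fact neg_v2r_bij : bijective neg_v2r.
Proof.
pose g (w : 'rV[laurent k]_(dim M)) : neg_space := (r2v (map_mx (@lneg k) w) : M).
exists g => [m|w]; rewrite /g.
  rewrite /neg_v2r -map_mx_comp map_mx_id_in ?v2rK //.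
  by move=> i j /=; rewrite lnegK.
rewrite /neg_v2r r2vK -map_mx_comp map_mx_id_in //.
by move=> i j /=; rewrite lnegK.
Qed.
HB.instance Definition _ := Lmodule_hasFinDim.Build (laurent k) neg_space
  (exist2 _ _ neg_v2r neg_v2r_linear neg_v2r_bij).
End NegSpace.

Section NegPullback.
Variable k : fieldType.

Section Obj.
Variable M : connection k.
Definition neg_nabla (m : neg_space M) : neg_space M := - nabla M m.
Fact neg_nabla_additive : additive neg_nabla.
Proof. by move=> m m'; rewrite /neg_nabla raddfB opprB opprK addrC. Qed.
HB.instance Definition _ := GRing.isZmodMorphism.Build
  (neg_space M) (neg_space M) neg_nabla neg_nabla_additive.
Fact neg_leibniz (f : laurent k) (m : neg_space M) :
  neg_nabla (f *: m) = lderiv f *: m + f *: neg_nabla m.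
Proof.
rewrite /neg_nabla !neg_scaleE leibniz lneg_deriv opprD scaleNr.
by congr (_ + _); rewrite scalerN.
Qed.
Definition neg_connection : connection k :=
  @Connection k (neg_space M) neg_nabla neg_leibniz.
End Obj.

Section Mor.
Variables (M N : connection k) (f : horizontal M N).
Definition neg_fun (m : neg_space M) : neg_space N := f m.
Fact neg_fun_linear : linear neg_fun.
Proof. by move=> a m m'; rewrite /neg_fun neg_scaleE linearP. Qed.
HB.instance Definition _ := GRing.isLinear.Build (laurent k)
  (neg_space M) (neg_space N) _ neg_fun neg_fun_linear.
Fact neg_funP (m : neg_connection M) :
  linfun neg_fun (nabla (neg_connection M) m) =
  nabla (neg_connection N) (linfun neg_fun m).
Proof.
have e : f (- nabla M (m : M)) = - nabla N (f (m : M)) by rewrite linearN; congr (- _); exact: hfunP.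
by rewrite !lfunE.
Qed.
Definition neg_horizontal : horizontal (neg_connection M) (neg_connection N) :=
  @Horizontal k (neg_connection M) (neg_connection N) (linfun neg_fun) neg_funP.
End Mor.

Fact neg_horizontal1 (M : connection k) :
  neg_horizontal (hid M) = hid (neg_connection M).
Proof. by apply: horizontal_eq => m; rewrite /= !lfunE /= /neg_fun lfunE. Qed.
Fact neg_horizontalM (M N P : connection k) (g : horizontal N P) (f : horizontal M N) :
  neg_horizontal (hcomp g f) = hcomp (neg_horizontal g) (neg_horizontal f).
Proof.
apply: horizontal_eq => m; rewrite /= comp_lfunE !lfunE /= /neg_fun /=.
by rewrite comp_lfunE.
Qed.
Definition neg_pullback : functor (conn_cat k) (conn_cat k) :=
  @Functor (conn_cat k) (conn_cat k) neg_connection neg_horizontal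
    neg_horizontal1 neg_horizontalM.

Fact neg_pullback_subproof (M : nohor_cat k) :
  no_horizontal_sections (neg_pullback (sval M)).
Proof. by move=> m /eqP; rewrite /= oppr_eq0 => /eqP; apply: (svalP M). Qed.

Definition neg_pullback_nohor : functor (nohor_cat k) (nohor_cat k) :=
  @corestrict _ _ _ (comp_functor neg_pullback (sub_incl _)) neg_pullback_subproof.

End NegPullback.

(* The functors F(0,oo) and F(oo,0) are only defined up to the choice of       *)
(* lattices and of a model of each cokernel, so they are specified: a functor  *)
(* is a model of F(0,oo) (resp. F(oo,0)) when its values carry, for EVERY      *)
(* admissible choice of lattices, a projection exhibiting them as the cokernel *)
(* with its induced connection, these projections being compatible with        *)
(* horizontal maps that respect the lattices. For the identity map the latter  *)
(* says that the cokernels for different lattices are identified by the        *)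
(* isomorphisms induced by inclusions of lattices.                             *)
Section Fourier.
Variable k : fieldType.

(* z' d_t + 1 *)
Definition phi_0_inf (M : connection k) (x : laurent (kspace M)) :=
  (lunif : laurent k) *: series_map (nabla M) x + x.

(* z'^2 d_z' - t *)
Definition conn_0_inf (M : connection k) (x : laurent (kspace M)) :=
  (lunif ^+ 2 : laurent k) *: lderiv x - series_map (@scale_by k M lunif) x.

Definition is_local_fourier_0_inf (F : functor (nohor_cat k) (conn_cat k)) :=
  exists p : forall (M : nohor_cat k) (V W : set (sval M)),
      laurent (kspace (sval M)) -> (F M : connection k),
    (forall (M : nohor_cat k) (V W : set (sval M)), good_lattice_pair V W ->
       is_coker (series_in V) (series_in (div_unif W)) (@phi_0_inf (sval M)) (p M V W)
       /\ forall x, series_in (div_unif W) x ->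
            lunif ^+ 2 *: nabla (F M) (p M V W x) = p M V W (conn_0_inf x))
    /\ forall (M M' : nohor_cat k) (f : horizontal (sval M) (sval M'))
         (V W : set (sval M)) (V' W' : set (sval M')),
         good_lattice_pair V W -> good_lattice_pair V' W' ->
         (forall v, V v -> V' (f v)) -> (forall w, W w -> W' (f w)) ->
         forall x, series_in (div_unif W) x ->
           (fmor F (f : mor M M') : horizontal (F M) (F M')) (p M V W x) =
           p M' V' W' (series_map f x).

(* - z^2 d_z + t' *)
Definition phi_inf_0 (M : connection k) (x : laurent (kspace M)) :=
  - series_map (@scale_by k M (lunif ^+ 2)) (series_map (nabla M) x)
  + (lunif : laurent k) *: x.

(* d_t' + 1/z *)
Definition conn_inf_0 (M : connection k) (x : laurent (kspace M)) :=
  lderiv x + series_map (@scale_by k M lunif^-1) x.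

Definition admissible_inf (M : connection k) (V : set M) :=
  (exists W, good_lattice_pair V W) /\
  forall v, V v -> V (lunif ^+ 2 *: nabla M v).

(* d_t' + 1/z sends V((t')) to (1/z)V((t')); the derivative of the class of x  *)
(* is the class of an x' in V((t')) with the same image as (d_t' + 1/z) x in   *)
(* the cokernel formed with (1/z)V.                                            *)
Definition is_local_fourier_inf_0 (G : functor (nohor_lt1_cat k) (conn_cat k)) :=
  exists p : forall (N : nohor_lt1_cat k) (V : set (sval N)),
      laurent (kspace (sval N)) -> (G N : connection k),
    (forall (N : nohor_lt1_cat k) (V : set (sval N)), admissible_inf V ->
       is_coker (series_in V) (series_in V) (@phi_inf_0 (sval N)) (p N V)
       /\ forall x, series_in V x ->
            exists x' y, [/\ series_in V x', series_in (div_unif V) y,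
              x' = conn_inf_0 x + phi_inf_0 y & nabla (G N) (p N V x) = p N V x'])
    /\ forall (N N' : nohor_lt1_cat k) (f : horizontal (sval N) (sval N'))
         (V : set (sval N)) (V' : set (sval N')),
         admissible_inf V -> admissible_inf V' ->
         (forall v, V v -> V' (f v)) ->
         forall x, series_in V x ->
           (fmor G (f : mor N N') : horizontal (G N) (G N')) (p N V x) =
           p N' V' (series_map f x).

End Fourier.

(* Main.v *)
(* Both transforms keep the underlying k-vector space. As 1 + z' d_t has cokernel
   "evaluation of the series at z' = - d_t^-1", F(0,oo)(M) is M itself with z' acting
   as - d_t^-1 and z'^2 d_z' as - t; likewise F(oo,0)(N) is N with t' acting as z^2 d_z
   and d_t' as 1/z. Evaluation makes sense because these operators are topologically
   nilpotent: d_t^-1 since (V, W) is a good lattice pair, which gives d_t^-1 (1/t) W = V,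
   and z^2 d_z since the slopes of N are < 1. Up to t' = - t the two recipes undo each
   other. The lattices come from cyclic vectors; a functor satisfying the specification
   is isomorphic to the model above by the universal property of cokernels, once the
   lattices are shrunk so that horizontal maps respect them. *)
From HB Require Import structures.
From mathcomp Require Import all_boot all_order all_algebra ssrAC.
From mathcomp Require Import zify ring lra.
From mathcomp Require Import boolp classical_sets.
Require Import Defs.
Set Implicit Arguments. Unset Strict Implicit. Unset Printing Implicit Defensive.
Import Order.TTheory GRing.Theory Num.Theory.
Local Open Scope classical_set_scope.
Local Open Scope ring_scope.

(** * Laurent series *)

Section PowerSeries.
Variable k : fieldType.
Implicit Types f g : laurent k.

Lemma lmono0 m : lmono (0 : k) m = 0.
Proof. by apply: laurentP => n /=; case: eqP. Qed.

Lemma lmonoN (c : k) m : lmono (- c) m = - lmono c m.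
Proof. by apply/eqP; rewrite -subr_eq0 opprK -lmonoD addNr lmono0. Qed.

Lemma lmono_sum (I : Type) (r : seq I) (c : I -> k) m :
  lmono (\sum_(i <- r) c i) m = \sum_(i <- r) lmono (c i) m.
Proof. by elim/big_rec2: _ => [|i x y _ <-]; rewrite ?lmono0 ?lmonoD. Qed.

Lemma lmono1M m n : lmono (1 : k) m * lmono 1 n = lmono 1 (m + n).
Proof. by rewrite lmonoM mulr1. Qed.

Lemma lmono1K m : cancel ( *%R (lmono (1 : k) m)) ( *%R (lmono 1 (- m))).
Proof. by move=> x; rewrite mulrA lmono1M addNr mul1r. Qed.

Lemma lmono_neq0 (c : k) m : c != 0 -> lmono c m != 0.
Proof.
move=> c0; apply/eqP => /(congr1 (fun f : laurent k => f m)) /=.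
by rewrite eqxx => /eqP; apply/negP.
Qed.

Lemma lmono_coef (c : k) m f n : (lmono c m * f) n = c * f (n - m).
Proof. exact: (@lscale_mono k k^o). Qed.

Lemma lunifX n : (lunif : laurent k) ^+ n = lmono 1 n%:Z.
Proof. by elim: n => // n IH; rewrite exprS IH lmono1M; congr lmono; lia. Qed.

Lemma lunifE : (lunif : laurent k) = lmono 1 1. Proof. by []. Qed.

Lemma lunif_neq0 : (lunif : laurent k) != 0.
Proof. exact/lmono_neq0/oner_neq0. Qed.

Lemma lunifV : (lunif : laurent k)^-1 = lmono 1 (- 1).
Proof.
apply: (mulfI lunif_neq0); rewrite divff ?lunif_neq0 //.
by rewrite lmono1M subrr.
Qed.

Lemma lderiv_mono (c : k) m : lderiv (lmono c m) = lmono (c *~ m) (m - 1).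
Proof.
apply: laurentP => n /=; rewrite eq_sym [in RHS]eq_sym subr_eq.
by case: eqP => [->|_]; rewrite ?mul0rz.
Qed.

Lemma psD f g : power_series f -> power_series g -> power_series (f + g).
Proof. by move=> hf hg n n0; rewrite coefD hf // hg // addr0. Qed.
Lemma psN f : power_series f -> power_series (- f).
Proof. by move=> hf n n0; rewrite coefN hf // oppr0. Qed.

Lemma ps_mono (c : k) m : 0 <= m -> power_series (lmono c m).
Proof. by move=> m0 n n0 /=; case: eqP => // e; move: m0; rewrite -e leNgt n0. Qed.
Lemma ps1 : power_series (1 : laurent k). Proof. exact: ps_mono. Qed.
Lemma ps_unif : power_series (lunif : laurent k). Proof. exact: ps_mono. Qed.

Lemma psM f g : power_series f -> power_series g -> power_series (f * g).
Proof.
move=> hf hg n n0; rewrite coefM (@convEr k k^o f g n 0 0) // big1_seq // => i.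
by rewrite mem_zrange => /andP[_ ?]; exfalso; lia.
Qed.

Lemma psM0 f g : power_series f -> power_series g -> (f * g) 0 = f 0 * g 0.
Proof.
move=> hf hg; rewrite coefM (@convE k k^o f g 0 [:: 0]) ?big_seq1 ?subr0 //.
move=> i; rewrite inE => i0; have [h|h] := ltP i 0; first by rewrite hf // scale0r.
by rewrite hg ?scaler0 // sub0r oppr_lt0 lt_neqAle eq_sym i0.
Qed.

Lemma ps_deriv f : power_series f -> power_series (lderiv f).
Proof.
move=> hf n n0 /=; have [->|n1] := eqVneq n (- 1); first by rewrite addNr mulr0z.
by rewrite hf ?mul0rz //; lia.
Qed.

Lemma coef_sum (V : zmodType) (I : Type) (r : seq I) (P : pred I) (F : I -> laurent V) n :
  (\sum_(i <- r | P i) F i) n = \sum_(i <- r | P i) F i n.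
Proof. by elim/big_rec2: _ => // i x y _ <-. Qed.

Lemma ps_split f : power_series f ->
  exists2 g, power_series g & f = lmono (f 0) 0 + lunif * g.
Proof.
move=> hf; exists (lmono 1 (- 1) * (f - lmono (f 0) 0)).
  move=> n n0; rewrite lmono_coef mul1r coefD coefN opprK /=.
  have [->|n1] := eqVneq n (- 1); first by rewrite addNr eqxx subrr.
  by rewrite hf ?(ifF _ _ _) ?subr0 //; [apply/negP => /eqP|]; lia.
by rewrite mulrA lunifE lmono1M subrr mul1r addrC subrK.
Qed.

Lemma ps_trunc f n : power_series f ->
  exists2 g, power_series g & f = \sum_(i < n) lmono (f i%:Z) i%:Z + lmono 1 n%:Z * g.
Proof.
move=> hf; exists (lmono 1 (- n%:Z) * (f - \sum_(i < n) lmono (f i%:Z) i%:Z)); last first.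
  by rewrite mulrA lmono1M subrr mul1r addrC subrK.
move=> m m0; rewrite lmono_coef mul1r opprK coefD coefN coef_sum /=.
have [h|h] := ltP (m + n) 0.
  rewrite hf // big1 ?subrr // => i _ /=; case: eqP => // e; exfalso.
  by move: h; rewrite e.
have hn : (`|(m + n)%R| < n)%N by lia.
rewrite (bigD1 (Ordinal hn)) //= gez0_abs // eqxx big1 ?addr0 ?subrr // => i.
by move=> ne; case: eqP => // e; case/eqP: ne; apply: val_inj => /=; lia.
Qed.

Lemma laurent_ps f : exists n : nat, power_series (lmono 1 n%:Z * f).
Proof.
have [N hN] := coef_bounded f; exists `|N|%N => n n0.
by rewrite lmono_coef hN ?mulr0 //; lia.
Qed.

Lemma primitive (I : finType) (f : I -> laurent k) : (exists i, f i <> 0) ->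
  exists c : int, (forall i, power_series (lmono 1 c * f i)) /\
                  exists i, (lmono 1 c * f i) 0 != 0.
Proof.
move=> [i0 hi0].
have /choice[N hN] : forall i, exists n : nat, power_series (lmono 1 n%:Z * f i).
  by move=> i; apply: laurent_ps.
pose B := (\max_i N i)%N.
have hB i : power_series (lmono 1 B%:Z * f i).
  have -> : B = ((B - N i) + N i)%N by rewrite subnK // /B (bigD1 i) //= leq_maxl.
  rewrite PoszD -lmono1M -mulrA; apply: psM => //; exact: ps_mono.
have ex : exists j : nat, [exists i, (lmono 1 B%:Z * f i) j%:Z != 0].
  apply/not_existsP => h; apply: hi0.
  rewrite -[f i0](lmono1K B%:Z); rewrite (_ : _ * f i0 = 0) ?mulr0 //.
  apply: laurentP => n; rewrite coef0; have [/hB //|n0] := ltP n 0.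
  have := h `|n|%N => /negP; rewrite negb_exists => /forallP/(_ i0).
  by rewrite negbK gez0_abs // => /eqP.
have [m /existsP[i hi] minm] := ex_minnP ex.
exists (B%:Z - m%:Z); split=> [j n n0|].
  rewrite lmono_coef mul1r opprB addrCA.
  have [h|h] := ltP (n + m%:Z) 0.
    by have := hB j _ h; rewrite lmono_coef mul1r => <-; congr (f j _); lia.
  apply/eqP/negPn/negP => hj; have := minm `|(n + m%:Z)%R|%N.
  have -> : [exists i, (lmono 1 B%:Z * f i) `|(n + m%:Z)%R|%N != 0].
    apply/existsP; exists j; rewrite lmono_coef mul1r gez0_abs //.
    by apply: contra hj => /eqP <-; apply/eqP; congr (f j _); lia.
  by move=> /(_ isT); lia.
exists i; move: hi; rewrite !lmono_coef !mul1r => hi.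
by apply: contra hi => /eqP <-; apply/eqP; congr (f i _); lia.
Qed.

Lemma psV f : power_series f -> f 0 != 0 -> power_series f^-1.
Proof.
move=> hf f0; have nf : f != 0 by apply: contraNneq f0 => ->.
have [|c [h1 [_ h2]]] := @primitive unit (fun=> f^-1).
  by exists tt; apply/eqP; rewrite invr_eq0.
have := psM0 hf (h1 tt); rewrite mulrCA divff // mulr1 => e.
have c0 : c = 0.
  apply/eqP/negPn/negP => c0; move: e; rewrite {1}/lmono /= eq_sym (negPf c0).
  by move/esym/eqP; rewrite mulf_eq0 (negPf f0) (negPf h2).
by move: (h1 tt); rewrite c0 lmono1 mul1r.
Qed.

Lemma laurent_eq0 f : (forall n : nat, power_series (lmono 1 (- n%:Z) * f)) -> f = 0.
Proof.
move=> h; apply: laurentP => n; rewrite coef0.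
have := h `|n|%N.+1 (n - (`|n|%N.+1)%:Z) _; rewrite lmono_coef mul1r opprK subrK.
by apply; lia.
Qed.

End PowerSeries.

(** * Lattices *)

Section Lattice.
Variables (k : fieldType) (M : connection k).
Implicit Types (V W : set M) (m x y : M) (f g : laurent k).

Definition ispan (n : nat) (e : 'I_n -> M) : set M :=
  [set m | exists2 a : 'I_n -> laurent k,
             forall i, power_series (a i) & m = \sum_i a i *: e i].

Definition submod V :=
  [/\ V 0, forall x y, V x -> V y -> V (x + y)
    & forall f x, power_series f -> V x -> V (f *: x)].

(* u^n V *)
Definition shift (n : int) V : set M := [set m | V (lmono 1 (- n) *: m)].

Definition frame n (e : 'I_n -> M) := forall m, exists a, m = \sum_i a i *: e i.
Definition indep n (e : 'I_n -> M) :=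
  forall a, \sum_i a i *: e i = 0 -> forall i, a i = 0.

Lemma submodN V x : submod V -> V x -> V (- x).
Proof. by move=> [_ _ h] Vx; rewrite -scaleN1r; apply: h Vx; apply/psN/ps1. Qed.

Lemma submodB V x y : submod V -> V x -> V y -> V (x - y).
Proof. by move=> h Vx Vy; case: (h) => _ hD _; apply/hD => //; apply: submodN. Qed.

Lemma submod_sum V (I : Type) (r : seq I) (P : pred I) (F : I -> M) :
  submod V -> (forall i, P i -> V (F i)) -> V (\sum_(i <- r | P i) F i).
Proof. by move=> [h0 hD _] h; elim/big_rec: _ => // i x /h; apply: hD. Qed.

Lemma submod_mono V (c : k) (n : int) x : 0 <= n -> submod V -> V x -> V (lmono c n *: x).
Proof. by move=> n0 [_ _ h]; apply/h/ps_mono. Qed.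

Lemma ispan_submod n (e : 'I_n -> M) : submod (ispan e).
Proof.
split=> [|x y [a ha ->] [b hb ->]|f x hf [a ha ->]].
- by exists (fun=> 0) => [i|]; rewrite ?big1 // => i _; rewrite scale0r.
- exists (fun i => a i + b i) => [i|]; first exact: psD.
  by rewrite -big_split; apply: eq_bigr => i _; rewrite scalerDl.
- exists (fun i => f * a i) => [i|]; first exact: psM.
  by rewrite scaler_sumr; apply: eq_bigr => i _; rewrite scalerA.
Qed.

Lemma ispan_gen n (e : 'I_n -> M) i : ispan e (e i).
Proof.
exists (fun j => lmono (j == i)%:R 0) => [j|]; first exact: ps_mono.
rewrite (bigD1 i) //= eqxx lmono1 scale1r big1 ?addr0 // => j /negPf ->.
by rewrite lmono0 scale0r.
Qed.

Lemma ispan_sub n (e : 'I_n -> M) V : submod V -> (forall i, V (e i)) -> ispan e `<=` V.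
Proof.
by move=> hV h m [a ha ->]; apply: submod_sum => // i _; case: hV => _ _; apply.
Qed.

Lemma span_frame n (e : n.-tuple M) : <<e>>%VS = fullv <-> frame (fun i : 'I_n => e`_i).
Proof.
split=> [h m|h].
  have : m \in <<e>>%VS by rewrite h memvf.
  by move=> /coord_span ->; exists (fun i => coord e i m).
apply/eqP; rewrite eqEsubv subvf /=; apply/subvP => m _.
have [a ->] := h m; apply: memv_suml => i _; apply/memvZ/memv_span.
by rewrite mem_nth ?size_tuple.
Qed.

Lemma latticeP V : is_lattice V <-> exists n (e : 'I_n -> M), frame e /\ V = ispan e.
Proof.
split=> [[n [e [/span_frame h ->]]]|[n [e [h ->]]]].
  by exists n, (fun i : 'I_n => e`_i).
have ee (i : 'I_n) : [tuple e i | i < n]`_i = e i by rewrite -tnth_nth tnth_mktuple.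
exists n, [tuple e i | i < n]; split.
  by apply/span_frame => m; have [a ->] := h m; exists a; apply: eq_bigr => i _; rewrite ee.
apply/seteqP; split=> m [a ha ->]; exists a => //; apply: eq_bigr => i _; rewrite ee //.
Qed.

Lemma lattice_submod V : is_lattice V -> submod V.
Proof. by move=> /latticeP[n [e [_ ->]]]; apply: ispan_submod. Qed.

Definition absorbing V := forall m, exists n : nat, V (lmono 1 n%:Z *: m).

Lemma lmono_le V (n p : nat) x : submod V -> (n <= p)%N ->
  V (lmono 1 n%:Z *: x) -> V (lmono 1 p%:Z *: x).
Proof.
move=> hV np Vx; have -> : p = ((p - n) + n)%N by rewrite subnK.
by rewrite PoszD -lmono1M -scalerA; apply: submod_mono.
Qed.

Lemma absorb_fin V (I : finType) (e : I -> M) : submod V -> absorbing V ->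
  exists n : nat, forall i, V (lmono 1 n%:Z *: e i).
Proof.
move=> hV hA; have /choice[N hN] := fun i => hA (e i).
exists (\max_i N i)%N => i; apply: lmono_le (hN i) => //.
by rewrite (bigD1 i) //= leq_maxl.
Qed.

Lemma lattice_absorbing V : is_lattice V -> absorbing V.
Proof.
move=> /latticeP[n [e [fe ->]]] m; have [a ->] := fe m.
have /choice[N hN] := fun i => laurent_ps (a i).
exists (\max_i N i)%N; rewrite scaler_sumr; apply: submod_sum; first exact: ispan_submod.
move=> i _; rewrite scalerA.
have [_ _ h] := ispan_submod e; apply: h (ispan_gen _ _).
have -> : (\max_i N i = (\max_i N i - N i) + N i)%N by rewrite subnK // (bigD1 i) //= leq_maxl.
by rewrite PoszD -lmono1M -mulrA; apply: psM; [exact: ps_mono|exact: hN].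
Qed.

Lemma lattice_comm V W : is_lattice V -> submod W -> absorbing W ->
  exists n : nat, forall v, V v -> W (lmono 1 n%:Z *: v).
Proof.
move=> /latticeP[r [e [_ ->]]] hW hA; have [n hn] := absorb_fin e hW hA.
exists n => v [a ha ->]; rewrite scaler_sumr; apply: submod_sum => // i _.
by rewrite scalerA mulrC -scalerA; case: hW => _ _; apply.
Qed.

Lemma shift_submod n V : submod V -> submod (shift n V).
Proof.
move=> [h0 hD hZ]; split=> [|x y|f x hf]; rewrite /shift /=.
- by rewrite scaler0.
- by rewrite scalerDr; apply: hD.
- by rewrite scalerA mulrC -scalerA; apply: hZ.
Qed.

Lemma shiftE n V x : V x -> shift n V (lmono 1 n *: x).
Proof. by rewrite /shift /= scalerA lmono1M addNr lmono1 scale1r. Qed.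

Lemma shiftP n V x : shift n V x -> exists2 y, V y & x = lmono 1 n *: y.
Proof.
by exists (lmono 1 (- n) *: x); rewrite // scalerA lmono1M subrr lmono1 scale1r.
Qed.

Lemma shift_shift n p V : shift n (shift p V) = shift (n + p) V.
Proof. by apply/seteqP; split=> x; rewrite /shift /= scalerA lmono1M opprD addrC. Qed.

Lemma shift0 V : shift 0 V = V.
Proof. by apply/seteqP; split=> x; rewrite /shift /= oppr0 lmono1 scale1r. Qed.

Lemma shift_le n p V x : submod V -> (n <= p)%R -> shift p V x -> shift n V x.
Proof.
move=> hV np /shiftP[y Vy ->]; have -> : p = n + (p - n) by lia.
by rewrite -lmono1M -scalerA; apply: shiftE; apply: submod_mono => //; lia.
Qed.

Lemma shift_sub n V W : V `<=` W -> shift n V `<=` shift n W.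
Proof. by move=> h x; apply: h. Qed.

Lemma shift_lattice n V : is_lattice V -> is_lattice (shift n V).
Proof.
move=> /latticeP[r [e [fe ->]]]; apply/latticeP; exists r, (fun i => lmono 1 n *: e i).
split=> [m|].
  have [a ea] := fe (lmono 1 (- n) *: m); exists a.
  rewrite -[m]scale1r -lmono1 -(subrr n) -lmono1M -scalerA ea scaler_sumr.
  by apply: eq_bigr => i _; rewrite !scalerA mulrC.
apply/seteqP; split=> x.
  move=> /shiftP[y [a ha ->] ->]; exists a => //; rewrite scaler_sumr.
  by apply: eq_bigr => i _; rewrite !scalerA mulrC.
move=> [a ha ->]; apply: submod_sum; first exact/shift_submod/ispan_submod.
move=> i _; have [_ _ h] := shift_submod n (ispan_submod e); apply: h => //.
by apply: shiftE; apply: ispan_gen.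
Qed.

Lemma indep_frame_dim n (e : 'I_n -> M) : frame e -> indep e -> n = \dim {:M}.
Proof.
move=> fe ie; have ee (i : 'I_n) : [tuple e i | i < n]`_i = e i.
  by rewrite -tnth_nth tnth_mktuple.
have f : free [tuple e i | i < n].
  apply/freeP => a ea i; apply: ie => //; rewrite -[RHS]ea.
  by apply: eq_bigr => j _; rewrite ee.
have : basis_of {:M} [tuple e i | i < n].
  rewrite basisEfree f subvf /=; have : <<[tuple e i | i < n]>>%VS = fullv.
    by apply/span_frame => m; have [a ->] := fe m; exists a; apply: eq_bigr => i _; rewrite ee.
  by move=> h; rewrite -[X in \dim X]h dim_span.
by move=> /size_basis ->.
Qed.

Lemma lattice_basis V : is_lattice V ->
  exists n (e : 'I_n -> M), [/\ frame e, indep e & V = ispan e].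
Proof.
move=> /latticeP[r [e [fe ->]]].
have ex : exists n, `[< exists e' : 'I_n -> M, ispan e = ispan e' >].
  by exists r; apply/asboolP; exists e.
have [n /asboolP[e' ee'] minn] := ex_minnP ex.
have fe' : frame e'.
  move=> m; have hl : is_lattice (ispan e) by apply/latticeP; exists r, e.
  have [N] := lattice_absorbing hl m; rewrite ee' => -[a _ ea].
  exists (fun i => lmono 1 (- N%:Z) * a i).
  rewrite -[m]scale1r -lmono1 -(addNr N%:Z) -lmono1M -scalerA ea scaler_sumr.
  by apply: eq_bigr => i _; rewrite !scalerA.
exists n, e'; split=> // a ea; apply: contrapT => /existsNP/primitive[c [hc [j hj]]].
pose b i := lmono 1 c * a i.
have eb : \sum_i b i *: e' i = 0.
  have := congr1 (fun m => lmono 1 c *: m) ea; rewrite scaler0 scaler_sumr => {2}<-.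
  by apply: eq_bigr => i _; rewrite scalerA.
case: n => [|n] in e' ee' minn fe' a ea c hc j hj b eb *; first by case: j {hj}.
have bj0 : b j != 0 by apply: contraNneq hj; rewrite /b => ->.
suff : (n.+1 <= n)%N by rewrite ltnn.
apply: minn; apply/asboolP; exists (fun i => e' (lift j i)); rewrite ee'.
apply/seteqP; split; apply: ispan_sub; do ?exact: ispan_submod; last first.
  by move=> i; apply: ispan_gen.
move=> i; case: (unliftP j i) => [i' ->|->]; first exact: (ispan_gen (fun i => e' (lift j i))).
have -> : e' j = \sum_(i < n) (- (b (lift j i) / b j)) *: e' (lift j i).
  apply: (scalerI bj0); move/eqP: eb; rewrite (bigD1_ord j) //= addr_eq0 => /eqP ->.
  rewrite scaler_sumr -sumrN; apply: eq_bigr => i' _.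
  by rewrite scalerA mulrN mulrCA divff // mulr1 scaleNr.
exists (fun i => - (b (lift j i) / b j)) => // i'.
by apply/psN/psM; [exact: hc|apply: psV; [exact: hc|]].
Qed.

Lemma lattice_sep V m : is_lattice V -> (forall n : nat, V (lmono 1 (- n%:Z) *: m)) -> m = 0.
Proof.
move=> /lattice_basis[r [e [fe ie ->]]] h; have [a ea] := fe m.
rewrite ea big1 // => i _; rewrite [a i]laurent_eq0 ?scale0r // => n.
have [b hb eb] := h n; suff -> : lmono 1 (- n%:Z) * a i = b i by [].
apply/eqP; rewrite -subr_eq0; apply/eqP.
apply: (ie (fun i => lmono 1 (- n%:Z) * a i - b i)).
under eq_bigr do rewrite scalerBl -scalerA.
by rewrite sumrB -scaler_sumr -ea eb subrr.
Qed.

Lemma lattice_complete V (a : nat -> M) : is_lattice V -> (forall n, V (a n)) ->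
  exists2 y : nat -> M, forall n, V (y n) & forall n, y n = a n + lunif *: y n.+1.
Proof.
move=> /latticeP[r [e [_ ->]]] ha.
have /choice[b hb] : forall n, exists b : 'I_r -> laurent k,
    (forall i, power_series (b i)) /\ a n = \sum_i b i *: e i.
  by move=> n; have [b ? ?] := ha n; exists b.
pose c n i (p : int) : k := if p < 0 then 0 else
  \sum_(j < `|p|%N.+1) b (n + j)%N i (p - j%:Z).
have cb n i : exists N : int, forall p : int, p < N -> c n i p = 0.
  by exists 0 => p p0; rewrite /c p0.
have hc n i : power_series (Laurent (cb n i)) by move=> p p0 /=; rewrite /c p0.
have ec n i : Laurent (cb n i) = b n i + lunif * Laurent (cb n.+1 i).
  apply: laurentP => p; rewrite coefD lunifE lmono_coef mul1r /= /c.
  have [p0|p0] := ltP p 0.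
    by rewrite (hb n).1 // ifT ?addr0 //; lia.
  rewrite big_ord_recl addn0 subr0; congr (_ + _).
  have [p1|p1] := ltP (p - 1) 0.
    by have -> : p = 0 by [lia]; rewrite big_ord0.
  have -> : `|p|%N = `|(p - 1)%R|%N.+1 by lia.
  apply: eq_bigr => j _; rewrite lift0 addSnnS; by have -> : p - j.+1%:Z = p - 1 - j%:Z by lia.
pose y n : M := \sum_i Laurent (cb n i) *: e i.
exists y => n; first by exists (fun i => Laurent (cb n i)).
rewrite /y (hb n).2 scaler_sumr -big_split /=; apply: eq_bigr => i _.
by rewrite ec scalerDl scalerA.
Qed.

End Lattice.

Section Index.
Variables (k : fieldType) (M : connection k) (V W : set M) (phi : M -> M).
Hypotheses (lV : is_lattice V) (lW : is_lattice W).
Hypothesis phiD : forall x y, phi (x + y) = phi x + phi y.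
Hypothesis phiZ : forall (c : k) x, phi (lmono c 0 *: x) = lmono c 0 *: phi x.
Hypothesis phiVW : forall v, V v -> W (phi v).
Hypothesis phi_shift : forall v, V v -> shift 1 W (phi (lunif *: v)).

Let inj_mod := forall v, V v -> shift 1 W (phi v) -> shift 1 V v.
Let surj_mod := forall w, W w -> exists2 v, V v & shift 1 W (w - phi v).

Lemma ispan_residue n (e : 'I_n -> M) (a : 'I_n -> laurent k) :
  (forall i, power_series (a i)) ->
  shift 1 (ispan e) (\sum_i a i *: e i - \sum_i lmono (a i 0) 0 *: e i).
Proof.
move=> ha; have sm := ispan_submod e; rewrite -sumrB; apply: submod_sum.
  exact: shift_submod.
move=> i _; have [b hb eb] := ps_split (ha i).
rewrite -scalerBl {1}eb addrC addKr lunifE.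
rewrite -scalerA; apply: shiftE; case: sm => _ _; apply => //; exact: ispan_gen.
Qed.

Lemma ispan_residue0 n (e : 'I_n -> M) (c : 'I_n -> k) : indep e ->
  shift 1 (ispan e) (\sum_i lmono (c i) 0 *: e i) -> forall i, c i = 0.
Proof.
move=> ie /shiftP[_ [b hb ->] eb] i.
have := ie (fun i => lmono (c i) 0 - lunif * b i).
under eq_bigr do rewrite scalerBl -scalerA.
rewrite sumrB -scaler_sumr eb subrr => /(_ erefl i) /(congr1 (fun f : laurent k => f 0)).
by rewrite coefD coefN lunifE lmono_coef /= hb // mulr0 subr0.
Qed.

Lemma index_matrix : exists n (C : 'M[k]_n),
  (inj_mod <-> C \in unitmx) /\ (surj_mod <-> C \in unitmx).
Proof.
have [n [e [fe ie eV]]] := lattice_basis lV.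
have [n' [f [ff jf eW]]] := lattice_basis lW.
have en : n = n' by rewrite (indep_frame_dim fe ie) (indep_frame_dim ff jf).
subst n'; exists n.
have /choice[B hB] : forall i, exists B : 'I_n -> laurent k,
    (forall j, power_series (B j)) /\ phi (e i) = \sum_j B j *: f j.
  move=> i; have : W (phi (e i)) by apply: phiVW; rewrite eV; apply: ispan_gen.
  by rewrite eW => -[B ? ?]; exists B.
pose C := \matrix_(i, j) (B i j 0); exists C.
have sW := shift_submod 1 (lattice_submod lW).
pose vec (g : 'I_n -> M) (c : 'rV[k]_n) := \sum_i lmono (c 0 i) 0 *: g i.
have vecV c : V (vec e c).
  apply: submod_sum (lattice_submod lV) _ => i _; apply: submod_mono => //.
    exact: lattice_submod.
  by rewrite eV; apply: ispan_gen.
have phi0 : phi 0 = 0 by have := phiD 0 0; rewrite addr0 => /eqP; rewrite -subr_eq subrr => /eqP.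
have phi_sum (g : 'I_n -> M) : phi (\sum_i g i) = \sum_i phi (g i).
  by elim/big_rec2: _ => [|i x y _ <-].
have phiN x : phi (- x) = - phi x.
  by apply/eqP; rewrite -subr_eq0 opprK -phiD addNr phi0.
have res_phi c : shift 1 W (phi (vec e c) - vec f (c *m C)).
  rewrite /vec phi_sum; under eq_bigr do rewrite phiZ (hB _).2.
  under [X in _ - X]eq_bigr do rewrite mxE lmono_sum scaler_suml.
  rewrite exchange_big -sumrB /=; apply: submod_sum => // i _.
  have -> : \sum_j lmono (c 0 i * C i j) 0 *: f j =
            lmono (c 0 i) 0 *: \sum_j lmono (B i j 0) 0 *: f j.
    rewrite scaler_sumr; apply: eq_bigr => j _.
    by rewrite scalerA lmonoM addr0 mxE.
  rewrite -scalerBr; apply: submod_mono => //; rewrite eW.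
  exact/ispan_residue/(hB i).1.
have resV v : V v -> exists c, shift 1 V (v - vec e c).
  rewrite {1}eV => -[a ha ->]; exists (\row_i a i 0).
  rewrite eV /vec; under [X in _ - X]eq_bigr do rewrite mxE.
  exact: ispan_residue.
have resW w : W w -> exists d, shift 1 W (w - vec f d).
  rewrite {1}eW => -[a ha ->]; exists (\row_i a i 0).
  rewrite eW /vec; under [X in _ - X]eq_bigr do rewrite mxE.
  exact: ispan_residue.
have vec0 d : shift 1 W (vec f d) -> d = 0.
  by rewrite eW => /(ispan_residue0 jf) h; apply/rowP => i; rewrite h mxE.
have vec0e c : shift 1 V (vec e c) -> c = 0.
  by rewrite eV => /(ispan_residue0 ie) h; apply/rowP => i; rewrite h mxE.
have vecB g c d : vec g c - vec g d = vec g (c - d).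
  by rewrite /vec -sumrB; apply: eq_bigr => i _; rewrite !mxE lmonoD lmonoN scalerBl.
have phi_s v : shift 1 V v -> shift 1 W (phi v).
  by move=> /shiftP[y Vy ->]; apply: phi_shift.
have step v c : shift 1 V (v - vec e c) -> shift 1 W (phi v - vec f (c *m C)).
  move=> /phi_s h; rewrite -(subrK (vec e c) v) phiD -addrA.
  by case: (sW) => _ hD _; apply: hD.
split; split.
- move=> hinj; rewrite -row_free_unit; apply: inj_row_free => c ec.
  apply: vec0e; apply: hinj => //; have := res_phi c.
  rewrite ec /vec [X in _ - X]big1 ?subr0 // => i _.
  by rewrite mxE lmono0 scale0r.
- move=> uC v Vv hv; have [c hc] := resV v Vv.
  suff c0 : c = 0.
    move: hc; rewrite c0 /vec [X in _ - X]big1 ?subr0 // => i _.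
    by rewrite mxE lmono0 scale0r.
  rewrite -(mulmxK uC c) (vec0 (c *m C)) ?mul0mx //.
  rewrite -[vec _ _](subKr (phi v)); apply: submodB => //; exact: step.
- move=> hs; have /choice[R hR] : forall i : 'I_n, exists c : 'rV[k]_n, c *m C = delta_mx 0 i.
    move=> i; have [|v Vv hv] := hs (vec f (delta_mx 0 i)).
      apply: submod_sum (lattice_submod lW) _ => j _; apply: submod_mono => //.
        exact: lattice_submod.
      by rewrite eW; apply: ispan_gen.
    have [c hc] := resV v Vv; exists c; apply/eqP; rewrite eq_sym -subr_eq0.
    apply/eqP/vec0; rewrite -vecB -(subrK (phi v) (vec f (delta_mx 0 i))) -addrA.
    by case: (sW) => _ hD _; apply: hD => //; apply: step.
  suff : (\matrix_i R i) *m C = 1%:M by case/mulmx1_unit.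
  by apply/row_matrixP => i; rewrite row_mul rowK hR rowE mulmx1.
- move=> uC w Ww; have [d hd] := resW w Ww.
  exists (vec e (d *m invmx C)) => //; have := res_phi (d *m invmx C).
  rewrite mulmxKV // => h.
  rewrite -(subrK (vec f d) w) -addrA; case: (sW) => _ hD _; apply: hD => //.
  by rewrite -opprB; apply: submodN.
Qed.

Lemma index_inj_surj : inj_mod -> surj_mod.
Proof. by have [n [C [h1 h2]]] := index_matrix => /h1/h2. Qed.
Lemma index_surj_inj : surj_mod -> inj_mod.
Proof. by have [n [C [h1 h2]]] := index_matrix => /h2/h1. Qed.

End Index.

(** * Cyclic vectors *)

Section Cyclic.
Variables (k : fieldType) (char0 : [pchar k] =i pred0).
Local Notation K := (laurent k).

Lemma natr_inj : injective (fun n : nat => n%:R : k).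
Proof.
move=> m n /eqP; wlog le : m n / (n <= m)%N => [hw|].
  by case/orP: (leq_total n m) => /hw // h e; rewrite eq_sym in e; apply/esym/h.
rewrite -subr_eq0 -natrB // => /eqP e; apply/eqP; rewrite eqn_leq le andbT.
apply/negPn/negP => h; have d0 : (m - n)%N != 0%N by rewrite subn_eq0.
by move/eqP: e; apply/negP; rewrite (pcharf0P _).1.
Qed.

Lemma exists_nonroot (F : idomainType) (x : nat -> F) (p : {poly F}) :
  injective x -> p != 0 -> exists n0, forall n, (n0 <= n)%N -> ~~ root p (x n).
Proof.
move=> xi p0; apply: contrapT => h.
have {}h n0 : exists n, (n0 <= n)%N && root p (x n).
  apply: contrapT => h'; apply: h; exists n0 => n hn; apply/negP => r.
  by apply: h'; exists n; rewrite hn.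
have [s [us hs sz]] : exists s : seq nat, [/\ uniq s, all (fun n => root p (x n)) s &
    size s = size p].
  elim: (size p) => [|d [s [us hs sz]]]; first by exists [::].
  have [n /andP[h1 h2]] := h (\max_(i <- s) i).+1.
  exists (n :: s); rewrite /= us hs h2 sz !andbT; split=> //.
  apply/negP => /leq_bigmax_seq - /(_ xpredT id isT).
  by rewrite leqNgt h1.
have := max_poly_roots p0 (rs := map x s); rewrite size_map sz ltnn all_map hs.
by rewrite (map_inj_uniq xi) us => /(_ isT isT).
Qed.

Definition kemb (c : k) : K := lmono c 0.
Lemma kemb_inj : injective kemb.
Proof. by move=> a b /(congr1 (fun f : K => f 0)). Qed.

Lemma kemb_nat n : n%:R = kemb n%:R.
Proof. by elim: n => [|n IH]; rewrite /kemb ?lmono0 // -addn1 !natrD lmonoD IH. Qed.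

Lemma laurent_nat_inj : injective (fun n : nat => n%:R : K).
Proof. by move=> m n /=; rewrite !kemb_nat => /kemb_inj/natr_inj. Qed.

Variable M : connection k.
Implicit Types (x y m : M) (a b : nat -> M).
Local Notation th := (@theta k M).

Definition family_indep n a := indep (fun i : 'I_n => a i).

Lemma findep_free n a : family_indep n a -> free [tuple a i | i < n].
Proof.
move=> h; apply/freeP => c ec i; apply: h => //; rewrite -[RHS]ec.
by apply: eq_bigr => j _; rewrite -[in RHS]tnth_nth tnth_mktuple.
Qed.

Lemma findep_leq n a : family_indep n a -> (n <= \dim {:M})%N.
Proof.
by move=> /findep_free; rewrite /free size_tuple => /eqP <-; apply/dimvS/subvf.
Qed.

Lemma findep_form n a (j : 'I_n) : family_indep n a ->
  exists phi : {linear M -> K^o}, forall i : 'I_n, phi (a i) = (i == j)%:R.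
Proof.
move=> /findep_free h; exists (coord [tuple a i | i < n] j) => i.
by rewrite -(coord_free _ _ h) -tnth_nth tnth_mktuple.
Qed.

Lemma findep_ext n a : family_indep n a ->
  (forall c : 'I_n -> K, a n <> \sum_i c i *: a i) -> family_indep n.+1 a.
Proof.
move=> h na c; rewrite big_ord_recr /= => ec.
have c0 : c ord_max = 0.
  apply/eqP/negPn/negP => c0; apply: (na (fun i => - (c ord_max)^-1 * c (widen_ord (leqnSn n) i))).
  apply: (scalerI c0); rewrite scaler_sumr; apply/eqP; rewrite eq_sym -subr_eq0.
  rewrite -oppr_eq0 opprB addrC -[X in _ == X]ec; apply/eqP; congr (_ + _).
  rewrite -sumrN; apply: eq_bigr => i _.
  by rewrite scalerA mulrA mulrN divff // mulN1r scaleNr opprK.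
move: ec; rewrite c0 scale0r addr0 => /h hc i.
have [e|ne] := eqVneq i ord_max; first by rewrite e.
have li : (i < n)%N by have := ltn_ord i; rewrite ltnS leq_eqVlt => /orP[/eqP e|//]; case/eqP: ne; apply: val_inj.
by rewrite -(hc (Ordinal li)); congr c; apply: val_inj.
Qed.

Lemma findep_perturb n a b : family_indep n a ->
  exists2 c : k, c != 0 & family_indep n (fun i => a i + lmono c 0 *: b i).
Proof.
move=> ha; have /choice[phi hphi] := fun j => findep_form j ha.
pose A : 'M[K]_n := \matrix_(i, j) phi j (b i).
pose p : {poly K} := \det (1%:M + 'X *: map_mx polyC A).
have pE (x : K) : p.[x] = \det (1%:M + x *: A).
  rewrite -[LHS]/(horner_eval x p) -det_map_mx map_mxD map_mx1 map_mxZ -map_mx_comp.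
  rewrite /= /horner_eval hornerX; congr (\det (_ + _ *: _)).
  by apply/matrixP => i j; rewrite !mxE /= hornerC.
have p0 : p != 0.
  by apply/eqP => e; have := pE 0; rewrite e horner0 scale0r addr0 det1 => /eqP; rewrite eq_sym oner_eq0.
have [n0 /(_ n0.+1 (leqnSn _))] := exists_nonroot laurent_nat_inj p0.
rewrite rootE pE kemb_nat => hd; exists n0.+1%:R.
  by apply/eqP => /(@natr_inj _ 0%N).
move=> s es i; apply/eqP; set C := _ + _ in hd.
have uC : C \in unitmx by rewrite unitmxE unitfE.
suff : \row_i s i *m C = 0.
  move=> /(congr1 (fun v => v *m invmx C)); rewrite mulmxK // mul0mx.
  by move/rowP/(_ i); rewrite !mxE => ->.
apply/rowP => j; rewrite !mxE -[RHS](linear0 (phi j)) -es linear_sum.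
apply: eq_bigr => i' _; rewrite linearZ /= linearD linearZ /= hphi !mxE.
by [].
Qed.

Lemma thetaD x y : theta (x + y) = theta x + theta y.
Proof. by rewrite /theta raddfD scalerDr. Qed.

Lemma thetaZ (f : K) x : theta (f *: x) = (lunif * lderiv f) *: x + f *: theta x.
Proof. by rewrite /theta leibniz scalerDr !scalerA [f * _]mulrC. Qed.

Lemma theta_mono (c : k) n x :
  theta (lmono c n *: x) = lmono (c *~ n) n *: x + lmono c n *: theta x.
Proof.
by rewrite thetaZ lderiv_mono lunifE lmonoM mul1r; have -> : 1 + (n - 1) = n by lia.
Qed.

Lemma theta_const (c : k) x : theta (lmono c 0 *: x) = lmono c 0 *: theta x.
Proof. by rewrite theta_mono mulr0z lmono0 scale0r add0r. Qed.

Lemma theta0 : theta (0 : M) = 0.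
Proof. by rewrite /theta raddf0 scaler0. Qed.

Lemma theta_sum (I : Type) (r : seq I) (P : pred I) (F : I -> M) :
  theta (\sum_(i <- r | P i) F i) = \sum_(i <- r | P i) theta (F i).
Proof. by elim/big_rec2: _ => [|i x y _ <-]; rewrite ?theta0 ?thetaD. Qed.

Lemma iter_thetaD i x y : iter i th (x + y) = iter i th x + iter i th y.
Proof. by elim: i => //= i ->; rewrite thetaD. Qed.

Lemma iter_theta_const i (c : k) x : iter i th (lmono c 0 *: x) = lmono c 0 *: iter i th x.
Proof. by elim: i => //= i ->; rewrite theta_const. Qed.

(* theta^i (u^j f) = u^j (theta + j)^i f, seen through a linear form as a polynomial in j *)
Fixpoint theta_poly (phi : M -> K) i x : {poly K} :=
  if i is i'.+1 then 'X * theta_poly phi i' x + theta_poly phi i' (theta x)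
  else (phi x)%:P.

Lemma size_theta_poly phi i x : (size (theta_poly phi i x) <= i.+1)%N.
Proof.
elim: i x => [|i IH] x /=; first exact: size_polyC_leq1.
apply: leq_trans (size_polyD _ _) _; rewrite geq_max (leq_trans (IH _)) // andbT.
by rewrite mulrC; apply: leq_trans (size_polyMleq _ _) _; rewrite size_polyX addn2 ltnS IH.
Qed.

Lemma theta_poly_lead phi i x : (theta_poly phi i x)`_i = phi x.
Proof.
elim: i x => [|i IH] x /=; first by rewrite coefC.
by rewrite poly.coefD coefXM /= IH (nth_default _ (size_theta_poly _ _ _)) addr0.
Qed.

Lemma theta_polyE (phi : {linear M -> K^o}) i x (j : nat) :
  phi (iter i th (lmono 1 j%:Z *: x)) = lmono 1 j%:Z * (theta_poly phi i x).[j%:R].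
Proof.
elim: i x => [|i IH] x; first by rewrite /= linearZ hornerC.
rewrite iterSr theta_mono -[in X in X + _](mulr1 (lmono _ _)).
have -> : lmono (1 *~ j) j%:Z = lmono (j%:R : k) 0 * lmono 1 j%:Z.
  by rewrite lmonoM mulr1 add0r.
rewrite mulr1 -scalerA iter_thetaD iter_theta_const linearD linearZ /= !IH -/(theta_poly _ _ _).
rewrite hornerD hornerM hornerX mulrDr; congr (_ + _).
by rewrite kemb_nat /kemb /GRing.scale /= mulrCA.
Qed.

Lemma exists_findep_cyclic : exists e : M, family_indep (\dim {:M}) (fun i => iter i th e).
Proof.
have ex : exists n, `[< exists e : M, family_indep n (fun i => iter i th e) >].
  by exists 0%N; apply/asboolP; exists 0 => a _ [].
have bd n : `[< exists e : M, family_indep n (fun i => iter i th e) >] -> (n <= \dim {:M})%N.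
  by move=> /asboolP[e /findep_leq].
have [m /asboolP[e he] maxm] := ex_maxnP ex bd.
have [md|md] := leqP (\dim {:M}) m.
  by exists e; have -> : \dim {:M} = m by [apply/eqP; rewrite eqn_leq md (findep_leq he)].
exfalso.
have nomore e' : ~ family_indep m.+1 (fun i => iter i th e').
  move=> h; suff /maxm : `[< exists e : M, family_indep m.+1 (fun i => iter i th e) >].
    by rewrite ltnn.
  by apply/asboolP; exists e'.
have [a ea] : exists a : 'I_m -> K, iter m th e = \sum_i a i *: iter i th e.
  by apply: contrapT => h; apply: (nomore e); apply: findep_ext => // c ec; apply: h; exists c.
have [f hf] : exists f, forall c : 'I_m -> K, f <> \sum_i c i *: iter i th e.
  apply: contrapT => h; have fe : frame (fun i : 'I_m => iter i th e).
    by move=> f; apply: contrapT => h'; apply: h; exists f => c ec; apply: h'; exists c.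
  by move: md; rewrite -(indep_frame_dim fe he) ltnn.
pose ext (b : nat -> M) x i := if (i < m)%N then b i else x.
have extE b x (i : 'I_m) : ext b x i = b i by rewrite /ext ltn_ord.
have extm b x : ext b x m = x by rewrite /ext ltnn.
have findep_in b x : family_indep m b -> family_indep m (ext b x).
  by move=> h c ec; apply: h; rewrite -[RHS]ec; apply: eq_bigr => i _; rewrite extE.
have [|phi hphi] := @findep_form m.+1 (ext (fun i => iter i th e) f) ord_max.
  apply: findep_ext; first exact: findep_in.
  by move=> c; rewrite extm => ec; apply: (hf c); rewrite ec; apply: eq_bigr => i _; rewrite extE.
have phif : phi f = 1 by have := hphi ord_max; rewrite /= extm eqxx.
have phie (i : 'I_m) : phi (iter i th e) = 0.
  have := hphi (widen_ord (leqnSn m) i); rewrite /= extE => ->.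
  by rewrite -val_eqE /= ltn_eqF.
pose P g := iter m th g - \sum_i a i *: iter i th g.
pose q := theta_poly phi m f - \sum_i a i *: theta_poly phi i f.
have q0 : q != 0.
  apply/eqP => /(congr1 (fun p : {poly K} => p`_m)); rewrite coefB theta_poly_lead phif poly.coef_sum.
  rewrite big1 ?subr0 ?poly.coef0; first by move/eqP; rewrite oner_eq0.
  by move=> i _; rewrite coefZ nth_default ?mulr0 // (leq_trans (size_theta_poly _ _ _)).
have [j /(_ j (leqnn _)) hj] := exists_nonroot laurent_nat_inj q0.
pose g := lmono 1 j%:Z *: f.
have phiP : phi (P g) != 0.
  rewrite /P linearB linear_sum theta_polyE.
  under eq_bigr do rewrite linearZ /= theta_polyE.
  have -> : \sum_(i < m) a i *: (lmono 1 j%:Z * (theta_poly phi i f).[j%:R] : K^o) =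
      lmono 1 j%:Z * (\sum_i a i *: theta_poly phi i f).[j%:R].
    rewrite horner_sum mulr_sumr; apply: eq_bigr => i _.
    by rewrite hornerZ /GRing.scale /= mulrCA.
  by rewrite -mulrBr -hornerN -hornerD mulf_neq0 // lmono_neq0 // oner_neq0.
have hA : family_indep m.+1 (ext (fun i => iter i th e) (P g)).
  apply: findep_ext; first exact: findep_in.
  move=> c; rewrite extm => ec; move/eqP: phiP; apply; rewrite ec linear_sum big1 // => i _.
  by rewrite extE linearZ /= phie /GRing.scale /= mulr0.
have [c c0 hc] := findep_perturb (ext (fun i => iter i th g) 0) hA.
pose e' := e + lmono c 0 *: g.
have ee' i : iter i th e' = iter i th e + lmono c 0 *: iter i th g.
  by rewrite iter_thetaD iter_theta_const.
apply: (nomore e') => s; rewrite big_ord_recr /= => es.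
have em : iter m th e' = \sum_i a i *: iter i th e' + lmono c 0 *: P g.
  rewrite ee' ea scalerBr addrA.
  under [X in _ = X + _ - _]eq_bigr do rewrite ee' scalerDr scalerA mulrC -scalerA.
  by rewrite big_split /= -scaler_sumr addrAC addrK.
pose t (i : 'I_m.+1) := if unlift ord_max i is Some i' then s (widen_ord (leqnSn m) i') + s ord_max * a i'
  else lmono c 0 * s ord_max.
have tl (i : 'I_m) : t (widen_ord (leqnSn m) i) = s (widen_ord (leqnSn m) i) + s ord_max * a i.
  have -> : widen_ord (leqnSn m) i = lift ord_max i by apply: val_inj; rewrite /= /bump leqNgt ltn_ord.
  by rewrite /t liftK; congr (s _ + _); apply: val_inj; rewrite /= /bump leqNgt ltn_ord.
have tm : t ord_max = lmono c 0 * s ord_max by rewrite /t unlift_none.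
have t0 : forall i, t i = 0.
  apply: hc; rewrite big_ord_recr /= !extm tm scaler0 addr0.
  move: es; rewrite em scalerDr scaler_sumr addrA -big_split /= => es; rewrite -[RHS]es; congr (_ + _).
    apply: eq_bigr => i _; by rewrite tl !extE -ee' scalerDl scalerA.
  by rewrite scalerA mulrC.
have sm : s ord_max = 0.
  by apply/eqP; have /eqP := t0 ord_max; rewrite tm mulf_eq0 (negPf (lmono_neq0 _ c0)).
move=> i; case: (unliftP ord_max i) => [i' ->|-> //].
have -> : lift ord_max i' = widen_ord (leqnSn m) i'.
  by apply: val_inj; rewrite /= /bump leqNgt ltn_ord.
by have := t0 (widen_ord (leqnSn m) i'); rewrite tl sm mul0r addr0.
Qed.

End Cyclic.

(** * Good lattice pairs *)

Section GoodLattice.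
Variables (k : fieldType) (char0 : [pchar k] =i pred0) (M : connection k).
Local Notation K := (laurent k).
Local Notation th := (@theta k M).
Implicit Types (V W : set M) (x y v w m : M).

Lemma findep_frame a : family_indep (\dim {:M}) a -> frame (fun i : 'I_(\dim {:M}) => (a i : M)).
Proof.
move=> h m; have := findep_free h; set t := [tuple _ | _ < _] => ft.
have st : <<t>>%VS = fullv.
  apply/eqP; rewrite eqEdim subvf /=; move: ft; rewrite /free size_tuple => /eqP ->.
  by [].
have : m \in <<t>>%VS by rewrite st memvf.
move=> /coord_span ->; exists (fun i => coord t i m); apply: eq_bigr => i _.
by rewrite -tnth_nth tnth_mktuple.
Qed.

Lemma sep_chain W (z : nat -> M) : is_lattice W -> (forall j, W (z j)) ->
  (forall j, z j = lunif *: z j.+1) -> z 0%N = 0.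
Proof.
move=> lW hz ez; apply: (lattice_sep lW) => n.
have -> : z 0%N = lmono 1 n%:Z *: z n.
  elim: n => [|n IH]; first by rewrite lmono1 scale1r.
  by rewrite IH ez scalerA lunifE lmono1M; congr (lmono _ _ *: _); lia.
by rewrite scalerA lmono1M addNr lmono1 scale1r.
Qed.

(* theta conjugated by u^n *)
Definition theta_twist (n : int) m := theta m + lmono n%:~R 0 *: m.

Lemma theta_shift n m : theta (lmono 1 n *: m) = lmono 1 n *: theta_twist n m.
Proof.
by rewrite theta_mono addrC scalerDr scalerA lmonoM mul1r addr0.
Qed.

Lemma thetanD n x y : theta_twist n (x + y) = theta_twist n x + theta_twist n y.
Proof. by rewrite /theta_twist thetaD scalerDr addrACA. Qed.

Lemma thetanB n x y : theta_twist n (x - y) = theta_twist n x - theta_twist n y.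
Proof. by rewrite /theta_twist /theta raddfB !scalerBr opprD addrACA. Qed.

Lemma thetan_const n c x : theta_twist n (lmono c 0 *: x) = lmono c 0 *: theta_twist n x.
Proof. by rewrite /theta_twist theta_const scalerDr; congr (_ + _); rewrite !scalerA mulrC. Qed.

Lemma thetan_unif n x : theta_twist n (lunif *: x) = lunif *: theta_twist (n + 1) x.
Proof.
rewrite /theta_twist (theta_shift 1) lunifE scalerA mulrC -scalerA -scalerDr /theta_twist.
by rewrite -addrA -scalerDl -lmonoD -intrD [1 + n]addrC.
Qed.

Lemma thetan0 x : theta_twist 0 x = theta x.
Proof. by rewrite /theta_twist mulr0z lmono0 scale0r addr0. Qed.

Definition lattice_pair V W :=
  [/\ is_lattice V, is_lattice W, V `<=` W & forall v, V v -> W (theta v)].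

Definition onto V W n := forall w, W w -> exists2 v, V v & theta_twist n v = w.

Lemma lattice_pair_thetan V W n v : lattice_pair V W -> V v -> W (theta_twist n v).
Proof.
move=> [lV lW VW tVW] Vv; have [_ hD _] := lattice_submod lW; apply: hD; first exact: tVW.
by apply: submod_mono; [|exact: lattice_submod|exact: VW].
Qed.

Lemma lattice_pair_shift V W n v : lattice_pair V W -> V v ->
  shift 1 W (theta_twist n (lunif *: v)).
Proof.
by move=> h Vv; rewrite thetan_unif; apply: shiftE; apply: lattice_pair_thetan h Vv.
Qed.

Lemma onto_lift V W n : lattice_pair V W ->
  (forall (j : nat) w, W w -> exists2 v, V v & shift 1 W (w - theta_twist (n + j%:Z) v)) ->
  onto V W n.
Proof.
move=> pVW h w Ww; have [lV lW VW tVW] := pVW.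
have /choice[g hg] : forall jw : nat * M, exists vw : M * M, W jw.2 ->
    [/\ V vw.1, W vw.2 & jw.2 = theta_twist (n + jw.1%:Z) vw.1 + lunif *: vw.2].
  move=> [j w0] /=; have [Ww0|?] := pselect (W w0); last by exists (0, 0).
  have [v Vv /shiftP[w' Ww' e]] := h j w0 Ww0.
  by exists (v, w') => _; split=> //=; rewrite -lunifE in e; rewrite -e addrC subrK.
pose ws := fix ws j := if j is j'.+1 then (g (j', ws j')).2 else w.
have hws j : W (ws j) by elim: j => // j IH /=; have [] := hg (j, ws j) IH.
have hvs j := hg (j, ws j) (hws j).
have [|y hy ey] := lattice_complete (a := fun j => (g (j, ws j)).1) lV.
  by move=> j; have [] := hvs j.
exists (y 0%N) => //; apply/eqP; rewrite -subr_eq0; apply/eqP.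
pose z (j : nat) := theta_twist (n + j%:Z) (y j) - ws j.
have -> : theta_twist n (y 0%N) - w = z 0%N by rewrite /z addr0.
apply: (sep_chain lW) => j.
  by apply: submodB => //; [exact: lattice_submod|exact: lattice_pair_thetan pVW _].
have [_ _ /= e] := hvs j; rewrite /z [y j]ey [X in _ - X = _]e thetanD thetan_unif.
rewrite scalerBr opprD addrACA subrr add0r; congr (_ *: theta_twist _ _ - _); lia.
Qed.

Hypothesis nohor : no_horizontal_sections M.

Lemma theta_inj x : theta x = 0 -> x = 0.
Proof.
move=> /eqP; rewrite scaler_eq0 (negPf (lunif_neq0 k)) /= => /eqP; exact: nohor.
Qed.

Lemma thetan_inj n x y : theta_twist n x = theta_twist n y -> x = y.
Proof.
move=> e; apply/eqP; rewrite -subr_eq0; apply/eqP.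
have : theta_twist n (x - y) = 0 by rewrite thetanB e subrr.
move=> h; have := theta_shift n (x - y); rewrite h scaler0 => /theta_inj/eqP.
by rewrite scaler_eq0 (negPf (lmono_neq0 _ (oner_neq0 _))) => /eqP.
Qed.

Lemma onto_surj_mod V W n : lattice_pair V W -> onto V W n ->
  forall w, W w -> exists2 v, V v & shift 1 W (w - theta_twist n v).
Proof.
move=> [_ lW _ _] h w /h[v Vv <-]; exists v => //; rewrite subrr.
by case: (shift_submod 1 (lattice_submod lW)).
Qed.

Lemma onto_succ V W n : lattice_pair V W -> onto V W n -> onto V W (n + 1).
Proof.
move=> pVW h w Ww; have [lV lW VW tVW] := pVW.
have inj := index_surj_inj lV lW (@thetanD n) (thetan_const n)
  (fun v => @lattice_pair_thetan V W n v pVW) (fun v => @lattice_pair_shift V W n v pVW)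
  (onto_surj_mod pVW h).
have Wuw : W (lunif *: w) by apply: submod_mono => //; exact: lattice_submod.
have [v Vv ev] := h _ Wuw; have : shift 1 W (theta_twist n v) by rewrite ev; apply: shiftE.
move=> /(inj _ Vv)/shiftP[v' Vv' ev']; exists v' => //.
move: ev; rewrite ev' -lunifE thetan_unif => /scalerI; apply; exact: lunif_neq0.
Qed.

Lemma onto_pred V W n : lattice_pair V W -> onto V W n -> onto V W (n - 1).
Proof.
move=> pVW h; have [lV lW VW tVW] := pVW.
have st w : W w -> exists2 v, V v & theta_twist (n - 1) (lunif *: v) = lunif *: w.
  by move=> /h[v Vv <-]; exists v => //; rewrite thetan_unif subrK.
have inj v : V v -> shift 1 W (theta_twist (n - 1) v) -> shift 1 V v.
  move=> Vv /shiftP[w /st[v' Vv' e']]; rewrite -lunifE -e' => /thetan_inj ->.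
  exact: shiftE.
have surj := index_inj_surj lV lW (@thetanD (n - 1)) (thetan_const (n - 1))
  (fun v => @lattice_pair_thetan V W (n - 1) v pVW) (fun v => @lattice_pair_shift V W (n - 1) v pVW)
  inj.
move=> w /surj[v Vv /shiftP[w' /st[v' Vv' e']]]; rewrite -lunifE -e' => e.
have [_ hD hZ] := lattice_submod lV.
exists (v + lunif *: v'); first by apply: hD => //; apply: hZ => //; apply: ps_unif.
by rewrite thetanD -e addrC subrK.
Qed.

Lemma onto_all V W n : lattice_pair V W -> onto V W n -> forall p, onto V W p.
Proof.
move=> pVW h p; have up (j : nat) q : onto V W q -> onto V W (q + j%:Z).
  elim: j => [|j IH] hq; first by rewrite addr0.
  by have := onto_succ pVW (IH hq); have -> : q + j%:Z + 1 = q + j.+1%:Z by lia.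
have dn (j : nat) q : onto V W q -> onto V W (q - j%:Z).
  elim: j => [|j IH] hq; first by rewrite subr0.
  by have := onto_pred pVW (IH hq); have -> : q - j%:Z - 1 = q - j.+1%:Z by lia.
have [le|lt] := leP n p.
  by have := up `|p - n|%N _ h; have -> : n + (`|p - n|%N)%:Z = p by lia.
by have := dn `|n - p|%N _ h; have -> : n - (`|n - p|%N)%:Z = p by lia.
Qed.

Section Pev.
Variable e : M.
Definition pev N (p : {poly k}) := \sum_(i < N) lmono p`_i 0 *: iter i th e.

Lemma pevD N p q : pev N (p + q) = pev N p + pev N q.
Proof.
by rewrite -big_split; apply: eq_bigr => i _; rewrite poly.coefD lmonoD scalerDl.
Qed.
Lemma pevZ N c p : pev N (c *: p) = lmono c 0 *: pev N p.
Proof.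
by rewrite scaler_sumr; apply: eq_bigr => i _; rewrite coefZ scalerA lmonoM addr0.
Qed.
Lemma pevX N p : pev N.+1 ('X * p) = theta (pev N p).
Proof.
rewrite /pev big_ord_recl coefXM /= lmono0 scale0r add0r theta_sum.
by apply: eq_bigr => i _; rewrite theta_const coefXM.
Qed.
Lemma pevS N (p : {poly k}) : (size p <= N)%N -> pev N.+1 p = pev N p.
Proof. by move=> sp; rewrite /pev big_ord_recr /= nth_default // lmono0 scale0r addr0. Qed.

(* Modulo u, theta + n is multiplication by X + n in k[X]/q, which is onto unless q(-n) = 0. *)
Lemma pev_onto N (q : {poly k}) (n : nat) (S : set M) :
  submod S -> (size q <= N.+1)%N -> ~~ root q (- n%:R) -> S (pev N.+1 q) ->
  forall p : {poly k}, (size p <= N.+1)%N ->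
  exists s : {poly k}, S (pev N.+1 p - theta_twist n (pev N s)).
Proof.
move=> hS sq rq Sq p sp; pose c := p.[- n%:R] / q.[- n%:R].
pose r := p - c *: q.
have /factor_theorem[s es] : root r (- n%:R).
  by rewrite rootE hornerD hornerN hornerZ mulfVK // subrr.
have sr : (size r <= N.+1)%N.
  rewrite (leq_trans (size_polyD _ _)) // geq_max sp size_polyN.
  exact: leq_trans (size_scale_leq _ _) sq.
have ss : (size s <= N)%N.
  have [->|s0] := eqVneq s 0; first by rewrite size_poly0.
  by move: sr; rewrite es size_Mmonic ?monicXsubC // size_XsubC addn2.
exists s; suff -> : theta_twist n (pev N s) = pev N.+1 p - lmono c 0 *: pev N.+1 q.
  by rewrite opprB addrC subrK; apply: submod_mono.
have -> : pev N.+1 p - lmono c 0 *: pev N.+1 q = pev N.+1 r.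
  by rewrite /r -[- (c *: q)]scaleNr pevD pevZ lmonoN scaleNr.
have -> : r = 'X * s + n%:R *: s.
  by rewrite es mulrC mulrBl polyCN mulNr opprK mul_polyC.
by rewrite pevD pevX pevZ (pevS ss).
Qed.

End Pev.

Lemma exists_onto_pair : exists V W, lattice_pair V W /\ forall n, onto V W n.
Proof.
have [e he] := exists_findep_cyclic char0 M; set d := \dim {:M} in he.
pose b (i : nat) := iter i th e; have fe : frame (fun i : 'I_d => b i) := findep_frame he.
pose V := ispan (fun i : 'I_d => b i); pose W := ispan (fun i : 'I_d.+1 => b i).
have sW : submod W := ispan_submod _.
have genW i : (i <= d)%N -> W (b i).
  by move=> li; exact: (ispan_gen (fun i : 'I_d.+1 => b i) (Ordinal (li : (i < d.+1)%N))).
have VW : V `<=` W by apply: ispan_sub => // i; apply/genW/ltnW/ltn_ord.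
have pVW : lattice_pair V W.
  split=> //.
  - by apply/latticeP; exists d, (fun i => b i).
  - apply/latticeP; exists d.+1, (fun i => b i); split=> // m.
    have [a ->] := fe m; exists (fun i : 'I_d.+1 => oapp a 0 (insub (i : nat))).
    rewrite big_ord_recr /= insubF ?ltnn // scale0r addr0; apply: eq_bigr => i _.
    by rewrite valK.
  - move=> v [a ha ->]; rewrite theta_sum; apply: submod_sum => // i _.
    case: (sW) => _ hD hZ; rewrite thetaZ; apply: hD; apply: hZ => //.
    + by apply: psM; [exact: ps_unif|exact: ps_deriv].
    + exact/genW/ltnW/ltn_ord.
    + exact: (genW i.+1).
have [Q [hQ [j hj]] eQ] : exists2 Q : 'I_d.+1 -> K,
    (forall i, power_series (Q i)) /\ (exists j, Q j 0 != 0) & \sum_i Q i *: b i = 0.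
  have : ~ family_indep d.+1 b by move=> /findep_leq; rewrite ltnn.
  move=> /existsNP[Q /not_implyP[eQ /existsNP /primitive[c [h1 h2]]]].
  exists (fun i => lmono 1 c * Q i) => //.
  have := congr1 (fun m => lmono 1 c *: m) eQ; rewrite scaler0 scaler_sumr => {2}<-.
  by apply: eq_bigr => i _; rewrite scalerA.
pose red (a : 'I_d.+1 -> K) : {poly k} := \poly_(i < d.+1) a (inord i) 0.
have pev_red a : pev e d.+1 (red a) = \sum_i lmono (a i 0) 0 *: b i.
  by apply: eq_bigr => i _; rewrite coef_poly ltn_ord inord_val.
have q0 : red Q != 0.
  apply/eqP => /(congr1 (fun p : {poly k} => p`_j)); rewrite coef_poly ltn_ord inord_val poly.coef0.
  by move/eqP; rewrite (negPf hj).
have injN : injective (fun n : nat => - n%:R : k).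
  by move=> m n /= /oppr_inj/(natr_inj char0).
have [n0 hn0] := exists_nonroot injN q0.
exists V, W; split=> //; apply: (@onto_all V W n0%:Z) => //; apply: onto_lift => // j' w Ww.
have [a ha ->] := Ww.
have Sq : shift 1 W (pev e d.+1 (red Q)).
  have := ispan_residue (fun i : 'I_d.+1 => b i) hQ; rewrite eQ sub0r -pev_red.
  by move=> /(submodN (shift_submod 1 sW)); rewrite opprK.
have [s hs] := pev_onto (shift_submod 1 sW) (size_poly _ _)
  (hn0 (n0 + j')%N (leq_addr _ _)) Sq (size_poly _ (fun i => a (inord i) 0)).
exists (pev e d s).
  by exists (fun i => lmono s`_i 0) => // i; apply: ps_mono.
rewrite -PoszD; have := ispan_residue (fun i : 'I_d.+1 => b i) ha; rewrite -pev_red => h.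
rewrite -(subrK (pev e d.+1 (red a)) (\sum_i _)) -addrA.
by case: (shift_submod 1 sW) => _ hD _; apply: hD.
Qed.

Lemma nabla_surj m : exists m', nabla M m' = m.
Proof.
have [V [W [[lV lW _ _] h]]] := exists_onto_pair.
have [N hN] := lattice_absorbing lW (lunif *: m).
have [v Vv ev] := h (- N%:Z) _ hN.
exists (lmono 1 (- N%:Z) *: v); apply: (scalerI (lunif_neq0 k)).
rewrite -/(theta _) theta_shift ev scalerA lmono1M addNr lmono1 scale1r //.
Qed.

Lemma good_lattice_pairE V W : good_lattice_pair V W <->
  lattice_pair V W /\ forall n, onto V W n.
Proof.
split=> [[lV lW VW tVW [_ _ h _]]|[[lV lW VW tVW] h]].
  have pVW : lattice_pair V W by [].
  split=> //; apply: (@onto_all _ _ 0) => // w Ww.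
  have [m em] := nabla_surj (lunif^-1 *: w).
  have [||v Vv ev] := h (lunif^-1 *: w); last 1 first.
  - by exists v => //; rewrite thetan0 /theta -ev scalerA divff ?scale1r ?lunif_neq0.
  - by rewrite /div_unif /= scalerA divff ?scale1r ?lunif_neq0.
  - by exists m.
split=> //; split.
- by [].
- by move=> m /nohor ->; case: (lattice_submod lV).
- move=> b Wb _; have [v Vv ev] := h 0 _ Wb; exists v => //.
  by apply: (scalerI (lunif_neq0 k)); rewrite -ev thetan0.
- move=> m; exists 0.
    by rewrite /div_unif /= scaler0; case: (lattice_submod lW).
  by have [m' <-] := nabla_surj m; exists m'; rewrite subr0.
Qed.

End GoodLattice.

(** * Slopes and lattices stable under u^2 d_u *)

Section Newton.
Variables (k : fieldType) (P : {poly laurent k}) (d : nat).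
Hypotheses (Pm : P \is monic) (sP : size P = d.+1).

Lemma has_order_exists (f : laurent k) : f != 0 -> exists n, has_order f n.
Proof.
move=> f0; have [c [h1 [_ h2]]] := @primitive _ unit (fun=> f) (ex_intro _ tt (fun e => negP f0 (introT eqP e))).
move: h2; rewrite lmono_coef mul1r => h2.
exists (0 - c); split=> [|i li]; first exact/eqP.
have := h1 tt (i + c) _; rewrite lmono_coef mul1r addrK; apply; lia.
Qed.

Lemma order_one n : has_order (1 : laurent k) n -> n = 0.
Proof. by move=> [h _]; move: h; rewrite -lmono1 /=; case: eqP. Qed.

Lemma monic_order0 : has_order P`_d 0.
Proof.
have -> : P`_d = 1 by have /monicP := Pm; rewrite /lead_coef sP.
by split=> [/eqP|i i0]; rewrite -lmono1 /= ?oner_eq0 // lt_eqF.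
Qed.

Lemma newton_lt1 s : (forall i n, (i < d)%N -> n <= i%:Z - d%:Z -> P`_i n = 0) ->
  newton_slope P s -> s < 1.
Proof.
move=> h [c [hc [i [j [ij [i' [n [ii' [hn hn0] le]] [j' [n' [jj' [hn' _] _]]]]]]]]].
have small (l : nat) p : P`_l p <> 0 -> (l <= d)%N.
  by move=> hl; rewrite leqNgt; apply/negP => hlt; apply: hl; rewrite nth_default ?sP.
have i'd := small _ _ hn; have j'd := small _ _ hn'.
rewrite ltNge; apply/negP => s1.
have id : (i < d)%N by lia.
have cd : c + s * d%:R <= 0.
  by apply: hc; exists d, 0; split=> //; exact: monic_order0.
have dpos : 1 <= d%:R - i%:R :> rat by rewrite -natrB ?(ltnW id) // ler1n subn_gt0.
have le2 : n%:~R <= i%:R - d%:R :> rat.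
  have h1 : (s - 1) * (d%:R - i%:R) >= 0 by apply: mulr_ge0; lra.
  by nra.
have {}le2 : n <= i%:Z - d%:Z.
  by rewrite -(ler_int rat) intrD intrN -!pmulrn.
have [lt|ge] := ltnP i' d.
  by apply: hn; apply: h => //; lia.
have e : i' = d by lia.
have : n = 0.
  apply: order_one; have <- : P`_d = 1 by have /monicP := Pm; rewrite /lead_coef sP.
  by rewrite -e.
by lia.
Qed.

Lemma newton_ge1 i0 n0 : (i0 < d)%N -> n0 <= i0%:Z - d%:Z -> P`_i0 n0 != 0 ->
  exists2 s, 1 <= s & newton_slope P s.
Proof.
move=> i0d n0le hn0.
have /choice[o ho] : forall i : nat, exists n, P`_i != 0 -> has_order P`_i n.
  move=> i; have [->|/has_order_exists[n hn]] := eqVneq P`_i 0; first by exists 0.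
  by exists n.
pose sl (i : 'I_d) : rat := - (o i)%:~R / (d%:R - i%:R).
have dpos (i : 'I_d) : 1 <= d%:R - (i : nat)%:R :> rat.
  by rewrite -natrB ?(ltnW (ltn_ord i)) // ler1n subn_gt0.
have nz0 : P`_(Ordinal i0d) != 0 by apply: contraNneq hn0 => /= ->.
have [i nzi maxi] := @Order.TotalTheory.arg_maxP _ _ _ (Ordinal i0d)
  (fun i : 'I_d => P`_i != 0) sl nz0.
have slE (j : 'I_d) : (o j)%:~R = - sl j * (d%:R - (j : nat)%:R).
  by rewrite /sl mulNr -mulrA mulVf ?mulr1 ?opprK //; have := dpos j; case: eqP => // ->; lra.
have s1 : 1 <= sl i.
  apply: le_trans (maxi _ nz0); have := slE (Ordinal i0d); have := dpos (Ordinal i0d).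
  have : (o i0)%:~R <= i0%:R - d%:R :> rat.
    have : o i0 <= i0%:Z - d%:Z.
      rewrite leNgt; apply/negP => lt; have [_ h] := ho _ nz0.
      by move/eqP: hn0; apply; apply: h; rewrite /=; lia.
    by rewrite -(ler_int rat) intrD intrN -!pmulrn.
  by rewrite /=; nra.
exists (sl i) => //; exists (- sl i * d%:R); split.
  move=> a y [j [n [aj [hn1 hn2] le]]].
  have nzj : P`_j != 0 by apply/eqP => e; apply: hn1; rewrite e.
  have jd : (j <= d)%N.
    by rewrite leqNgt; apply/negP => hlt; move: nzj; rewrite nth_default ?sP ?eqxx.
  have aj' : a%:R <= j%:R :> rat by rewrite ler_nat.
  apply: le_trans le; move: jd; rewrite leq_eqVlt => /orP[/eqP e|lt].
    have -> : n = 0.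
      apply: order_one; have <- : P`_d = 1 by have /monicP := Pm; rewrite /lead_coef sP.
      by rewrite -e.
    by rewrite -e; nra.
  have := maxi (Ordinal lt) nzj; have := slE (Ordinal lt); have := dpos (Ordinal lt).
  have -> : o (Ordinal lt) = n.
    have [h1 h2] := ho j nzj; rewrite /=; case: (ltgtP (o j) n) => // ?.
      by case: h1; apply: hn2.
    by case: hn1; apply: h2.
  by rewrite /= => ? -> ?; nra.
exists i, d; split=> //.
- exists i, (o i); split=> //; first exact: ho.
  by rewrite slE; lra.
- exists d, 0; split=> //; first exact: monic_order0.
  by lra.
Qed.

End Newton.

Section Delta.
Variables (k : fieldType) (M : connection k).
Local Notation K := (laurent k).
Local Notation th := (@theta k M).
Implicit Types (V W S T L : set M) (x y v w m : M).

(* u^2 d_u; the slopes of M are < 1 iff it is topologically nilpotent. *)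
Definition delta m : M := lunif *: theta m.

Lemma deltaE m : delta m = lunif ^+ 2 *: nabla M m.
Proof. by rewrite /delta /theta scalerA expr2. Qed.

Lemma deltaD x y : delta (x + y) = delta x + delta y.
Proof. by rewrite /delta thetaD scalerDr. Qed.

Lemma deltaB x y : delta (x - y) = delta x - delta y.
Proof. by rewrite !deltaE raddfB scalerBr. Qed.

Lemma deltaZ (f : K) x : delta (f *: x) = lunif *: ((lunif * lderiv f) *: x) + f *: delta x.
Proof. by rewrite /delta thetaZ scalerDr !scalerA [lunif * f]mulrC. Qed.

Lemma delta_mono n x :
  delta (lmono 1 n *: x) = lmono 1 n *: (delta x + lmono n%:~R 1 *: x).
Proof.
rewrite /delta theta_shift scalerA mulrC -scalerA; congr (_ *: _).
by rewrite /theta_twist scalerDr; congr (_ + _); rewrite scalerA lunifE lmonoM mul1r addr0.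
Qed.

Lemma delta_const c x : delta (lmono c 0 *: x) = lmono c 0 *: delta x.
Proof. by rewrite /delta theta_const scalerA mulrC -scalerA. Qed.

Lemma iter_deltaD n x y : iter n delta (x + y) = iter n delta x + iter n delta y.
Proof. by elim: n => //= n ->; rewrite deltaD. Qed.

Lemma iter_delta_const n c x : iter n delta (lmono c 0 *: x) = lmono c 0 *: iter n delta x.
Proof. by elim: n => //= n ->; rewrite delta_const. Qed.

Definition delta_stable V := forall x, V x -> V (delta x).

Lemma iter_delta_stable V n x : delta_stable V -> V x -> V (iter n delta x).
Proof. by move=> h Vx; elim: n => //= n; apply: h. Qed.

Lemma delta_ispan n (e : 'I_n -> M) T : submod T ->
  (forall i, T (lunif *: e i)) -> (forall i, T (delta (e i))) ->
  forall x, ispan e x -> T (delta x).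
Proof.
move=> sT h1 h2 x [a ha ->]; have [h0 hTD hZ] := sT.
elim/big_rec: _ => [|i y _ hy]; first by rewrite deltaE raddf0 scaler0.
rewrite deltaD; apply: (hTD) => //; rewrite deltaZ; apply: (hTD); last exact: hZ.
rewrite scalerA mulrC -scalerA; apply: hZ => //.
by apply: psM; [exact: ps_unif|exact: ps_deriv].
Qed.

Lemma delta_shift V n : submod V -> delta_stable V -> delta_stable (shift n V).
Proof.
move=> sV dV x /shiftP[y Vy ->]; rewrite delta_mono; apply: shiftE.
by case: (sV) => _ hD _; apply: hD; [exact: dV|exact: submod_mono].
Qed.

Lemma iter_delta_shift V n j x : submod V -> delta_stable V -> V x ->
  shift (j + 1) V (iter n delta (lmono 1 j *: x) - lmono 1 j *: iter n delta x).
Proof.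
move=> sV dV Vx; have sV' := shift_submod (j + 1) sV.
elim: n => [|n IH] /=; first by rewrite subrr; case: sV'.
rewrite -(subrK (delta (lmono 1 j *: iter n delta x)) (delta _)) -deltaB -addrA.
case: (sV') => _ hD _; apply: hD; first exact: delta_shift IH.
rewrite delta_mono scalerDr addrC addKr scalerA mulrC -scalerA.
have -> : lmono j%:~R 1 = lmono (j%:~R : k) 0 * lmono 1 1 by rewrite lmonoM mulr1 add0r.
rewrite -scalerA; apply: submod_mono => //.
by rewrite scalerA lmono1M addrC; apply: shiftE; apply: iter_delta_stable.
Qed.

Definition delta_nilp V d := forall x, V x -> shift 1 V (iter d delta x).

Lemma delta_nilp_shift V d j : submod V -> delta_stable V -> delta_nilp V d ->
  forall x, shift j V x -> shift (j + 1) V (iter d delta x).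
Proof.
move=> sV dV nV x /shiftP[y Vy ->].
have := iter_delta_shift d j sV dV Vy => h.
rewrite -(subrK (lmono 1 j *: iter d delta y) (iter d delta _)).
case: (shift_submod (j + 1) sV) => _ hD _; apply: hD => //.
by rewrite -shift_shift; apply: shiftE; apply: nV.
Qed.

Lemma delta_nilp_iter V d j n : submod V -> delta_stable V -> delta_nilp V d ->
  forall x, shift j V x -> shift (j + n%:Z) V (iter (n * d) delta x).
Proof.
move=> sV dV nV; elim: n => [|n IH] x Vx; first by rewrite addr0.
rewrite mulSn iterD; have -> : j + n.+1%:Z = j + n%:Z + 1 by lia.
by apply: delta_nilp_shift => //; exact: IH.
Qed.

Variable e : M.
Definition eps (i : nat) : M := lmono 1 i%:Z *: iter i th e.

Lemma delta_eps i : delta (eps i) = eps i.+1 + lmono i%:R 1 *: eps i.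
Proof.
rewrite /eps delta_mono scalerDr; congr (_ + _).
  by rewrite /delta lunifE scalerA lmono1M [_ + 1]addrC.
by rewrite !scalerA mulrC.
Qed.

Lemma iter_delta_eps V n i : submod V -> delta_stable V -> (forall j, V (eps j)) ->
  forall j, shift j V (eps i) -> shift (j + 1) V (iter n delta (eps i) - eps (n + i)).
Proof.
move=> sV dV hV j hj; have sV' := shift_submod (j + 1) sV.
have [_ hD _] := sV'; have mono m c : shift j V m -> shift (j + 1) V (lmono c 1 *: m).
  move=> hm; have -> : lmono c 1 = lmono c 0 * lmono 1 1 by rewrite lmonoM mulr1 add0r.
  by rewrite -scalerA; apply: submod_mono => //; rewrite addrC -shift_shift; apply: shiftE.
have sh n' : shift j V (eps (n' + i)).
  elim: n' => // n' IH; have -> : eps (n'.+1 + i) = delta (eps (n' + i)) - lmono (n' + i)%:R 1 *: eps (n' + i).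
    by rewrite delta_eps addrK.
  apply: submodB; [exact: shift_submod|exact: delta_shift|].
  by apply: submod_mono => //; exact: shift_submod.
elim: n => [|n IH]; first by rewrite subrr; case: sV'.
have -> : iter n.+1 delta (eps i) - eps (n.+1 + i) =
    delta (iter n delta (eps i) - eps (n + i)) + lmono (n + i)%:R 1 *: eps (n + i).
  by rewrite deltaB delta_eps opprD addrA subrK.
by apply: hD; [exact: delta_shift|exact: mono].
Qed.

Lemma eps_frame d : frame (fun i : 'I_d => iter i th e) -> frame (fun i : 'I_d => eps i).
Proof.
move=> h m; have [a ->] := h m; exists (fun i => a i * lmono 1 (- i%:Z)).
by apply: eq_bigr => i _; rewrite scalerA -mulrA lmono1M addNr mulr1.
Qed.

End Delta.

Section Slopes.
Variables (k : fieldType) (M : connection k).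
Local Notation K := (laurent k).
Local Notation th := (@theta k M).
Local Notation d := (\dim {:M}).
Local Notation dl := (@delta k M).

Lemma cyclic_findep (e : M) : cyclic_vector e <-> family_indep d (fun i => iter i th e).
Proof.
have es : mkseq (fun i => iter i th e) d = [tuple iter i th e | i < d].
  by rewrite /mkseq -val_enum_ord -map_comp.
rewrite /cyclic_vector es; split=> [/basis_free/freeP h a ea|h].
  apply: h; rewrite -[RHS]ea; apply: eq_bigr => i _.
  by rewrite -tnth_nth tnth_mktuple.
rewrite basisEfree findep_free // subvf /= size_map size_enum_ord //.
Qed.

Lemma slopes_top_nilp (char0 : [pchar k] =i pred0) : all_slopes_lt1 M ->
  exists (E : set M) n, [/\ is_lattice E, delta_stable E & delta_nilp E n].
Proof.
move=> hs; have [e he] := exists_findep_cyclic char0 M.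
have fe := findep_frame he; have [a ea] := fe (iter d th e).
pose P : {poly K} := \poly_(i < d.+1) (if insub i is Some j then - a j else 1).
have Pi (i : 'I_d) : P`_i = - a i by rewrite coef_poly ltnS ltnW // valK.
have Pd : P`_d = 1 by rewrite coef_poly ltnSn insubF // ltnn.
have sP : size P = d.+1 by rewrite size_poly_eq // insubF ?ltnn // oner_neq0.
have Pm : P \is monic by rewrite monicE /lead_coef sP Pd.
have ha (i : 'I_d) n : n <= i%:Z - d%:Z -> a i n = 0.
  move=> hn; apply/eqP/negPn/negP => ne.
  have [|s s1 hsl] := @newton_ge1 _ P d Pm sP i n (ltn_ord i) hn.
    by rewrite Pi coefN oppr_eq0.
  have : s < 1.
    apply: hs; exists e, P; split=> //; first exact/cyclic_findep.
    rewrite sP big_ord_recr /= Pd scale1r ea -big_split big1 // => j _ /=.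
    by rewrite Pi scaleNr addNr.
  by rewrite ltNge s1.
pose E := ispan (fun i : 'I_d => eps e i); have sE : submod E := ispan_submod _.
have sE1 := shift_submod 1 sE; have [E10 E1D E1Z] := sE1.
have gE i : (i < d)%N -> E (eps e i).
  by move=> h; exact: (ispan_gen (fun i : 'I_d => eps e i) (Ordinal h)).
have epsd : shift 1 E (eps e d).
  rewrite /eps ea scaler_sumr; apply: submod_sum => // i _.
  have -> : lmono 1 d%:Z *: (a i *: iter i th e) =
      (lmono 1 (d%:Z - i%:Z - 1) * a i) *: (lmono 1 1 *: eps e i).
    have -> : lmono (1 : k) d%:Z = lmono 1 (d%:Z - i%:Z - 1) * lmono 1 1 * lmono 1 i%:Z.
      by rewrite !lmono1M; congr lmono; lia.
    by rewrite /eps !scalerA; congr (_ *: _); ring.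
  apply: E1Z; last by apply: shiftE; apply: gE; apply: ltn_ord.
  by move=> n n0; rewrite lmono_coef mul1r ha //; lia.
pose G j := ispan (fun i : 'I_d => if (j <= i)%N then eps e i else 0).
have sG j : submod (G j) by exact: ispan_submod.
pose T j : set M := [set x | exists2 y, G j y & shift 1 E (x - y)].
have sT j : submod (T j).
  have [G0 G_der GZ] := sG j; split=> [|x y [x' gx hx] [y' gy hy]|f x hf [x' gx hx]].
  - by exists 0; rewrite ?subrr.
  - by exists (x' + y'); [exact: G_der|rewrite opprD addrACA; exact: E1D].
  - by exists (f *: x'); [exact: GZ|rewrite -scalerBr; exact: E1Z].
have E1T j x : shift 1 E x -> T j x by exists 0; rewrite ?subr0 //; case: (sG j).
have epsT j i : (j <= i)%N -> (i <= d)%N -> T j (eps e i).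
  move=> ji; rewrite leq_eqVlt => /orP[/eqP ->|id]; first exact: E1T.
  exists (eps e i); last by rewrite subrr.
  by have := ispan_gen (fun i : 'I_d => if (j <= i)%N then eps e i else 0) (Ordinal id); rewrite /= ji.
have ueps i c : (i < d)%N -> shift 1 E (lmono c 1 *: eps e i).
  move=> id; have -> : lmono c 1 = lmono c 0 * lmono 1 1 by rewrite lmonoM mulr1 add0r.
  by rewrite -scalerA; apply: submod_mono => //; apply: shiftE; apply: gE.
have deps j i : (j <= i.+1)%N -> (i < d)%N -> T j (delta (eps e i)).
  move=> ji id; rewrite delta_eps; have [_ TD _] := sT j; apply: TD; first exact: epsT.
  by apply: E1T; apply: ueps.
have TE x : T 0%N x -> E x.
  move=> [y gy hy]; rewrite -(subrK y x); have [_ hD _] := sE; apply: hD.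
    by rewrite -(shift0 E); apply: shift_le hy.
  by apply: ispan_sub gy => // i; apply: gE; apply: ltn_ord.
have dE : delta_stable E.
  move=> x Ex; apply: TE; apply: delta_ispan Ex => // i; last exact: deps.
  by apply: E1T; apply: ueps.
have dT j x : T j x -> T j.+1 (delta x).
  move=> [y gy hy]; rewrite -(subrK y x) deltaD; have [_ TD _] := sT j.+1; apply: TD.
    by apply: E1T; apply: delta_shift.
  apply: delta_ispan gy => // i; case: ifP => ji.
  - by apply: E1T; apply: ueps.
  - by rewrite scaler0; case: (sT j.+1).
  - exact: deps.
  - by rewrite deltaE raddf0 scaler0; case: (sT j.+1).
have nT j x : E x -> T j (iter j dl x).
  elim: j => [|j IH] Ex; last exact/dT/IH.
  by exists x; rewrite ?subrr.
exists E, d; split=> //; first by apply/latticeP; exists d, (fun i => eps e i); split=> //; exact: eps_frame.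
move=> x /(nT d)[y gy]; suff -> : y = 0 by rewrite subr0.
move: gy => [b _ ->]; rewrite big1 // => i _.
by rewrite leqNgt ltn_ord scaler0.
Qed.

End Slopes.

Section TopNilp.
Variables (k : fieldType) (M : connection k).
Local Notation K := (laurent k).
Local Notation th := (@theta k M).
Local Notation d := (\dim {:M}).
Local Notation dl := (@delta k M).

Section Span.
Variables (e : M) (L : set M) (r : nat).
Hypotheses (he : family_indep d (fun i => iter i th e)) (lL : is_lattice L).
Hypotheses (dL : delta_stable L) (nL : delta_nilp L r) (Le : L e).

Let sL : submod L := lattice_submod lL.
Let E := ispan (fun i : 'I_d => eps e i).

(* the k[[u]]-module generated by all the u^i theta^i e *)
Variable E' : set M.
Hypotheses (sE' : submod E') (epsE' : forall i, E' (eps e i)).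
Hypothesis minE' : forall S, submod S -> (forall i, S (eps e i)) -> E' `<=` S.

Let dE' : delta_stable E'.
Proof.
move=> x hx; suff [] : E' x /\ E' (delta x) by [].
apply: (@minE' [set x | E' x /\ E' (delta x)]) hx => [|i].
  have [h0 hD hZ] := sE'; split=> [|y z [y1 y2] [z1 z2]|f y hf [y1 y2]].
  - by rewrite /= deltaE raddf0 scaler0.
  - by rewrite /= deltaD; split; apply: (hD).
  - split; first exact: (hZ).
    rewrite deltaZ scalerA; apply: hD; apply: (hZ) => //.
    by apply: psM; [exact: ps_unif|apply: psM; [exact: ps_unif|exact: ps_deriv]].
split; first exact: epsE'.
rewrite delta_eps; have [_ hD _] := sE'; apply: hD; first exact: epsE'.
by apply: (@submod_mono _ _ E').
Qed.

Let epsL i : L (eps e i).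
Proof.
elim: i => [|i IH]; first by rewrite /eps /= lmono1 scale1r.
have -> : eps e i.+1 = delta (eps e i) - lmono i%:R 1 *: eps e i.
  by rewrite delta_eps addrK.
by apply: submodB => //; [exact: dL|exact: submod_mono].
Qed.

Let lE : is_lattice E.
Proof.
by apply/latticeP; exists d, (fun i => eps e i); split=> //; apply/eps_frame/findep_frame.
Qed.

Let EE' : E `<=` E'. Proof. exact: ispan_sub. Qed.
Let E'L : E' `<=` L. Proof. exact: minE'. Qed.

Let eps_small q j : (q * r <= j)%N -> shift q%:Z L (eps e j).
Proof.
elim: q j => [|q IH] j hj; first by rewrite shift0.
have step n : shift (q%:Z + 1) L (iter r dl (eps e n) - eps e (r + n)) ->
    shift q%:Z L (eps e n) -> shift q.+1%:Z L (eps e (r + n)).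
  move=> h1 h2; have -> : q.+1%:Z = q%:Z + 1 by lia.
  rewrite -(subKr (iter r dl (eps e n)) (eps e (r + n))).
  apply: submodB => //; first exact: shift_submod.
  exact: delta_nilp_shift.
have hn : (q * r <= j - r)%N by move: hj; rewrite mulSn; lia.
have -> : j = (r + (j - r))%N by move: hj; rewrite mulSn; lia.
apply: step; last exact: IH.
by apply: iter_delta_eps => //; exact: IH.
Qed.

Let eps_unifE' : exists J, forall j, (J <= j)%N -> shift 1 E' (eps e j).
Proof.
have [b hb] := lattice_comm lL (lattice_submod lE) (lattice_absorbing lE).
exists (b.+1 * r)%N => j /eps_small/shiftP[x Lx ->].
have -> : lmono 1 b.+1%:Z = lmono 1 1 * lmono 1 b%:Z :> K by rewrite lmono1M; congr lmono; lia.
by rewrite -scalerA; apply: shiftE; apply: EE'; apply: hb.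
Qed.

Let epsd : shift 1 E' (eps e d).
Proof.
have sE1 := shift_submod 1 sE'; have [E10 E1D E1Z] := sE1.
have [c [i0 [c0 ci0 hc]]] : exists (c : 'I_d.+1 -> k) (i0 : 'I_d.+1),
    [/\ c i0 != 0, forall i : 'I_d.+1, (i < i0)%N -> c i = 0
      & shift 1 E' (\sum_i lmono (c i) 0 *: eps e i)].
  have : ~ family_indep d.+1 (eps e) by move=> /findep_leq; rewrite ltnn.
  move=> /existsNP[Q /not_implyP[eQ /existsNP /primitive[c [h1 [j hj]]]]].
  pose f (i : 'I_d.+1) := (lmono 1 c * Q i) 0.
  have fj : f j != 0 by [].
  have [i0 fi0 mini] := @arg_minnP _ j (fun i => f i != 0) (fun i => i : nat) fj.
  exists f, i0; split=> // [i lt|].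
    by apply/eqP/negPn/negP => /mini; rewrite leqNgt lt.
  have := ispan_residue (fun i : 'I_d.+1 => eps e i) h1.
  have -> : \sum_i (lmono 1 c * Q i) *: eps e i = 0.
    have := congr1 (fun m => lmono 1 c *: m) eQ; rewrite scaler0 scaler_sumr => e0; rewrite -[RHS]e0.
    by apply: eq_bigr => i _; rewrite -scalerA.
  rewrite sub0r => /(submodN (shift_submod 1 (ispan_submod _))); rewrite opprK.
  by apply: shift_sub; apply: ispan_sub.
have [J hJ] := eps_unifE'.
suff desc n j : (i0 <= j)%N -> (J <= n + j)%N -> shift 1 E' (eps e j).
  by apply: (desc J); rewrite ?leq_addr // -ltnS ltn_ord.
elim: n j => [|n IH] j ij hj; first exact: hJ.
have big j' : (j < j')%N -> shift 1 E' (eps e j').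
  by move=> lt; apply: IH; [exact: leq_trans ij (ltnW lt)|lia].
pose m := (j - i0)%N.
have h1 : shift 1 E' (iter m dl (\sum_i lmono (c i) 0 *: eps e i)).
  by apply: iter_delta_stable hc; apply: delta_shift.
have congm i : shift 1 E' (iter m dl (eps e i) - eps e (m + i)).
  by apply: (@iter_delta_eps _ _ e E' m i sE' dE' epsE' 0); rewrite shift0.
have h2 : shift 1 E' (\sum_i lmono (c i) 0 *: eps e (m + i)).
  have -> : \sum_i lmono (c i) 0 *: eps e (m + i) =
      iter m dl (\sum_i lmono (c i) 0 *: eps e i) -
      \sum_i lmono (c i) 0 *: (iter m dl (eps e i) - eps e (m + i)).
    rewrite -[LHS](subKr (\sum_i lmono (c i) 0 *: iter m dl (eps e i))) -sumrB.
    congr (_ - _); last by apply: eq_bigr => i _; rewrite scalerBr.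
    elim/big_rec2: _ => [|i x y _ ->]; last by rewrite iter_deltaD iter_delta_const.
    by elim: (m) => //= p <-; rewrite deltaE raddf0 scaler0.
  apply: submodB => //; apply: submod_sum => // i _; exact: submod_mono.
have : shift 1 E' (lmono (c i0) 0 *: eps e j).
  move: h2; rewrite (bigD1 i0) //= /m subnK // => h2.
  rewrite -[X in shift _ _ X](addrK (\sum_(i < d.+1 | i != i0) lmono (c i) 0 *: eps e (j - i0 + i))).
  apply: submodB => //; apply: submod_sum => // i ne.
  have [lt|gt|e'] := ltngtP i i0.
  - by rewrite ci0 // lmono0 scale0r.
  - by apply: submod_mono => //; apply: big; lia.
  - by case/eqP: ne; apply: val_inj.
move=> h; have -> : eps e j = lmono (c i0)^-1 0 *: (lmono (c i0) 0 *: eps e j).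
  by rewrite scalerA lmonoM mulVf // addr0 lmono1 scale1r.
by apply: submod_mono.
Qed.

Let E'E : E' `<=` E.
Proof.
have sE := lattice_submod lE; have [E10 E1D E1Z] := shift_submod 1 sE'.
have gE i : (i < d)%N -> E (eps e i).
  by move=> h; exact: (ispan_gen (fun i : 'I_d => eps e i) (Ordinal h)).
have step x : E' x -> exists2 y, E y & shift 1 E' (x - y).
  move=> hx; have [_ //] : E' x /\ exists2 y, E y & shift 1 E' (x - y).
  apply: (@minE' [set x | E' x /\ exists2 y, E y & shift 1 E' (x - y)]) hx.
    have [h0 hD hZ] := sE'; have [g0 gD gZ] := sE.
    split=> [|y z [y1 [y' ? ?]] [z1 [z' ? ?]]|f y hf [y1 [y' ? ?]]].
    - by split=> //; exists 0; rewrite ?subrr.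
    - split; first exact: (hD).
      by exists (y' + z'); [exact: gD|rewrite opprD addrACA; exact: E1D].
    - split; first exact: (hZ).
      by exists (f *: y'); [exact: gZ|rewrite -scalerBr; exact: E1Z].
  move=> i; split; first exact: epsE'.
  have [lt|ge] := ltnP i d; first by exists (eps e i); [exact: gE|rewrite subrr].
  exists 0; first by case: sE.
  rewrite subr0; elim: i ge => [|i IH]; first by rewrite leqn0 => /eqP <-; exact: epsd.
  rewrite leq_eqVlt => /orP[/eqP <-|/IH h]; first exact: epsd.
  have -> : eps e i.+1 = delta (eps e i) - lmono i%:R 1 *: eps e i by rewrite delta_eps addrK.
  apply: submodB; [exact: shift_submod|exact: delta_shift|].
  by apply: submod_mono => //; exact: shift_submod.
move=> x0 hx0.
have /choice[g hg] : forall x, exists yx : M * M, E' x ->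
    [/\ E yx.1, E' yx.2 & x = yx.1 + lunif *: yx.2].
  move=> x; have [hx|?] := pselect (E' x); last by exists (0, 0).
  have [y Ey /shiftP[x' hx' ex]] := step x hx.
  by exists (y, x') => _; split=> //=; rewrite lunifE -ex addrC subrK.
pose xs := fix xs j := if j is j'.+1 then (g (xs j')).2 else x0.
have hxs j : E' (xs j) by elim: j => // j IH /=; have [] := hg _ IH.
have [|z hz ez] := lattice_complete (a := fun j => (g (xs j)).1) lE.
  by move=> j; have [] := hg _ (hxs j).
suff : xs 0%N - z 0%N = 0 by move/eqP; rewrite subr_eq0 => /eqP /= ->.
apply: (sep_chain (z := fun j => xs j - z j) lL) => j.
  by apply: submodB => //; apply: E'L => //; apply: EE'.
have [_ _ ex] := hg _ (hxs j); rewrite [xs j in LHS]ex ez opprD addrACA subrr add0r -scalerBr.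
by [].
Qed.

Lemma eps_dim_unif : shift 1 E (eps e d).
Proof. exact: shift_sub E'E _ epsd. Qed.

End Span.

Lemma submod_gen (b : nat -> M) : exists E' : set M,
  [/\ submod E', forall i, E' (b i) & forall S, submod S -> (forall i, S (b i)) -> E' `<=` S].
Proof.
exists [set x | forall S, submod S -> (forall i, S (b i)) -> S x]; split.
- split=> [S [S0 _ _] _ //|x y hx hy S sS hS|f x hf hx S sS hS].
    by have [_ hD _] := sS; apply: hD; [exact: hx|exact: hy].
  by have [_ _ hZ] := sS; apply: hZ; [|exact: hx].
- by move=> i S _; apply.
- by move=> S sS hS x; apply.
Qed.

Lemma top_nilp_slopes (L : set M) r : is_lattice L -> delta_stable L -> delta_nilp L r ->
  all_slopes_lt1 M.
Proof.
move=> lL dL nL s [e [P [/cyclic_findep he Pm sP eP hs]]].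
have sL := lattice_submod lL; have [a La] := lattice_absorbing lL e.
have [E' [sE' epsE' minE']] := submod_gen (eps e).
have [||||g hg eg] := @eps_dim_unif e (shift (- a%:Z) L) r he _ _ _ _ E' sE' epsE' minE'.
- exact: shift_lattice.
- exact: delta_shift.
- move=> x /(delta_nilp_shift sL dL nL); rewrite shift_shift.
  by rewrite addrC.
- by rewrite /shift /= opprK.
have {}eg : \sum_(i < d) (lmono 1 d%:Z * P`_i + lmono 1 (i%:Z + 1) * g i) *: iter i th e = 0.
  move: eP; rewrite sP big_ord_recr /=; have -> : P`_d = 1.
    by have /monicP := Pm; rewrite /lead_coef sP.
  rewrite scale1r => /eqP; rewrite addrC addr_eq0 => /eqP eP.
  have e2 : lmono 1 d%:Z *: (\sum_(i < d) P`_i *: iter i th e) =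
      - (lmono 1 1 *: \sum_i g i *: eps e i).
    by rewrite -eg scalerA lmono1M subrr lmono1 scale1r /eps eP scalerN opprK.
  under eq_bigr do rewrite scalerDl.
  rewrite big_split /=; apply/eqP; rewrite addrC addr_eq0; apply/eqP.
  have -> : \sum_(i < d) (lmono 1 d%:Z * P`_i) *: iter i th e =
      lmono 1 d%:Z *: \sum_(i < d) P`_i *: iter i th e.
    by rewrite scaler_sumr; apply: eq_bigr => i _; rewrite scalerA.
  rewrite e2 opprK scaler_sumr; apply: eq_bigr => i _.
  by rewrite /eps !scalerA addrC -lmono1M; congr (_ *: _); ring.
apply: (newton_lt1 Pm sP) hs => i n id hn.
have := he _ eg (Ordinal id) => /= /(congr1 (fun f : K => f (n + d%:Z))).
rewrite coefD !lmono_coef !mul1r addrK hg ?addr0 //; lia.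
Qed.

End TopNilp.

Lemma vspace_of_pred (F : fieldType) (vT : vectType F) (P : vT -> Prop) :
  P 0 -> (forall c x y, P x -> P y -> P (c *: x + y)) ->
  exists U : {vspace vT}, forall x, x \in U <-> P x.
Proof.
move=> P0 PL.
pose Q n := `[< exists U : {vspace vT}, \dim U = n /\ forall x, x \in U -> P x >].
have ex : exists n, Q n.
  by exists 0%N; apply/asboolP; exists 0%VS; split=> [|x]; rewrite ?dimv0 // memv0 => /eqP ->.
have bd n : Q n -> (n <= \dim {:vT})%N.
  by move=> /asboolP[U [<- _]]; apply/dimvS/subvf.
have [n /asboolP[U [dU hU]] maxn] := ex_maxnP ex bd.
exists U => x; split; first exact: hU.
move=> Px; apply/negPn/negP => xU.
have : Q (\dim (U + <[x]>)%VS).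
  apply/asboolP; exists (U + <[x]>)%VS; split=> // y /memv_addP[z zU [_ /vlineP[c ->] ->]].
  by rewrite addrC; apply: PL => //; apply: hU.
move=> /maxn; rewrite -dU leqNgt => /negP; apply.
rewrite ltn_neqAle dimvS ?addvSl // andbT; apply: contra xU => /eqP e.
have : (U + <[x]> <= U)%VS.
  by rewrite -(geq_leqif (dimv_leqif_sup (addvSl U <[x]>))) -e.
by rewrite subv_add => /andP[_]; rewrite -memvE.
Qed.

Section Between.
Variables (k : fieldType) (M : connection k).
Implicit Types (V L : set M).

Lemma between_lattice V L1 L2 : submod V -> is_lattice L1 -> is_lattice L2 ->
  L1 `<=` V -> V `<=` L2 -> is_lattice V.
Proof.
move=> sV lL1 lL2 h1 h2; have [V0 VD VZ] := sV.
have [c hc] := lattice_comm lL2 (lattice_submod lL1) (lattice_absorbing lL1).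
move/latticeP: (lL2) => [r [f [ff eL2]]].
pose lam (A : 'M[k]_(r, c)) : M := \sum_i \sum_j lmono (A i j) j%:Z *: f i.
have lamL a A B : lam (a *: A + B) = lmono a 0 *: lam A + lam B.
  rewrite /lam scaler_sumr -big_split; apply: eq_bigr => i _ /=.
  rewrite scaler_sumr -big_split; apply: eq_bigr => j _ /=.
  by rewrite !mxE lmonoD scalerDl scalerA lmonoM add0r.
have lam0 : lam 0 = 0.
  by rewrite /lam big1 // => i _; rewrite big1 // => j _; rewrite mxE lmono0 scale0r.
have [|a A B hA hB|U hU] := @vspace_of_pred k _ (fun A => V (lam A)).
- by rewrite lam0.
- by rewrite lamL; apply: VD => //; apply: submod_mono.
pose g (i : 'I_(r + \dim U)) : M :=
  match split i with inl i => lmono 1 c%:Z *: f i | inr j => lam (vbasis U)`_j end.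
have sl (i : 'I_r) : split (lshift (\dim U) i) = inl i := unsplitK (inl i).
have sr (j : 'I_(\dim U)) : split (rshift r j) = inr j := unsplitK (inr j).
have gl i : ispan g (lmono 1 c%:Z *: f i).
  by have := ispan_gen g (lshift _ i); rewrite /g sl.
have gr (j : 'I_(\dim U)) : ispan g (lam (vbasis U)`_j).
  by have := ispan_gen g (rshift _ j); rewrite /g sr.
have [_ gD gZ] := ispan_submod g.
apply/latticeP; exists (r + \dim U)%N, g; split.
  move=> m; have [a ea] := ff (lmono 1 (- c%:Z) *: m).
  exists (fun i => match split i with inl i => a i | inr _ => 0 end).
  rewrite big_split_ord /= [X in _ + X]big1 ?addr0; last first.
    by move=> i _; rewrite sr scale0r.
  rewrite -[m]scale1r -lmono1 -(subrr c%:Z) -lmono1M -scalerA ea scaler_sumr.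
  by apply: eq_bigr => i _; rewrite /g sl !scalerA mulrC.
apply/seteqP; split; last first.
  apply: ispan_sub => // i; rewrite /g; case: split => [i'|j].
    by apply/h1/hc; rewrite eL2; apply: ispan_gen.
  by apply/hU/vbasis_mem/mem_nth; rewrite size_tuple.
move=> x Vx; have := h2 _ Vx; rewrite eL2 => -[a ha ex].
have /choice[b hb] : forall i, exists b, power_series b /\
    a i = \sum_(j < c) lmono (a i j%:Z) j%:Z + lmono 1 c%:Z * b.
  by move=> i; have [b ? ?] := ps_trunc c (ha i); exists b.
pose A := \matrix_(i < r, j < c) a i j%:Z.
have eA : x = lam A + lmono 1 c%:Z *: \sum_i b i *: f i.
  rewrite ex /lam scaler_sumr -big_split; apply: eq_bigr => i _ /=.
  rewrite {1}(hb i).2 scalerDl scalerA scaler_suml; congr (_ + _).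
  by apply: eq_bigr => j _; rewrite mxE.
have AU : A \in U.
  apply/hU; rewrite -[lam A](addrK (lmono 1 c%:Z *: \sum_i b i *: f i)) -eA.
  apply: submodB => //; apply/h1/hc; rewrite eL2; exists b => // i; exact: (hb i).1.
rewrite eA; apply: (gD).
  rewrite (coord_vbasis AU); elim/big_rec: _ => [|j B _ hB].
    by rewrite lam0; case: (ispan_submod g).
  by rewrite lamL; apply: (gD) => //; apply: gZ => //; exact: ps_mono.
rewrite scaler_sumr; apply: submod_sum => [|i _]; first exact: ispan_submod.
by rewrite scalerA mulrC -scalerA; apply: gZ => //; exact: (hb i).1.
Qed.

End Between.

Section Admissible.
Variables (k : fieldType) (char0 : [pchar k] =i pred0) (M : connection k).
Hypothesis nohor : no_horizontal_sections M.
Local Notation dl := (@delta k M).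

Lemma delta_thetan n m (j : nat) :
  iter j dl (theta_twist n m) = theta_twist (n - j%:Z) (iter j dl m).
Proof.
have e1 i x : delta (theta_twist i x) = theta_twist (i - 1) (delta x).
  by rewrite /delta thetan_unif subrK /theta_twist thetaD theta_const.
elim: j => [|j IH]; first by rewrite subr0.
by rewrite !iterS IH e1; congr theta_twist; lia.
Qed.

Lemma exists_admissible : all_slopes_lt1 M -> exists V, @admissible_inf k M V.
Proof.
move=> hs; have [E [r [lE dE nE]]] := slopes_top_nilp char0 hs.
have [V0 [W0 [pVW h0]]] := exists_onto_pair char0 nohor.
have [lV0 lW0 VW0 tVW0] := pVW; have sV0 := lattice_submod lV0.
pose V : set M := [set v | forall n, V0 (iter n dl v)].
have VV0 : V `<=` V0 by move=> v /(_ 0%N).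
have dV : delta_stable V by move=> v hv n; rewrite -iterSr.
have sV : submod V.
  have [V00 VD VZ] := sV0; split=> [n|x y hx hy n|f x hf hx n].
  - by elim: n => // n; rewrite iterSr deltaE raddf0 scaler0.
  - by rewrite iter_deltaD; apply: VD.
  - elim: n f x hf hx => [|n IH] f x hf hx; first exact/VZ/VV0.
    rewrite iterSr deltaZ scalerA iter_deltaD; apply: VD; apply: IH => //.
      by do 2?[apply: psM; first exact: ps_unif]; exact: ps_deriv.
    exact: dV.
have [c hc] := lattice_comm lE sV0 (lattice_absorbing lV0).
have cE x : shift c%:Z E x -> V x.
  move=> hx n; have /shiftP[y Ey ->] : shift c%:Z E (iter n dl x).
    by apply: iter_delta_stable => //; apply: delta_shift => //; exact: lattice_submod.
  exact: hc.
have lV : is_lattice V := (between_lattice sV (shift_lattice c%:Z lE) lV0 cE VV0).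
pose W : set M := [set w | exists2 v, V v & theta v = w].
have VW : V `<=` W.
  move=> v Vv; have [v' Vv' e] := h0 0 v (VW0 _ (VV0 _ Vv)).
  exists v'; last by rewrite -thetan0.
  move=> n; have [v'' Vv'' e''] := h0 (- n%:Z) _ (VW0 _ (Vv n)).
  suff -> : iter n dl v' = v'' by [].
  apply: (thetan_inj nohor (n := - n%:Z)); rewrite e'' -e delta_thetan.
  by rewrite sub0r.
have [V_0 VD VZ] := sV.
have sW : submod W.
  have D x y : W x -> W y -> W (x + y).
    by move=> [a Va <-] [b Vb <-]; exists (a + b); [exact: VD|rewrite thetaD].
  split=> // [|f x hf [v Vv <-]]; first exact: VW.
  have -> : f *: theta v = theta (f *: v) + (- (lunif * lderiv f)) *: v.
    by rewrite thetaZ scaleNr addrAC subrr add0r.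
  apply: D; first by exists (f *: v) => //; exact: VZ.
  by apply/VW/VZ => //; apply/psN/psM; [exact: ps_unif|exact: ps_deriv].
have lW : is_lattice W.
  by apply: (between_lattice sW lV lW0 VW) => w [v /VV0 Vv <-]; exact: tVW0.
exists V; split; last by move=> v Vv; rewrite -deltaE; exact: dV.
have pVW' : lattice_pair V W by split=> // v Vv; exists v.
exists W; apply/(good_lattice_pairE char0 nohor); split=> //.
apply: (onto_all nohor (n := 0)) => // w [v Vv <-]; exists v => //; exact: thetan0.
Qed.

End Admissible.

Definition mk_linear (R : pzRingType) (U V : lmodType R) (f : U -> V) (h : linear f) :
  {linear U -> V} := HB.pack f (GRing.isLinear.Build R U V *:%R f h).

(** * Laurent series evaluated at an operator *)

Section SeriesMaps.
Variables (k : fieldType) (V W : lmodType k).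
Local Notation K := (laurent k).

Lemma coef_lmap (f : {additive V -> W}) (x : laurent V) n : lmap f x n = f (x n).
Proof. by []. Qed.

Lemma coef_lderiv (Z : zmodType) (x : laurent Z) n : lderiv x n = x (n + 1) *~ (n + 1).
Proof. by []. Qed.

Lemma coef_unif (x : laurent V) n : ((lunif : K) *: x) n = x (n - 1).
Proof. by rewrite lunifE scale_lmono scale1r. Qed.

Lemma coef_scale_closed (S : V -> Prop) (f : K) (x : laurent V) :
  S 0 -> (forall c a b, S a -> S b -> S (c *: a + b)) ->
  (forall n, S (x n)) -> forall n, S ((f *: x) n).
Proof.
move=> S0 SL hx n; have [N hN] := coef_bounded f; have [N' hN'] := coef_bounded x.
rewrite [X in S X](convEr n hN hN'); elim/big_rec: _ => // i y _; exact: SL.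
Qed.

Lemma lmapZ (f : {linear V -> W}) (g : K) (x : laurent V) : lmap f (g *: x) = g *: lmap f x.
Proof.
have [N hN] := coef_bounded g; have [N' hN'] := coef_bounded x.
have hN2 i : i < N' -> lmap f x i = 0 by move=> h; rewrite coef_lmap hN' // raddf0.
apply: laurentP => n; rewrite coef_lmap [(g *: x) n](convEr n hN hN').
rewrite [RHS](convEr n hN hN2) raddf_sum; apply: eq_bigr => i _.
exact: linearZ.
Qed.

Lemma lmapD (f : {additive V -> W}) (x y : laurent V) : lmap f (x + y) = lmap f x + lmap f y.
Proof. by apply: laurentP => n; rewrite coefD !coef_lmap coefD raddfD. Qed.

Lemma lmapB (f : {additive V -> W}) (x y : laurent V) : lmap f (x - y) = lmap f x - lmap f y.
Proof. by apply: laurentP => n; rewrite coefD coefN !coef_lmap coefD coefN raddfB. Qed.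

Fact lconst_bounded (s : V) : exists N : int, forall n : int, n < N -> (if n == 0 then s else 0) = 0.
Proof. by exists 0 => n /lt_eqF ->. Qed.
Definition lconst (s : V) : laurent V := Laurent (lconst_bounded s).

Lemma coef_lconst s n : lconst s n = if n == 0 then s else 0. Proof. by []. Qed.

Lemma lconstD s t : lconst (s + t) = lconst s + lconst t.
Proof. by apply: laurentP => n; rewrite coefD !coef_lconst; case: eqP; rewrite ?addr0. Qed.

Lemma lconstN s : lconst (- s) = - lconst s.
Proof. by apply: laurentP => n; rewrite coefN !coef_lconst; case: eqP; rewrite ?oppr0. Qed.

Lemma scale_lconst (f : K) s n : (f *: lconst s) n = f n *: s.
Proof.
rewrite [LHS](@convE _ _ f (lconst s) n [:: n]) ?big_seq1 ?subrr ?coef_lconst ?eqxx //.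
by move=> i; rewrite inE => ne; rewrite coef_lconst subr_eq0 eq_sym (negPf ne) scaler0.
Qed.

Lemma lderivB (x y : laurent V) : lderiv (x - y) = lderiv x - lderiv y.
Proof. by apply: laurentP => n; rewrite coefD coefN /= mulrzBl. Qed.

Lemma lderiv_lconst s : lderiv (lconst s) = 0.
Proof. by apply: laurentP => n; rewrite coef0 /=; case: eqP => [->|_]; rewrite ?mulr0z ?mul0rz. Qed.

Lemma lderiv_scale_lconst (f : K) s : lderiv (f *: lconst s) = lderiv f *: lconst s.
Proof.
apply: laurentP => n; rewrite coef_lderiv !scale_lconst coef_lderiv.
by rewrite scalerMzl.
Qed.

Lemma lderiv_unif (x : laurent V) : lderiv ((lunif : K) *: x) = x + (lunif : K) *: lderiv x.
Proof.
apply: laurentP => n; rewrite coefD coef_unif !coef_lderiv coef_unif.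
by rewrite addrK subrK mulrzDr mulr1z addrC.
Qed.

End SeriesMaps.

Lemma lderiv_lmap (k : fieldType) (V W : lmodType k) (f : {additive V -> W}) (x : laurent V) :
  lderiv (lmap f x) = lmap f (lderiv x).
Proof. by apply: laurentP => n; rewrite /= raddfMz. Qed.

(* An operator lT, with inverse lS, for which X is a k((z))-vector space of finite
   dimension with z acting as lT, and lU is a k[[z]]-lattice in it. *)
Record lattice_op (k : fieldType) (X : lmodType k) := LatticeOp {
  lT : {linear X -> X};
  lS : X -> X;
  lU : set X;
  lTK : cancel lT lS;
  lSK : cancel lS lT;
  lU0 : lU 0;
  lUL : forall c x y, lU x -> lU y -> lU (c *: x + y);
  lUT : forall x, lU x -> lU (lT x);
  lU_abs : forall x, exists n, lU (iter n lT x);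
  lU_sep : forall x, (forall n, lU (iter n lS x)) -> x = 0;
  lU_complete : forall a : nat -> X, (forall n, lU (a n)) ->
    exists2 y : nat -> X, forall n, lU (y n) & forall n, y n = a n + lT (y n.+1);
  lU_fin : exists n (e : 'I_n -> X), (forall i, lU (e i)) /\
    forall x, lU x -> exists (c : 'I_n -> k) y, lU y /\ x = \sum_i c i *: e i + lT y }.

Section Evaluation.
Variables (k : fieldType) (X : lmodType k) (S : lattice_op X).
Local Notation K := (laurent k).
Local Notation T := (lT S).
Local Notation Si := (lS S).
Local Notation U := (lU S).
Implicit Types (x y : laurent X) (s t : X) (f g : K).

Lemma iter_lT_linear c a s t : iter c T (a *: s + t) = a *: iter c T s + iter c T t.
Proof. by elim: c => //= c ->; rewrite linearP. Qed.
Lemma iter_lT0 c : iter c T 0 = 0.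
Proof. by elim: c => //= c ->; rewrite linear0. Qed.
Lemma iter_lT_inj c s t : iter c T s = iter c T t -> s = t.
Proof. by elim: c => //= c IH /(can_inj (@lTK _ _ S)). Qed.
Lemma iter_lTK c s : iter c T (iter c Si s) = s.
Proof. by elim: c s => //= c IH s; rewrite -iterS iterSr lSK IH. Qed.
Lemma lS_lT_comm c s : iter c T (Si s) = Si (iter c T s).
Proof. by apply: (can_inj (@lTK _ _ S)); rewrite lSK -iterS iterSr lSK. Qed.
Lemma iter_lS_lT_comm c n s : iter c T (iter n Si s) = iter n Si (iter c T s).
Proof. by elim: n => //= n IH; rewrite lS_lT_comm IH. Qed.
Lemma lUD s t : U s -> U t -> U (s + t).
Proof. by move=> hs ht; rewrite -[s]scale1r; apply: lUL. Qed.
Lemma lUZ c s : U s -> U (c *: s).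
Proof. by move=> hs; rewrite -[_ *: _]addr0; apply: lUL => //; apply: lU0. Qed.
Lemma lU_iter c s : U s -> U (iter c T s).
Proof. by move=> hs; elim: c => //= c; apply: lUT. Qed.
Lemma lU_le c d s : (c <= d)%N -> U (iter c T s) -> U (iter d T s).
Proof. by move=> cd hs; rewrite -(subnK cd) iterD; apply: lU_iter. Qed.

(* the series that can be evaluated at z = T *)
Definition bseries x := exists c, forall n, U (iter c T (x n)).

Lemma bseriesL f x y : bseries x -> bseries y -> bseries (f *: x + y).
Proof.
move=> [c hc] [d hd]; exists (maxn c d) => n.
rewrite coefD -[(f *: x) n]scale1r iter_lT_linear scale1r; apply: lUD; last first.
  by apply: lU_le (hd n); apply: leq_maxr.
apply: (@coef_scale_closed _ _ (fun s => U (iter (maxn c d) T s))).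
- by rewrite iter_lT0; apply: lU0.
- by move=> a s t hs ht; rewrite iter_lT_linear; apply: lUL.
- by move=> p; apply: lU_le (hc p); apply: leq_maxl.
Qed.

Lemma bseries0 : bseries 0.
Proof. by exists 0%N => n; apply: lU0. Qed.
Lemma bseriesZ f x : bseries x -> bseries (f *: x).
Proof. by move=> h; rewrite -[_ *: _]addr0; apply: bseriesL => //; apply: bseries0. Qed.
Lemma bseriesD x y : bseries x -> bseries y -> bseries (x + y).
Proof. by move=> h; rewrite -[x]scale1r; apply: bseriesL. Qed.
Lemma bseriesN x : bseries x -> bseries (- x).
Proof. by rewrite -scaleN1r; apply: bseriesZ. Qed.
Lemma bseries_const s : bseries (lconst s).
Proof.
have [c hc] := lU_abs S s; exists c => n; rewrite coef_lconst; case: eqP => // _.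
by rewrite iter_lT0; apply: lU0.
Qed.

(* multiplication by z - T, z being the variable of the series *)
Definition zmT x := (lunif : K) *: x - lmap T x.

Lemma zmTL f x y : zmT (f *: x + y) = f *: zmT x + zmT y.
Proof.
rewrite /zmT scalerDr lmapD lmapZ opprD addrACA scalerBr; congr (_ - _ + _).
by rewrite !scalerA mulrC.
Qed.

(* The two series take the same value at z = T. *)
Definition eqT x x' := exists2 y, bseries y & x - x' = zmT y.

Lemma eqTL f x x' y y' : eqT x x' -> eqT y y' -> eqT (f *: x + y) (f *: x' + y').
Proof.
move=> [a ha ea] [b hb eb]; exists (f *: a + b); first exact: bseriesL.
by rewrite zmTL -ea -eb scalerBr opprD addrACA.
Qed.

Lemma zmT0 : zmT 0 = 0.
Proof. by apply: laurentP => n; rewrite /zmT scaler0 coefD coefN coef_lmap raddf0 subrr. Qed.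

Lemma eqT_refl x : eqT x x.
Proof. by exists 0; [exact: bseries0|rewrite subrr zmT0]. Qed.

Lemma eqT_trans y x z : eqT x y -> eqT y z -> eqT x z.
Proof.
move=> h1 h2; have := eqTL 1 h1 h2; rewrite !scale1r => -[a ha ea].
by exists a; rewrite // -ea opprD addrA addrK.
Qed.

Lemma eqTZ f x y : eqT x y -> eqT (f *: x) (f *: y).
Proof. by move=> h; have := eqTL f h (eqT_refl 0); rewrite !addr0. Qed.
Lemma eqTD x x' y y' : eqT x x' -> eqT y y' -> eqT (x + y) (x' + y').
Proof. by move=> h1 h2; have := eqTL 1 h1 h2; rewrite !scale1r. Qed.
Lemma eqT_sym x y : eqT x y -> eqT y x.
Proof.
move=> h; have := eqTL (-1) h (eqT_refl (x + y)); rewrite !scaleN1r addKr.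
by rewrite [x + y]addrC addKr => /eqT_trans; apply; apply: eqT_refl.
Qed.

Lemma zmT_const s : zmT (lconst s) = lunif *: lconst s - lconst (T s).
Proof.
rewrite /zmT; congr (_ - _); apply: laurentP => n.
by rewrite coef_lmap !coef_lconst; case: eqP; rewrite ?raddf0.
Qed.

Lemma eqT_unif_const s : eqT ((lunif : K) *: lconst s) (lconst (T s)).
Proof. by exists (lconst s); [exact: bseries_const|rewrite zmT_const]. Qed.

Lemma eqT_unifV_const s : eqT (lmono 1 (- 1) *: lconst s) (lconst (Si s)).
Proof.
have := eqTZ (lmono 1 (- 1)) (eqT_unif_const (Si s)); rewrite lSK scalerA lunifE lmono1M addNr.
by rewrite lmono1 scale1r => /eqT_sym.
Qed.

Lemma eqT_const_inj s t : eqT (lconst s) (lconst t) -> s = t.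
Proof.
rewrite /eqT -lconstN -lconstD => -[y [c hc] ey]; apply/eqP; rewrite -subr_eq0; apply/eqP.
set r := s - t in ey *.
have ey' n : n != 0 -> y (n - 1) = T (y n).
  move=> n0; have := congr1 (fun x : laurent X => x n) ey.
  rewrite coef_lconst (negPf n0) /zmT coefD coefN coef_unif coef_lmap => /eqP.
  by rewrite eq_sym subr_eq0 => /eqP.
have [N hN] := coef_bounded y.
have yneg (j : nat) n : n = N - 1 + j%:Z -> n < 0 -> y n = 0.
  elim: j n => [|j IH] n en n0; first by rewrite hN //; lia.
  apply: (can_inj (@lTK _ _ S)); rewrite raddf0 -ey' ?lt_eqF //; apply: IH; lia.
have ym1 : y (- 1) = 0.
  have [h|h] := ltP (- 1) N; first exact: hN.
  by apply: (yneg `|(- N)%R|%N) => //; lia.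
have y0 (n : nat) : iter n Si (y 0) = y n%:Z.
  elim: n => // n IH; rewrite iterS IH; have -> : y n%:Z = T (y n.+1%:Z).
    by rewrite -ey' //; congr (y _); lia.
  by rewrite lTK.
have {}y0 : y 0 = 0.
  apply: (@iter_lT_inj c); rewrite iter_lT0; apply: (lU_sep (l := S)) => n.
  by rewrite -iter_lS_lT_comm y0.
have := congr1 (fun x : laurent X => x 0) ey.
by rewrite coef_lconst eqxx /zmT coefD coefN coef_unif coef_lmap sub0r ym1 y0 raddf0 subrr.
Qed.

Lemma eqT_const x : bseries x -> exists s, eqT x (lconst s).
Proof.
move=> hx; have [N hN] := coef_bounded x.
pose m := `|N|%N; pose x' := lmono 1 m%:Z *: x : laurent X.
have hx' n : n < 0 -> x' n = 0 by move=> n0; rewrite scale_lmono hN ?scaler0 //; lia.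
have [c hc] := bseriesZ (lmono 1 m%:Z) hx.
have [y hy ey] := @lU_complete _ _ S (fun n => iter c T (x' n%:Z)) (fun n => hc n%:Z).
pose y' n := iter c Si (y n).
have ey' n : y' n = x' n%:Z + T (y' n.+1).
  apply: (@iter_lT_inj c); rewrite -[x' _ + _]/(x' n%:Z + T (y' n.+1)) -[x' n%:Z]scale1r.
  by rewrite iter_lT_linear scale1r iter_lTK -iterSr iterS iter_lTK.
pose Y n := if 0 <= n then y' `|n|%N.+1 else 0.
have bY : exists N : int, forall n : int, n < N -> Y n = 0.
  by exists 0 => n n0; rewrite /Y leNgt n0.
have YE n : Laurent bY n = Y n by [].
have ex' : eqT x' (lconst (y' 0%N)).
  exists (Laurent bY).
    exists c => n; rewrite YE /Y; case: ifP => _; last by rewrite iter_lT0; apply: lU0.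
    by rewrite iter_lTK.
  apply: laurentP => n; rewrite /zmT !coefD !coefN coef_unif coef_lmap coef_lconst !YE /Y.
  have [n0|n0|->] := ltgtP n 0.
  - by rewrite hx' // !ifF ?raddf0 //; lia.
  - rewrite subr0 !ifT; try lia.
    have -> : `|(n - 1)%R|%N.+1 = `|n|%N by lia.
    by rewrite ey' gez0_abs ?ltW // addrK.
  - by rewrite [y' 0%N]ey' opprD addrA subrr.
have back (j : nat) s : exists t, eqT (lmono 1 (- j%:Z) *: lconst s) (lconst t).
  elim: j => [|j [t ht]]; first by exists s; rewrite oppr0 lmono1 scale1r; apply: eqT_refl.
  exists (Si t); apply: eqT_trans (eqT_unifV_const t).
  have := eqTZ (lmono 1 (- 1)) ht; rewrite scalerA lmono1M.
  by have -> : -1 - j%:Z = - j.+1%:Z by lia.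
have [t ht] := back m (y' 0%N); exists t; apply: eqT_trans ht.
have := eqTZ (lmono 1 (- m%:Z)) ex'.
by rewrite /x' scalerA lmono1M addNr lmono1 scale1r.
Qed.

Definition eval_op x : X := xget 0 [set s | eqT x (lconst s)].

Lemma evTP x : bseries x -> eqT x (lconst (eval_op x)).
Proof. by move=> /eqT_const h; exact: (xgetPex 0 h). Qed.

Lemma evT_eq x s : eqT x (lconst s) -> eval_op x = s.
Proof.
move=> h; apply: eqT_const_inj; apply: eqT_trans (h); apply: eqT_sym.
exact: (xgetPex 0 (ex_intro (fun s => eqT x (lconst s)) s h)).
Qed.

Lemma evT_congr x y : bseries y -> eqT x y -> eval_op x = eval_op y.
Proof. by move=> hy h; apply: evT_eq; apply: eqT_trans h (evTP hy). Qed.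

Lemma evT_const s : eval_op (lconst s) = s.
Proof. exact/evT_eq/eqT_refl. Qed.

Lemma evT_scale f x : bseries x -> eval_op (f *: x) = eval_op (f *: lconst (eval_op x)).
Proof.
move=> hx; apply: evT_congr; first exact/bseriesZ/bseries_const.
exact/eqTZ/evTP.
Qed.

Lemma evTD x y : bseries x -> bseries y -> eval_op (x + y) = eval_op x + eval_op y.
Proof. by move=> hx hy; apply: evT_eq; rewrite lconstD; apply: eqTD; apply: evTP. Qed.

Lemma evT_unif x : bseries x -> eval_op ((lunif : K) *: x) = T (eval_op x).
Proof. by move=> hx; rewrite evT_scale //; apply/evT_eq/eqT_unif_const. Qed.

Lemma bseries_lmapT x : bseries x -> bseries (lmap T x).
Proof. by move=> [c hc]; exists c => n; rewrite coef_lmap -iterSr iterS; apply: lUT. Qed.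

Lemma eqT_lmapT x : bseries x -> eqT (lmap T x) ((lunif : K) *: x).
Proof. by move=> hx; apply: eqT_sym; exists x. Qed.

Lemma evT_lmapT x : bseries x -> eval_op (lmap T x) = T (eval_op x).
Proof.
by move=> hx; rewrite -evT_unif //; apply: evT_congr (eqT_lmapT hx); apply: bseriesZ.
Qed.

Lemma scale_const_const (c : k) s : lmono c 0 *: lconst s = lconst (c *: s).
Proof.
apply: laurentP => n; rewrite scale_lconst coef_lconst /=.
by case: eqP; rewrite ?scale0r.
Qed.

Lemma zmT_closed y : bseries y -> (forall n, U (zmT y n)) -> forall n, U (y n).
Proof.
move=> [c hc] hx; elim: c hc => [//|c IH] hc; apply: IH => n.
have -> : y n = zmT y (n + 1) + T (y (n + 1)).
  by rewrite /zmT coefD coefN coef_unif coef_lmap addrK subrK.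
rewrite -[zmT _ _]scale1r iter_lT_linear scale1r; apply: lUD; first exact: lU_iter.
by rewrite -iterSr; apply: hc.
Qed.

Lemma evT_zmT y : bseries y -> eval_op (zmT y) = 0.
Proof.
move=> hy; apply: evT_eq; exists y => //.
suff -> : lconst (0 : X) = 0 by rewrite subr0.
by apply: laurentP => n; rewrite coef_lconst; case: eqP.
Qed.

Lemma evT_eq0 x : bseries x -> eval_op x = 0 -> exists2 y, bseries y & x = zmT y.
Proof.
move=> /evTP; case=> y hy ey e0; exists y => //; rewrite -ey e0.
suff -> : lconst (0 : X) = 0 by rewrite subr0.
by apply: laurentP => n; rewrite coef_lconst; case: eqP.
Qed.

Lemma evT_surj s : exists2 x : laurent X, forall n, U (x n) & eval_op x = s.
Proof.
have [c hc] := lU_abs S s; exists (lmono 1 (- c%:Z) *: lconst (iter c T s)).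
  move=> n; rewrite scale_lconst /=; apply: lUZ; exact: hc.
apply: evT_eq; elim: c {hc} => [|c IH]; first by rewrite oppr0 lmono1 scale1r; apply: eqT_refl.
apply: eqT_trans IH; have := eqTZ (lmono 1 (- c.+1%:Z)) (eqT_unif_const (iter c T s)).
rewrite scalerA lunifE lmono1M -iterS; have -> : - c.+1%:Z + 1 = - c%:Z by lia.
exact: eqT_sym.
Qed.

End Evaluation.

Section FinDim.
Variables (F : fieldType) (V : lmodType F).

Lemma spanning_vector_axiom : (exists n (e : 'I_n -> V), forall v, exists a, v = \sum_i a i *: e i) ->
  exists n (f : V -> 'rV[F]_n), linear f /\ bijective f.
Proof.
move=> ex0.
have ex : exists n, `[< exists e : 'I_n -> V, forall v, exists a, v = \sum_i a i *: e i >].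
  by have [n h] := ex0; exists n; apply/asboolP.
have [n /asboolP[e he] minn] := ex_minnP ex.
have ie (a : 'I_n -> F) : \sum_i a i *: e i = 0 -> forall i, a i = 0.
  move=> ea; apply: contrapT => /existsNP[j /eqP aj].
  case: n => [|n] in e he minn a ea j aj *; first by case: j {aj}.
  suff : (n.+1 <= n)%N by rewrite ltnn.
  apply: minn; apply/asboolP; exists (fun i => e (lift j i)) => v.
  have ej : e j = \sum_(i < n) (- (a (lift j i) / a j)) *: e (lift j i).
    apply: (scalerI aj); move/eqP: ea; rewrite (bigD1_ord j) //= addr_eq0 => /eqP ->.
    rewrite scaler_sumr -sumrN; apply: eq_bigr => i' _.
    by rewrite scalerA mulrN mulrCA divff // mulr1 scaleNr.
  have [b ->] := he v; exists (fun i => b j * - (a (lift j i) / a j) + b (lift j i)).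
  rewrite (bigD1_ord j) //= {1}ej scaler_sumr -big_split; apply: eq_bigr => i _ /=.
  by rewrite scalerDl scalerA.
have /choice[c hc] := he.
have cE a : c (\sum_i a i *: e i) = a.
  apply/funext => i; apply/eqP; rewrite -subr_eq0; apply/eqP.
  apply: (ie (fun i => c (\sum_i a i *: e i) i - a i)).
  by under eq_bigr do rewrite scalerBl; rewrite sumrB -hc subrr.
exists n, (fun v => \row_i c v i); split=> [b v w|].
  apply/rowP => i; rewrite !mxE.
  have -> : b *: v + w = \sum_i (b * c v i + c w i) *: e i.
    under eq_bigr do rewrite scalerDl -scalerA.
    by rewrite big_split /= -scaler_sumr -!hc.
  by rewrite cE.
exists (fun r : 'rV_n => \sum_i r 0 i *: e i) => [v|r].
  by rewrite [RHS]hc; apply: eq_bigr => i _; rewrite mxE.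
by apply/rowP => i; rewrite mxE cE.
Qed.

End FinDim.

(* X, with the variable of k((z)) acting as lT S *)
Definition lspace (k : fieldType) (X : lmodType k) (S : lattice_op X) : Type := X.

Section LSpace.
Variables (k : fieldType) (X : lmodType k) (S : lattice_op X).
Local Notation K := (laurent k).
Local Notation T := (lT S).
Local Notation U := (lU S).

Local Notation lspace := (lspace S).
HB.instance Definition _ := GRing.Zmodule.on lspace.
Definition lact (f : K) (s : lspace) : lspace := eval_op S (f *: lconst (s : X)).

Let bs (f : K) (s : X) : bseries S (f *: lconst s) := bseriesZ f (bseries_const S s).

Fact lactA f g s : lact f (lact g s) = lact (f * g) s.
Proof. by rewrite /lact -evT_scale ?scalerA. Qed.
Fact lact1 : left_id 1 lact.
Proof. by move=> s; rewrite /lact scale1r evT_const. Qed.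
Fact lactDr : right_distributive lact +%R.
Proof. by move=> f s t; rewrite /lact lconstD scalerDr evTD. Qed.
Fact lactDl s : {morph lact^~ s : f g / f + g}.
Proof. by move=> f g; rewrite /lact scalerDl evTD. Qed.
HB.instance Definition _ := GRing.Zmodule_isLmodule.Build K lspace
  lactA lact1 lactDr lactDl.

Lemma lspaceE (f : K) (s : lspace) : f *: s = eval_op S (f *: lconst (s : X)).
Proof. by []. Qed.

Lemma lspace_unif (s : lspace) : (lunif : K) *: s = T s.
Proof. by rewrite lspaceE evT_unif ?evT_const //; apply: bseries_const. Qed.

Lemma lspace_const c (s : lspace) : lmono c 0 *: s = (c *: (s : X)).
Proof. by rewrite lspaceE scale_const_const evT_const. Qed.

Lemma evT_linear f x y : bseries S x -> bseries S y ->
  eval_op S (f *: x + y) = f *: (eval_op S x : lspace) + (eval_op S y : lspace).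
Proof. by move=> hx hy; rewrite evTD //; [rewrite 1?evT_scale|exact: bseriesZ]. Qed.

Lemma lspace_unifn (n : nat) (s : lspace) : lmono 1 n%:Z *: s = iter n T (s : X).
Proof.
elim: n => [|n IH]; first by rewrite lmono1 scale1r.
have -> : lmono (1 : k) n.+1%:Z = lunif * lmono 1 n%:Z by rewrite lunifE lmono1M; congr lmono; lia.
by rewrite -scalerA IH lspace_unif.
Qed.

Lemma lU_frame : exists n (e : 'I_n -> lspace), (forall i, U (e i)) /\
  forall x : lspace, U x -> exists2 a : 'I_n -> K, forall i, power_series (a i) & x = \sum_i a i *: e i.
Proof.
have [n [e [he hU]]] := lU_fin S; exists n, e; split=> // x0 Ux0.
have /choice[g hg] : forall x, exists cy : ('I_n -> k) * X, U x ->
    U cy.2 /\ x = \sum_i cy.1 i *: e i + T cy.2.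
  move=> x; have [Ux|?] := pselect (U x); last by exists (fun=> 0, 0).
  by have [c [y [Uy ->]]] := hU x Ux; exists (c, y).
pose xs := fix xs j := if j is j'.+1 then (g (xs j')).2 else x0 : X.
have hxs j : U (xs j) by elim: j => // j IH /=; have [] := hg _ IH.
pose a i (p : int) : k := if 0 <= p then (g (xs `|p|%N)).1 i else 0.
have ba i : exists N : int, forall p : int, p < N -> a i p = 0.
  by exists 0 => p p0; rewrite /a leNgt p0.
exists (fun i => Laurent (ba i)).
  by move=> i p p0 /=; rewrite /a leNgt p0.
pose Y (p : int) : X := if 0 <= p then xs `|p|%N.+1 else 0.
have bY : exists N : int, forall p : int, p < N -> Y p = 0.
  by exists 0 => p p0; rewrite /Y leNgt p0.
have YE p : Laurent bY p = Y p by [].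
have -> : \sum_i (Laurent (ba i) *: (e i : lspace)) =
    eval_op S (\sum_i Laurent (ba i) *: lconst (e i)).
  have: bseries S (\sum_i Laurent (ba i) *: lconst (e i)) /\
    \sum_i (Laurent (ba i) *: (e i : lspace)) =
    eval_op S (\sum_i Laurent (ba i) *: lconst (e i)).
    elim/big_rec2: _ => [|i y1 y2 _ [b1 ->]].
      split; first exact: bseries0.
      rewrite (@evT_eq k X S 0 0) //; have := eqT_refl S (lconst (0 : X)).
      by rewrite -{1}(subrr 0) lconstD lconstN subrr.
    by split; [apply: bseriesD|rewrite evTD].
  by case.
refine (esym (@evT_eq k X S _ x0 _)); exists (Laurent bY).
  by exists 0%N => p; rewrite YE /Y; case: ifP => _; [exact: hxs|exact: lU0].
apply: laurentP => p; rewrite coefD coefN coef_sum /zmT coefD coefN coef_unif coef_lmap !YE coef_lconst.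
have aE i : (Laurent (ba i) *: @lconst k X (e i)) p = a i p *: (e i : X) by rewrite scale_lconst.
under eq_bigr do rewrite aE.
have [_ ex] := hg _ (hxs `|p|%N); rewrite /Y.
have [p0|p0|e0] := ltgtP p 0.
- rewrite big1 => [|i _]; last by rewrite /a leNgt p0 scale0r.
  by rewrite !ifF ?raddf0 ?subr0 //; lia.
- rewrite subr0 !ifT; try lia.
  have -> : `|(p - 1)%R|%N.+1 = `|p|%N by lia.
  by rewrite [in RHS]ex addrK /=; apply: eq_bigr => i _; rewrite /a ltW.
- move: ex; rewrite e0 => ex; rewrite /a.
  by rewrite [X in _ - X]ex sub0r opprD addrA subrr add0r.
Qed.

Lemma lspace_spanning : exists n (e : 'I_n -> lspace), forall v, exists a : 'I_n -> K, v = \sum_i a i *: e i.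
Proof.
have [n [e [_ h]]] := lU_frame; exists n, e => v.
have [c hc] := lU_abs S v; have [a _ ea] := h _ hc.
exists (fun i => lmono 1 (- c%:Z) * a i).
have -> : v = lmono 1 (- c%:Z) *: (iter c T v : lspace).
  by rewrite -lspace_unifn scalerA lmono1M addNr lmono1 scale1r.
by rewrite ea scaler_sumr; apply: eq_bigr => i _; rewrite scalerA.
Qed.

Definition lspace_dim := projT1 (cid (spanning_vector_axiom lspace_spanning)).
Definition lspace_vector : Vector.axiom lspace_dim lspace :=
  let h := cid (projT2 (cid (spanning_vector_axiom lspace_spanning))) in
  exist2 _ _ (projT1 h) (proj1 (projT2 h)) (proj2 (projT2 h)).
HB.instance Definition _ := Lmodule_hasFinDim.Build K lspace lspace_vector.

End LSpace.

(** * Connections with the variable acting as a given operator *)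

(* lT and wD act as z and d_z of a connection. *)
Record weyl_op (k : fieldType) (X : lmodType k) := WeylOp {
  wL :> lattice_op X;
  wD : {linear X -> X};
  wDT : forall s, wD (lT wL s) = lT wL (wD s) + s;
  wD_bounded : exists c, forall s, lU wL s -> lU wL (iter c (lT wL) (wD s)) }.

Section WConn.
Variables (k : fieldType) (X : lmodType k) (w : weyl_op X).
Local Notation K := (laurent k).
Local Notation T := (lT w).
Local Notation U := (lU w).
Local Notation D := (wD w).

Lemma bseries_D x : bseries w x -> bseries w (lmap D x).
Proof.
have [c' hc'] := wD_bounded w; move=> [c hc]; exists (c' + c.+1)%N => n; rewrite coef_lmap.
have DTn p s : iter p.+1 T (D s) = - p%:R *: iter p T s + T (D (iter p T s)).
  elim: p => [|p IH]; first by rewrite oppr0 scale0r add0r.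
  rewrite iterS IH linearP -iterS [X in _ = _ + T (D X)]iterS wDT linearD -iterS.
  rewrite -addn1 natrD opprD scalerDl scaleN1r -!addrA; congr (_ + _).
  by rewrite addrC addrK.
rewrite iterD DTn iter_lT_linear; apply: lUL; first exact: lU_iter.
by rewrite -iterSr iterS; apply/lUT/hc'.
Qed.

Lemma bseries_lderiv x : bseries w x -> bseries w (lderiv x).
Proof.
move=> [c hc]; exists c => n; rewrite coef_lderiv -scaler_int -[_ *: _]addr0.
by rewrite iter_lT_linear iter_lT0; apply: lUL => //; apply: lU0.
Qed.

Lemma evT_deriv x : bseries w x -> eval_op w (lderiv x + lmap D x) = D (eval_op w x).
Proof.
move=> hx; have [y hy ey] := evTP hx; apply: evT_eq.
exists (lderiv y + lmap D y); first by apply: bseriesD; [exact: bseries_lderiv|exact: bseries_D].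
have -> : lconst (D (eval_op w x)) = lderiv (lconst (eval_op w x)) + lmap D (lconst (eval_op w x)).
  rewrite lderiv_lconst add0r; apply: laurentP => n.
  by rewrite coef_lmap !coef_lconst; case: eqP; rewrite ?raddf0.
rewrite opprD addrACA -lderivB -lmapB ey /zmT lderivB lmapB lderiv_unif lderiv_lmap.
rewrite scalerDr !lmapD lmapZ.
have -> : lmap D (lmap T y) = lmap T (lmap D y) + y.
  by apply: laurentP => n; rewrite coefD !coef_lmap; exact: wDT.
rewrite !opprD !addrA [LHS](ACl (1*6*2*4*3*5)) /= subrr add0r.
by [].
Qed.

Definition lnabla (s : lspace w) : lspace w := D s.
Fact lnabla_additive : zmod_morphism lnabla.
Proof. by move=> s t; apply: raddfB. Qed.
HB.instance Definition _ := GRing.isZmodMorphism.Build (lspace w) (lspace w) lnabla lnabla_additive.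

Fact lnabla_leibniz (f : K) (s : lspace w) :
  lnabla (f *: s) = lderiv f *: s + f *: lnabla s.
Proof.
have b (g : K) (t : X) : bseries w (g *: lconst t) by apply: bseriesZ; apply: bseries_const.
suff : D (eval_op w (f *: lconst (s : X))) =
    eval_op w (lderiv f *: lconst (s : X)) + eval_op w (f *: lconst (D s)) by [].
rewrite -evTD // -evT_deriv // lderiv_scale_lconst lmapZ; congr (eval_op _ (_ + _ *: _)).
apply: laurentP => n; rewrite coef_lmap !coef_lconst.
by case: eqP; rewrite ?raddf0.
Qed.

Definition wconn : connection k := @Connection k (lspace w) lnabla lnabla_leibniz.

Lemma nabla_wconn (s : wconn) : nabla wconn s = D s. Proof. by []. Qed.

Lemma wconn_unifn (n : nat) (s : wconn) : lmono 1 n%:Z *: s = iter n T (s : X).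
Proof. exact: lspace_unifn. Qed.

(* A power series acts as an iterated T-expansion, so the completeness of U keeps it inside U. *)
Lemma lU_power_series (f : K) (s : wconn) : power_series f -> U s -> U (f *: s).
Proof.
move=> hf Us; have [y hy ey] := @lU_complete _ _ w (fun n => f n%:Z *: (s : X)) (fun n => lUZ _ Us).
suff -> : f *: s = y 0%N by [].
refine (@evT_eq k X w _ (y 0%N) _).
pose Y (p : int) : X := if 0 <= p then y `|p|%N.+1 else 0.
have bY : exists N : int, forall p : int, p < N -> Y p = 0.
  by exists 0 => p p0; rewrite /Y leNgt p0.
have YE p : Laurent bY p = Y p by [].
exists (Laurent bY).
  by exists 0%N => p; rewrite YE /Y; case: ifP => _; [exact: hy|exact: lU0].
apply: laurentP => p; rewrite /zmT !coefD !coefN coef_unif coef_lmap !YE coef_lconst scale_lconst /Y.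
have [p0|p0|->] := ltgtP p 0.
- by rewrite hf // scale0r !ifF ?raddf0 //; lia.
- rewrite subr0 !ifT; try lia.
  have -> : `|(p - 1)%R|%N.+1 = `|p|%N by lia.
  by rewrite [y `|p|%N]ey gez0_abs ?ltW // addrK.
- by rewrite [y 0%N]ey opprD addrA subrr.
Qed.

Lemma lU_submod : submod (U : set wconn).
Proof.
split=> [|s t|f s]; [exact: lU0|exact: lUD|exact: lU_power_series].
Qed.

Lemma wconn_lattice : is_lattice (U : set wconn).
Proof.
have [n [e [he hU]]] := lU_frame w; apply/latticeP; exists n, e; split; last first.
  apply/seteqP; split=> x; last by apply: ispan_sub => //; exact: lU_submod.
  by move=> /hU[a ha ->]; exists a.
move=> v; have [c hc] := lU_abs w v; have [a _ ea] := hU _ hc.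
exists (fun i => lmono 1 (- c%:Z) * a i).
have -> : v = lmono 1 (- c%:Z) *: (iter c T v : wconn).
  by rewrite -wconn_unifn scalerA lmono1M addNr lmono1 scale1r.
by rewrite ea scaler_sumr; apply: eq_bigr => i _; rewrite scalerA.
Qed.

End WConn.

Section WMor.
Variables (k : fieldType) (X X' : lmodType k) (w : weyl_op X) (w' : weyl_op X').
Variable f : {linear X -> X'}.
Hypothesis fT : forall s, f (lT w s) = lT w' (f s).
Hypothesis fD : forall s, f (wD w s) = wD w' (f s).
Hypothesis f_bounded : exists c, forall s, lU w s -> lU w' (iter c (lT w') (f s)).

Lemma bseries_lmap x : bseries w x -> bseries w' (lmap f x).
Proof.
have fTn c s : f (iter c (lT w) s) = iter c (lT w') (f s).
  by elim: c => //= c IH; rewrite fT IH.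
have [c' hc'] := f_bounded; move=> [c hc]; exists (c' + c)%N => n.
by rewrite coef_lmap iterD -fTn; apply: hc'.
Qed.

Lemma evT_lmap x : bseries w x -> eval_op w' (lmap f x) = f (eval_op w x).
Proof.
move=> hx; have [y hy ey] := evTP hx; apply: evT_eq.
exists (lmap f y); first exact: bseries_lmap.
have -> : lconst (f (eval_op w x)) = lmap f (lconst (eval_op w x)).
  by apply: laurentP => n; rewrite coef_lmap !coef_lconst; case: eqP; rewrite ?raddf0.
rewrite -lmapB ey /zmT lmapB lmapZ; congr (_ - _).
by apply: laurentP => n; rewrite !coef_lmap; exact: fT.
Qed.

Definition wfun (s : wconn w) : wconn w' := f s.
Fact wfun_linear : linear wfun.
Proof.
move=> a s t; rewrite /wfun.
suff : f (eval_op w (a *: lconst (s : X)) + (t : X)) = eval_op w' (a *: lconst (f s)) + f t by [].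
have b : bseries w (a *: lconst (s : X)) by apply: bseriesZ; apply: bseries_const.
rewrite linearD -evT_lmap // lmapZ; congr (eval_op _ (_ *: _) + _).
by apply: laurentP => n; rewrite coef_lmap !coef_lconst; case: eqP; rewrite ?raddf0.
Qed.

Definition wlfun : 'Hom(wconn w, wconn w') := linfun (mk_linear wfun_linear).
Lemma wlfunE s : wlfun s = f s.
Proof. exact: (lfunE (mk_linear wfun_linear) s). Qed.

Fact wmor_subproof (s : wconn w) :
  wlfun (nabla (wconn w) s) = nabla (wconn w') (wlfun s).
Proof. by rewrite !wlfunE; exact: fD. Qed.
Definition wmor : horizontal (wconn w) (wconn w') := Horizontal wmor_subproof.

Lemma wmorE s : wmor s = f s.
Proof. exact: wlfunE. Qed.

End WMor.

Lemma zmod_telescope (R : pzRingType) (A B : lmodType R) (T : {linear A -> B})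
    (y a p : B) (y' p' : A) :
  y - (a + T y') = (y - p) - T (y' - p') - (a + T p' - p).
Proof.
rewrite linearB !opprD !opprK !addrA [RHS](ACl (1*5*3*2*7*4*6)) /=.
by rewrite addrNK addrK.
Qed.

Lemma kspaceE (k : fieldType) (M : connection k) (a : k) (m : kspace M) :
  a *: m = lmono a 0 *: (m : M).
Proof. by []. Qed.

Section MkLstr.
Variables (k : fieldType) (M : connection k) (U : set M).
Variables (T : {linear kspace M -> kspace M}) (S : kspace M -> kspace M) (d c : nat).
Hypotheses (TK : cancel T S) (SK : cancel S T) (lU : is_lattice U).
Hypothesis hT : forall n (x : M), shift n U x -> shift n U (T x).
Hypothesis hTd : forall n (x : M), shift n U x -> shift (n + 1) U (iter d T x).
Hypothesis hS : forall x : M, shift c%:Z U x -> U (S x).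

Let sU : submod U := lattice_submod lU.

Lemma shift_iterT n q (x : M) : shift n U x -> shift (n + q%:Z) U (iter (q * d) T x).
Proof.
elim: q => [|q IH] hx; first by rewrite addr0.
rewrite mulSn iterD; have -> : n + q.+1%:Z = n + q%:Z + 1 by lia.
by apply: hTd; apply: IH.
Qed.

Lemma mk_U0 : U (0 : M). Proof. by case: sU. Qed.
Lemma mk_UL (a : k) (x y : kspace M) : U x -> U y -> U (a *: x + y).
Proof.
move=> Ux Uy; have [_ hD hZ] := sU; apply: hD => //.
by apply: (submod_mono (V := U)).
Qed.
Lemma mk_UT x : U x -> U (T x).
Proof. by move=> Ux; have := @hT 0 x; rewrite shift0; apply. Qed.

Lemma mk_abs (x : kspace M) : exists n, U (iter n T x).
Proof.
have [n hn] := lattice_absorbing lU x; exists (n * d)%N.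
have := @shift_iterT (- n%:Z) n x; rewrite addNr shift0; apply.
by rewrite /shift /= opprK.
Qed.
Lemma mk_sep (x : kspace M) : (forall n, U (iter n S x)) -> x = 0.
Proof.
move=> h; apply: (lattice_sep lU) => n.
have -> : x = iter (n * d) T (iter (n * d) S x).
  by elim: (n * d)%N => // j IH; rewrite iterSr [iter j.+1 S x]iterS SK.
have := @shift_iterT 0 n (iter (n * d) S x); rewrite add0r; apply.
by rewrite shift0.
Qed.

Lemma mk_complete (a : nat -> kspace M) : (forall n, U (a n)) ->
  exists2 y : nat -> kspace M, forall n, U (y n) & forall n, y n = a n + T (y n.+1).
Proof.
move=> ha.
pose ps := fix ps N m := if N is N'.+1 then a m + T (ps N' m.+1) else 0 : kspace M.
have psU N m : U (ps N m).
  elim: N m => [|N IH] m /=; first exact: mk_U0.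
  by have [_ hD _] := sU; apply: hD => //; apply: mk_UT.
have iterT_D j x y : iter j T (x + y) = iter j T x + iter j T y.
  by elim: j => //= j ->; rewrite linearD.
have ps_add N N' m : ps (N + N')%N m = ps N m + iter N T (ps N' (m + N)%N).
  elim: N m => [|N IH] m /=; first by rewrite add0r addn0.
  by rewrite IH linearD addrA addSnnS.
pose b n q : M := lmono 1 (- q%:Z) *: (iter (q * d) T (ps d (n + q * d)%N) : M).
have bU n q : U (b n q).
  by have := @shift_iterT 0 q (ps d (n + q * d)%N); rewrite add0r shift0; apply.
have /choice[y hy] : forall n, exists y : nat -> M,
    (forall q, U (y q)) /\ forall q, y q = b n q + lunif *: y q.+1.
  by move=> n; have [y ? ?] := lattice_complete lU (bU n); exists y.
have approx n q : shift q%:Z U (y n 0%N - ps (q * d)%N n : M).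
  suff -> : (y n 0%N - ps (q * d)%N n : M) = lmono 1 q%:Z *: y n q.
    by apply: shiftE; case: (hy n).
  elim: q => [|q IH]; first by rewrite subr0 lmono1 scale1r.
  rewrite mulSn addnC ps_add opprD addrA IH (hy n).2 /b scalerDr scalerA lmono1M subrr lmono1 scale1r.
  rewrite addrAC subrr add0r scalerA lunifE lmono1M; congr (lmono _ _ *: _); lia.
exists (fun n => y n 0%N) => n; first by case: (hy n).
apply/eqP; rewrite -subr_eq0; apply/eqP; apply: (lattice_sep lU) => q.
rewrite -[U _]/(shift q%:Z U (y n 0%N - (a n + T (y n.+1 0%N)) : M)).
have sS := shift_submod q%:Z sU.
have -> : (y n 0%N - (a n + T (y n.+1 0%N)) : M) =
    (y n 0%N - ps (q * d)%N n) - T (y n.+1 0%N - ps (q * d)%N n.+1) - iter (q * d) T (a (n + q * d)%N).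
  have e : ps (q * d)%N n + iter (q * d) T (a (n + q * d)%N) = a n + T (ps (q * d)%N n.+1).
    by have := ps_add (q * d)%N 1%N n; rewrite addn1 /= linear0 addr0 => <-.
  have -> : iter (q * d) T (a (n + q * d)%N) = a n + T (ps (q * d)%N n.+1) - ps (q * d)%N n.
    by rewrite -e addrC addKr.
  exact: (@zmod_telescope k (kspace M) (kspace M) T (y n 0%N) (a n) (ps (q * d)%N n)
    (y n.+1 0%N) (ps (q * d)%N n.+1)).
apply: (submodB (V := shift q%:Z U)) => //; last first.
  by have := @shift_iterT 0 q (a (n + q * d)%N); rewrite add0r shift0; apply.
by apply: (submodB (V := shift q%:Z U)) => //; apply: hT.
Qed.

Lemma mk_fin : exists n (e : 'I_n -> kspace M), (forall i, U (e i)) /\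
  forall x, U x -> exists (b : 'I_n -> k) y, U y /\ x = \sum_i b i *: e i + T y.
Proof.
have [r [f [_ eU]]] := (latticeP U).1 lU.
pose I : finType := ('I_r * 'I_c)%type.
pose e (p : I) : kspace M := lmono 1 p.2%:Z *: f p.1.
exists #|I|, (fun i => e (enum_val i)); split.
  move=> i; apply: (submod_mono (V := U)) => //; rewrite eU; exact: ispan_gen.
rewrite {1}eU => x [a ha ->].
have /choice[b hb] : forall i, exists b, power_series b /\
    a i = \sum_(j < c) lmono (a i j%:Z) j%:Z + lmono 1 c%:Z * b.
  by move=> i; have [b ? ?] := ps_trunc c (ha i); exists b.
pose z : M := \sum_i b i *: f i.
exists (fun i => a (enum_val i : I).1 (enum_val i : I).2%:Z), (S (lmono 1 c%:Z *: z)); split.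
  by apply: hS; apply: shiftE; rewrite eU; exists b => // i; exact: (hb i).1.
rewrite SK.
have -> : \sum_(i < #|I|) a (enum_val i).1 (enum_val i).2%:Z *: e (enum_val i) =
   \sum_(p : I) a p.1 p.2%:Z *: e p.
  by rewrite -(big_enum_val (fun p : I => a p.1 p.2%:Z *: e p)); apply: eq_bigl.
rewrite -(pair_bigA _ (fun (i : 'I_r) (j : 'I_c) => a i j%:Z *: e (i, j))) /z scaler_sumr -big_split.
apply: eq_bigr => i _; rewrite {1}(hb i).2 scalerDl scalerA scaler_suml; congr (_ + _).
apply: eq_bigr => j _; rewrite /e /=.
by rewrite kspaceE scalerA lmonoM mulr1 add0r.
Qed.

Definition mk_lattice_op : lattice_op (kspace M) :=
  @LatticeOp k (kspace M) T S U TK SK mk_U0 mk_UL mk_UT mk_abs mk_sep mk_complete mk_fin.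

End MkLstr.

Lemma nabla_const (k : fieldType) (M : connection k) c (x : M) :
  nabla M (lmono c 0 *: x) = lmono c 0 *: nabla M x.
Proof. by rewrite leibniz lderiv_mono mulr0z lmono0 scale0r add0r. Qed.

Lemma nablaN (k : fieldType) (M : connection k) (x : M) : nabla M (- x) = - nabla M x.
Proof. exact: raddfN. Qed.
Lemma nablaD (k : fieldType) (M : connection k) (x y : M) :
  nabla M (x + y) = nabla M x + nabla M y.
Proof. exact: raddfD. Qed.

Lemma nabla_unif (k : fieldType) (M : connection k) (x : M) :
  nabla M (lunif *: x) = x + lunif *: nabla M x.
Proof. by rewrite leibniz lunifE lderiv_mono mulr1z subrr lmono1 scale1r. Qed.

Lemma nabla_unifV (k : fieldType) (M : connection k) (x : M) :
  lunif ^+ 2 *: nabla M (lunif^-1 *: x) = lunif *: nabla M x - x.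
Proof.
rewrite leibniz lunifV lderiv_mono mulrN1z lmonoN scaleNr scalerDr scalerN !scalerA lunifX.
rewrite !lmono1M addrC; congr (_ *: _ - _).
by rewrite -[RHS]scale1r -lmono1.
Qed.

(** * The operators defining the two transforms *)

Section FData.
Variables (k : fieldType) (char0 : [pchar k] =i pred0) (M : connection k).
Hypothesis nohor : no_horizontal_sections M.
Local Notation K := (laurent k).

Definition ninv (m : M) : M := projT1 (cid (nabla_surj char0 nohor m)).
Lemma ninvK m : nabla M (ninv m) = m.
Proof. exact: projT2 (cid (nabla_surj char0 nohor m)). Qed.
Lemma nabla_inj (x y : M) : nabla M x = nabla M y -> x = y.
Proof.
by move=> e; apply/eqP; rewrite -subr_eq0; apply/eqP; apply: nohor; rewrite raddfB e subrr.
Qed.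
Lemma nablaK m : ninv (nabla M m) = m.
Proof. by apply: nabla_inj; rewrite ninvK. Qed.

Lemma ninvD x y : ninv (x + y) = ninv x + ninv y.
Proof. by apply: nabla_inj; rewrite nablaD !ninvK. Qed.
Lemma ninvZ c x : ninv (lmono c 0 *: x) = lmono c 0 *: ninv x.
Proof. by apply: nabla_inj; rewrite nabla_const !ninvK. Qed.

Fact FT_linear : linear (fun m : kspace M => - ninv m : kspace M).
Proof. by move=> c x y; rewrite !kspaceE ninvD ninvZ opprD scalerN. Qed.
(* z' acts on F(0,oo)(M) as - nabla^-1, and d_z' as - nabla^2 u. *)
Definition F_var : {linear kspace M -> kspace M} := mk_linear FT_linear.
Lemma F_varE m : F_var m = - ninv m. Proof. by []. Qed.
Definition F_var_inv (m : kspace M) : kspace M := - nabla M m.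
Lemma FTK : cancel F_var F_var_inv.
Proof. by move=> m; rewrite /F_var_inv F_varE nablaN opprK ninvK. Qed.
Lemma FSK : cancel F_var_inv F_var.
Proof. by move=> m; apply: nabla_inj; rewrite F_varE /F_var_inv nablaN ninvK opprK. Qed.

Fact FD_linear : linear (fun m : kspace M => - nabla M (nabla M (lunif *: m)) : kspace M).
Proof.
move=> c x y; rewrite !kspaceE scalerDr scalerA [lunif * _]mulrC -scalerA.
by rewrite !nablaD !nabla_const opprD scalerN.
Qed.
Definition F_der : {linear kspace M -> kspace M} := mk_linear FD_linear.
Lemma F_derE m : F_der m = - nabla M (nabla M (lunif *: m)). Proof. by []. Qed.

Lemma FTTD (s : kspace M) : F_var (F_var (F_der s)) = - ((lunif : K) *: (s : M)).
Proof.
have -> : F_der s = F_var_inv (F_var_inv (- (lunif *: (s : M)))) by rewrite F_derE /F_var_inv !nablaN opprK.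
by rewrite !FSK.
Qed.

Lemma FDT (s : kspace M) : F_der (F_var s) = F_var (F_der s) + s.
Proof.
have -> : F_var (F_der s) = nabla M (lunif *: (s : M)).
  by apply: (can_inj FTK); rewrite FTTD F_varE nablaK.
rewrite F_derE F_varE scalerN !nablaN opprK [nabla M (lunif *: ninv s)]nabla_unif ninvK nablaD ninvK.
exact: addrC.
Qed.

Variables V W : set M.
Hypothesis gVW : good_lattice_pair V W.
Local Notation U := (div_unif W).

Lemma div_unifE : U = shift (- 1) W. Proof. by []. Qed.

Lemma F_lattice : is_lattice U.
Proof. by rewrite div_unifE; apply: shift_lattice; case: gVW. Qed.

Lemma ninv_shift n (x : M) : shift n U x -> shift n V (ninv x).
Proof.
have [pVW h] := (good_lattice_pairE char0 nohor V W).1 gVW.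
rewrite div_unifE shift_shift => /shiftP[w Ww ->].
have [v Vv <-] := h n w Ww; suff -> : ninv (lmono 1 (n - 1) *: theta_twist n v) = lmono 1 n *: v.
  exact: shiftE.
apply: nabla_inj; rewrite ninvK; apply: (scalerI (lunif_neq0 k)).
by rewrite -/(theta _) theta_shift lunifE scalerA lmono1M addrC subrK.
Qed.

Lemma FT_shift n (x : M) : shift n U x -> shift (n + 1) U (F_var x).
Proof.
have [lV lW VW _ _] := gVW.
move=> /ninv_shift hx; rewrite div_unifE shift_shift addrK; apply: (shift_sub VW).
by apply: submodN hx; apply: shift_submod; apply: lattice_submod.
Qed.

Lemma FS_V (v : M) : V v -> U (F_var_inv v).
Proof.
have [lV lW VW tVW _] := gVW; move=> Vv; rewrite /F_var_inv; apply: submodN.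
  exact: lattice_submod F_lattice.
exact: tVW.
Qed.

Lemma FT_V (x : M) : U x -> V (F_var x).
Proof.
have [lV _ _ _ _] := gVW; move=> Ux; apply: (submodN (V := V)); first exact: lattice_submod.
by have := @ninv_shift 0 x; rewrite !shift0; apply.
Qed.

Lemma V_comm : exists c : nat, forall x, U x -> V (lmono 1 c%:Z *: x).
Proof.
have [lV _ _ _ _] := gVW; apply: lattice_comm; [exact: F_lattice|exact: lattice_submod|].
exact: lattice_absorbing.
Qed.

Lemma FT_shift_le n (x : M) : shift n U x -> shift n U (F_var x).
Proof.
move=> /FT_shift; apply: shift_le; first exact: lattice_submod F_lattice.
by rewrite lerDl.
Qed.

Lemma FS_shift (x : M) : shift (projT1 (cid V_comm))%:Z U x -> U (F_var_inv x).
Proof. by case: (cid V_comm) => c hc /= /shiftP[y Uy ->]; apply/FS_V/hc. Qed.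

Definition F_lattice_op : lattice_op (kspace M) :=
  mk_lattice_op FTK FSK F_lattice FT_shift_le (d := 1) FT_shift FS_shift.

Lemma F_D_bounded : exists c, forall s, U s -> U (iter c F_var (F_der s)).
Proof.
exists 2%N => s Us; rewrite [iter _ _ _]FTTD; have sU := lattice_submod F_lattice.
by apply: (submodN (V := U)) => //; apply: (submod_mono (V := U)).
Qed.

Definition F_weyl_op : weyl_op (kspace M) :=
  @WeylOp k (kspace M) F_lattice_op F_der FDT F_D_bounded.

End FData.

Section GData.
Variables (k : fieldType) (char0 : [pchar k] =i pred0) (N : connection k).
Hypotheses (nohor : no_horizontal_sections N) (slopes : all_slopes_lt1 N).
Local Notation K := (laurent k).

Fact GT_linear : linear (fun m : kspace N => delta (m : N) : kspace N).
Proof. by move=> c x y; rewrite !kspaceE deltaD delta_const. Qed.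
(* t' acts on F(oo,0)(N) as z^2 d_z, and d_t' as 1/z. *)
Definition G_var : {linear kspace N -> kspace N} := mk_linear GT_linear.
Lemma G_varE m : G_var m = delta (m : N). Proof. by []. Qed.
Definition G_var_inv (m : kspace N) : kspace N := ninv char0 nohor ((lunif ^+ 2)^-1 *: (m : N)).
Lemma lunif2_neq0 : (lunif : K) ^+ 2 != 0.
Proof. by rewrite expf_neq0 ?lunif_neq0. Qed.
Lemma GTK : cancel G_var G_var_inv.
Proof. by move=> m; rewrite /G_var_inv G_varE deltaE scalerA mulVf ?lunif2_neq0 // scale1r nablaK. Qed.
Lemma GSK : cancel G_var_inv G_var.
Proof. by move=> m; rewrite /G_var_inv G_varE deltaE ninvK scalerA divff ?lunif2_neq0 // scale1r. Qed.

Fact GD_linear : linear (fun m : kspace N => (lunif : K)^-1 *: (m : N) : kspace N).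
Proof. by move=> c x y; rewrite !kspaceE scalerDr !scalerA mulrC. Qed.
Definition G_der : {linear kspace N -> kspace N} := mk_linear GD_linear.
Lemma G_derE m : G_der m = (lunif : K)^-1 *: (m : N). Proof. by []. Qed.

Lemma GDT (s : kspace N) : G_der (G_var s) = G_var (G_der s) + s.
Proof.
rewrite !G_derE !G_varE !deltaE nabla_unifV subrK scalerA expr2 mulrA mulVf ?lunif_neq0 //.
by rewrite mul1r.
Qed.

Variable V : set N.
Hypothesis aV : admissible_inf V.

Lemma G_lattice : is_lattice V.
Proof. by have [[W []]] := aV. Qed.

Lemma G_delta_stable : delta_stable V.
Proof. by move=> x Vx; rewrite deltaE; case: aV => _; apply. Qed.

Lemma G_delta_nilp : exists d, delta_nilp V d.
Proof.
have [E [r [lE dE nE]]] := slopes_top_nilp char0 slopes.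
have [a ha] := lattice_comm G_lattice (lattice_submod lE) (lattice_absorbing lE).
have [b hb] := lattice_comm lE (lattice_submod G_lattice) (lattice_absorbing G_lattice).
exists ((a + b + 1) * r)%N => x Vx.
have : shift (- a%:Z) E x by rewrite /shift /= opprK; apply: ha.
move=> /(delta_nilp_iter (a + b + 1) (lattice_submod lE) dE nE).
have -> : - a%:Z + (a + b + 1)%N%:Z = 1 + b%:Z by lia.
rewrite -shift_shift; apply: shift_sub => y /shiftP[z Ez ->]; exact: hb.
Qed.

Lemma GS_V (x : N) : shift 1 V x -> V (G_var_inv x).
Proof.
have [[W gVW] _] := aV; have [lV lW VW _ _] := gVW.
have [pVW h] := (good_lattice_pairE char0 nohor V W).1 gVW.
move=> /shiftP[y /VW Wy ->]; have [v Vv ev] := h 0 y Wy.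
suff -> : lmono 1 1 *: y = G_var v by rewrite GTK.
by rewrite -ev thetan0.
Qed.

Lemma GT_shift n (x : N) : shift n V x -> shift n V (G_var x).
Proof. by apply: delta_shift; [exact: lattice_submod G_lattice|exact: G_delta_stable]. Qed.

Lemma GT_nilp_shift n (x : N) :
  shift n V x -> shift (n + 1) V (iter (projT1 (cid G_delta_nilp)) G_var x).
Proof.
case: (cid G_delta_nilp) => d hd /=; apply: delta_nilp_shift => //.
  exact: lattice_submod G_lattice.
exact: G_delta_stable.
Qed.

Definition G_lattice_op : lattice_op (kspace N) :=
  mk_lattice_op GTK GSK G_lattice GT_shift GT_nilp_shift (c := 1) GS_V.

Lemma G_shift (n : nat) : exists d, forall x : N, shift (- n%:Z) V x -> V (iter d G_var x).
Proof.
have [d hd] := G_delta_nilp; have sV := lattice_submod G_lattice; exists (n * d)%N => x hx.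
by have := delta_nilp_iter n sV G_delta_stable hd hx; rewrite addNr shift0.
Qed.

Lemma G_D_bounded : exists c, forall s, V s -> V (iter c G_var (G_der s)).
Proof.
have [d hd] := G_shift 1; exists d => s Vs; apply: hd.
by rewrite G_derE lunifV; apply: shiftE.
Qed.

Definition G_weyl_op : weyl_op (kspace N) :=
  @WeylOp k (kspace N) G_lattice_op G_der GDT G_D_bounded.

End GData.

Section Horizontal.
Variables (k : fieldType) (M M' : connection k) (f : horizontal M M').

Fact hklinear_subproof : linear (fun m : kspace M => f (m : M) : kspace M').
Proof. by move=> c x y; rewrite !kspaceE linearP. Qed.
Definition hklinear : {linear kspace M -> kspace M'} := mk_linear hklinear_subproof.
Lemma hklinearE m : hklinear m = f (m : M). Proof. by []. Qed.

Lemma hfunN (m : M) : f (- m) = - f m. Proof. exact: linearN. Qed.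

Lemma hfunZ (a : laurent k) (m : M) : f (a *: m) = a *: f m. Proof. exact: linearZ. Qed.

Lemma hom_bounded (U : set M) (U' : set M') : is_lattice U -> is_lattice U' ->
  exists n : nat, forall x, U x -> shift (- n%:Z) U' (f x).
Proof.
move=> /latticeP[r [e [_ ->]]] lU'; have sU' := lattice_submod lU'.
have [n hn] := absorb_fin (fun i => f (e i)) sU' (lattice_absorbing lU').
exists n => x [a ha ->]; rewrite linear_sum; apply: submod_sum => [|i _].
  exact: shift_submod.
rewrite linearZ /=; have [_ _ hZ] := shift_submod (- n%:Z) sU'; apply: hZ => //.
by rewrite /shift /= opprK.
Qed.

Lemma series_map_hklinear x : series_map f x = lmap hklinear x.
Proof. by apply: laurentP. Qed.

End Horizontal.

Lemma series_map_id (k : fieldType) (M : connection k) (x : laurent (kspace M)) :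
  series_map (hid M) x = x.
Proof. by apply: laurentP => n; rewrite /= id_lfunE. Qed.

Lemma hcompE (k : fieldType) (M N P : connection k) (g : horizontal N P) (f : horizontal M N) m :
  hcomp g f m = g (f m).
Proof. exact: comp_lfunE. Qed.

Lemma coker_unique (K : fieldType) (X : lmodType K) (N1 N2 : vectType K) (A B : set X)
  (phi : X -> X) (p1 : X -> N1) (p2 : X -> N2) :
  (forall c x y, B x -> B y -> B (c *: x + y)) ->
  is_coker A B phi p1 -> is_coker A B phi p2 ->
  exists psi : 'Hom(N1, N2), forall x, B x -> psi (p1 x) = p2 x.
Proof.
move=> hB [l1 s1 k1] [l2 s2 k2].
have same x y : B x -> B y -> p1 x = p1 y -> p2 x = p2 y.
  move=> Bx By e; have Bd : B (-1 *: y + x) by apply: hB.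
  have : p1 (-1 *: y + x) = 0 by rewrite l1 // e scaleN1r addNr.
  by move=> /(k1 _ Bd)/(k2 _ Bd); rewrite l2 // scaleN1r addrC => /eqP; rewrite subr_eq0 => /eqP.
have /choice[s hs] : forall n, exists x, B x /\ p1 x = n.
  by move=> n; have [x ? ?] := s1 n; exists x.
have lin : linear (fun n => p2 (s n)).
  move=> c x y; rewrite -l2; [|exact: (hs x).1|exact: (hs y).1].
  apply: same; [exact: (hs _).1|apply: hB; [exact: (hs x).1|exact: (hs y).1]|].
  by rewrite l1; [rewrite !(hs _).2|exact: (hs x).1|exact: (hs y).1].
exists (linfun (mk_linear lin)) => x Bx.
rewrite (lfunE (mk_linear lin)) /=; apply: same => //; [exact: (hs _).1|exact: (hs _).2].
Qed.

(** * The transform F(0,oo) *)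

Section CanonicalF.
Variables (k : fieldType) (char0 : [pchar k] =i pred0).
Local Notation K := (laurent k).
Local Notation Fw h g := (F_weyl_op char0 h g).

Section MorF.
Variables (M M' : connection k) (h : no_horizontal_sections M) (h' : no_horizontal_sections M').
Variables (V W : set M) (g : good_lattice_pair V W).
Variables (V' W' : set M') (g' : good_lattice_pair V' W').
Variable f : horizontal M M'.

Lemma F_mor_T s : hklinear f (F_var char0 h s) = F_var char0 h' (hklinear f s).
Proof.
by apply: (nabla_inj h'); rewrite !hklinearE !F_varE hfunN !nablaN -hfunP !ninvK.
Qed.

Lemma F_mor_D s : hklinear f (F_der M s) = F_der M' (hklinear f s).
Proof. by rewrite !hklinearE !F_derE hfunN !hfunP hfunZ. Qed.

Lemma F_mor_bounded : exists c, forall s, lU (Fw h g) s ->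
  lU (Fw h' g') (iter c (lT (Fw h' g')) (hklinear f s)).
Proof.
have [n hn] := hom_bounded f (F_lattice g) (F_lattice g'); exists n => s /hn.
rewrite [lT _]/(F_var char0 h') [lU _]/(div_unif W') => hs.
have sh j x : shift (- j%:Z) (div_unif W') x -> div_unif W' (iter j (F_var char0 h') x).
  elim: j x => [|j IH] x; first by rewrite oppr0 shift0.
  move=> /(FT_shift char0 h' g'); have -> : - j.+1%:Z + 1 = - j%:Z by lia.
  by rewrite iterSr; apply: IH.
exact: sh.
Qed.

Lemma F_bseries_lmap x : bseries (Fw h g) x -> bseries (Fw h' g') (lmap (hklinear f) x).
Proof. exact: (@bseries_lmap k _ _ (Fw h g) (Fw h' g') (hklinear f) F_mor_T F_mor_bounded). Qed.

Lemma F_evT_lmap x : bseries (Fw h g) x ->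
  eval_op (Fw h' g') (lmap (hklinear f) x) = hklinear f (eval_op (Fw h g) x).
Proof. exact: (@evT_lmap k _ _ (Fw h g) (Fw h' g') (hklinear f) F_mor_T F_mor_bounded). Qed.

Definition F_wmor : horizontal (wconn (Fw h g)) (wconn (Fw h' g')) :=
  @wmor k _ _ (Fw h g) (Fw h' g') (hklinear f) F_mor_T F_mor_D F_mor_bounded.
End MorF.

Definition goodF (M : nohor_cat k) :
  {VW : set (sval M) * set (sval M) | good_lattice_pair VW.1 VW.2}.
Proof.
apply: cid; have [V [W h]] := exists_onto_pair char0 (svalP M).
by exists (V, W); apply/(good_lattice_pairE char0 (svalP M)).
Qed.

Definition Fw0 (M : nohor_cat k) : weyl_op (kspace (sval M)) := Fw (svalP M) (svalP (goodF M)).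

Definition Fob (M : nohor_cat k) : conn_cat k := wconn (Fw0 M).
Definition Fmor (M M' : nohor_cat k) (f : mor M M') : mor (Fob M) (Fob M') :=
  F_wmor (svalP M) (svalP M') (svalP (goodF M)) (svalP (goodF M')) f.

Lemma FmorE (M M' : nohor_cat k) (f : mor M M') s :
  (Fmor f : horizontal (wconn (Fw0 M)) (wconn (Fw0 M'))) s = (f : horizontal (sval M) (sval M')) s.
Proof. exact: wmorE. Qed.

Lemma Fmor1 (M : nohor_cat k) : Fmor (idm M) = idm (Fob M).
Proof. by apply: horizontal_eq => m; rewrite FmorE /= !id_lfunE. Qed.

Lemma FmorM (M N P : nohor_cat k) (g : mor N P) (f : mor M N) :
  Fmor (comp g f) = comp (Fmor g) (Fmor f).
Proof.
apply: horizontal_eq => m; rewrite FmorE.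
have -> : (comp (Fmor g) (Fmor f) : horizontal (wconn (Fw0 M)) (wconn (Fw0 P))) m =
    (Fmor g : horizontal (wconn (Fw0 N)) (wconn (Fw0 P)))
    ((Fmor f : horizontal (wconn (Fw0 M)) (wconn (Fw0 N))) m).
  by exact: (@hcompE k (wconn (Fw0 M)) (wconn (Fw0 N)) (wconn (Fw0 P)) (Fmor g) (Fmor f) m).
by rewrite !FmorE; exact: (@hcompE k (sval M) (sval N) (sval P) g f m).
Qed.

Definition Fcan : functor (nohor_cat k) (conn_cat k) := Functor Fmor1 FmorM.

Definition Fproj (M : nohor_cat k) (V W : set (sval M)) (x : laurent (kspace (sval M))) :
  wconn (Fw0 M) := eval_op (Fw0 M) x.

Section SpecF.
Variables (M : nohor_cat k) (V W : set (sval M)) (g : good_lattice_pair V W).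
Local Notation w := (Fw (svalP M) g).
Local Notation U := (div_unif W).

Lemma bseries_F x : series_in U x -> bseries w x.
Proof. by move=> hx; exists 0%N. Qed.

Lemma bseries_Fw0 x : bseries w x -> bseries (Fw0 M) x.
Proof.
move=> hx; rewrite -(series_map_id x) series_map_hklinear.
exact: (F_bseries_lmap (svalP M) (svalP (goodF M)) (hid (sval M)) hx).
Qed.

Lemma evT_Fw0 x : bseries w x -> eval_op (Fw0 M) x = eval_op w x.
Proof.
move=> hx; rewrite -{1}(series_map_id x) series_map_hklinear.
rewrite (F_evT_lmap (svalP M) (svalP (goodF M)) (hid (sval M)) hx).
exact: id_lfunE.
Qed.

Lemma phi_0_infE a : phi_0_inf a = zmT w (lmap (nabla (sval M)) a).
Proof.
apply: laurentP => n; rewrite /phi_0_inf /zmT !coefD coefN; congr (_ + _).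
suff : a n = - - ninv char0 (svalP M) (nabla (sval M) (a n)) by [].
by rewrite opprK nablaK.
Qed.

Lemma F_is_coker : is_coker (series_in V) (series_in U) (@phi_0_inf k (sval M)) (@Fproj M V W).
Proof.
split=> [c x y hx hy|s|x hx].
- rewrite /Fproj; have bx := bseries_Fw0 (bseries_F hx); have by_ := bseries_Fw0 (bseries_F hy).
  exact: (@evT_linear k _ (Fw0 M) c x y bx by_).
- have [x hx ex] := evT_surj w s; exists x => //; rewrite /Fproj evT_Fw0 //.
  exact: bseries_F.
have bx := bseries_F hx; rewrite /Fproj (evT_Fw0 bx); split.
  move=> /(evT_eq0 bx)[y hy ey].
  have Uy n : U (y n) by apply: (zmT_closed hy) => p; rewrite -ey; apply: hx.
  exists (lmap (F_var char0 (svalP M)) (- y)).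
    move=> n; rewrite coef_lmap; apply: (FT_V char0 (svalP M) g).
    by apply: (submodN (V := U)) => //; exact: lattice_submod (F_lattice g).
  rewrite phi_0_infE ey; congr (zmT _ _); apply: laurentP => n.
  suff : y n = nabla (sval M) (- ninv char0 (svalP M) (- y n)) by [].
  by rewrite nablaN ninvK opprK.
move=> [a Va ->]; rewrite phi_0_infE evT_zmT //; exists 0%N => n.
rewrite coef_lmap -[nabla _ _]opprK; apply: (submodN (V := U)).
  exact: lattice_submod (F_lattice g).
exact: (FS_V g).
Qed.

Lemma F_conn x : series_in U x ->
  lunif ^+ 2 *: nabla (wconn (Fw0 M)) (Fproj V W x) = Fproj V W (conn_0_inf x).
Proof.
move=> hx; have bx := bseries_Fw0 (bseries_F hx); have bD := bseries_D bx.
have bl := bseries_lderiv bx; have bT := bseries_lmapT bD; have bTT := bseries_lmapT bT.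
have -> : conn_0_inf x = (lunif ^+ 2 : K) *: lderiv x + lmap (lT (Fw0 M)) (lmap (lT (Fw0 M)) (lmap (wD (Fw0 M)) x)).
  congr (_ + _); apply: laurentP => n; rewrite coefN !coef_lmap.
  exact/esym/(FTTD char0 (svalP M)).
have eD : (wD (Fw0 M) (eval_op (Fw0 M) x) : lspace (Fw0 M)) =
    (eval_op (Fw0 M) (lderiv x) : lspace (Fw0 M)) + (eval_op (Fw0 M) (lmap (wD (Fw0 M)) x) : lspace (Fw0 M)).
  by rewrite -evT_deriv // evTD.
have eR : (eval_op (Fw0 M) ((lunif ^+ 2 : K) *: lderiv x + lmap (lT (Fw0 M)) (lmap (lT (Fw0 M)) (lmap (wD (Fw0 M)) x)))
    : lspace (Fw0 M)) = (lunif ^+ 2 : K) *: (eval_op (Fw0 M) (lderiv x) : lspace (Fw0 M)) +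
    (lT (Fw0 M) (lT (Fw0 M) (eval_op (Fw0 M) (lmap (wD (Fw0 M)) x))) : lspace (Fw0 M)).
  by rewrite evT_linear // !evT_lmapT.
apply: etrans (esym eR); rewrite [nabla _ _]eD scalerDr; congr (_ + _).
by rewrite expr2 -scalerA !lspace_unif.
Qed.

Lemma series_in_F_conn x : series_in U x -> series_in U (conn_0_inf x).
Proof.
move=> hx n; have sU := lattice_submod (F_lattice g).
apply: (submodB (V := U)) => //; last exact: submod_mono.
rewrite lunifX scale_lmono scale1r coef_lderiv -scaler_int.
exact: (submod_mono (V := U)).
Qed.

End SpecF.

Theorem Fcan_spec : is_local_fourier_0_inf Fcan.
Proof.
exists Fproj; split=> [M V W g|M M' f V W V' W' g g' _ _ x hx].
  by split; [exact: F_is_coker|move=> x; exact: F_conn].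
have b1 : bseries (Fw (svalP M) g) x := bseries_F g hx; have bx := bseries_Fw0 b1.
rewrite /Fproj series_map_hklinear.
have := F_evT_lmap (svalP M') (svalP (goodF M')) f bx.
by move=> ->; exact: FmorE.
Qed.

Lemma good_shift (M : connection k) (h : no_horizontal_sections M) (V W : set M) (n : int) :
  good_lattice_pair V W -> good_lattice_pair (shift n V) (shift n W).
Proof.
move=> /(good_lattice_pairE char0 h)[[lV lW VW tVW] ho]; apply/(good_lattice_pairE char0 h).
have sW := lattice_submod lW.
have pV : lattice_pair (shift n V) (shift n W).
  split; [exact: shift_lattice|exact: shift_lattice|exact: shift_sub|].
  move=> v /shiftP[y Vy ->]; rewrite theta_shift; apply: shiftE.
  exact: (@lattice_pair_thetan k M V W n y (And4 lV lW VW tVW) Vy).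
split=> // p w /shiftP[y Wy ->]; have [v Vv ev] := ho (p + n) y Wy.
exists (lmono 1 n *: v); first exact: shiftE.
rewrite /theta_twist theta_shift scalerA mulrC -scalerA -scalerDr -ev /theta_twist; congr (_ *: _).
by rewrite -addrA -scalerDl -lmonoD -intrD [n + p]addrC.
Qed.

End CanonicalF.

Lemma series_in_linear (k : fieldType) (M : connection k) (U : set M) : submod U ->
  forall (c : laurent k) (x y : laurent (kspace M)),
  series_in U x -> series_in U y -> series_in U (c *: x + y).
Proof.
move=> [U0 UD UZ] c x y hx hy n; rewrite coefD; apply: (UD) => //.
apply: (coef_scale_closed (S := fun m : kspace M => U m)) => // a s t Us Ut.
by apply: UD => //; apply: UZ => //; apply: ps_mono.
Qed.

Section UniqueF.
Variables (k : fieldType) (char0 : [pchar k] =i pred0).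

Definition model_0_inf (F : functor (nohor_cat k) (conn_cat k))
    (p : forall (M : nohor_cat k) (V W : set (sval M)),
      laurent (kspace (sval M)) -> (F M : connection k)) :=
    (forall (M : nohor_cat k) (V W : set (sval M)), good_lattice_pair V W ->
       is_coker (series_in V) (series_in (div_unif W)) (@phi_0_inf k (sval M)) (p M V W)
       /\ forall x, series_in (div_unif W) x ->
            lunif ^+ 2 *: nabla (F M) (p M V W x) = p M V W (conn_0_inf x))
    /\ forall (M M' : nohor_cat k) (f : horizontal (sval M) (sval M'))
         (V W : set (sval M)) (V' W' : set (sval M')),
         good_lattice_pair V W -> good_lattice_pair V' W' ->
         (forall v, V v -> V' (f v)) -> (forall w, W w -> W' (f w)) ->
         forall x, series_in (div_unif W) x ->
           (fmor F (f : mor M M') : horizontal (F M) (F M')) (p M V W x) =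
           p M' V' W' (series_map f x).

Lemma compare_0_inf F1 p1 F2 p2 : @model_0_inf F1 p1 -> @model_0_inf F2 p2 ->
  forall (M : nohor_cat k) (V W : set (sval M)), good_lattice_pair V W ->
  exists eta : horizontal (F1 M) (F2 M),
    forall x, series_in (div_unif W) x -> eta (p1 M V W x) = p2 M V W x.
Proof.
move=> [h1 _] [h2 _] M V W g; have [c1 n1] := h1 M V W g; have [c2 n2] := h2 M V W g.
have sU := lattice_submod (F_lattice g).
have [psi hpsi] := coker_unique (series_in_linear sU) c1 c2.
have hor (m : (F1 M : connection k)) : psi (nabla (F1 M : connection k) m) = nabla (F2 M : connection k) (psi m).
  have [_ s1 _] := c1; have [x hx <-] := s1 m.
  have hc := series_in_F_conn g hx.
  apply: (scalerI (lunif2_neq0 k)); rewrite -linearZ /= (n1 x hx).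
  by rewrite (hpsi _ hc) (hpsi _ hx) (n2 x hx).
by exists (Horizontal hor).
Qed.

(* A horizontal map need not respect two given good pairs, but it does after shrinking the first one. *)
Lemma shrink_0_inf (M M' : nohor_cat k) (f : horizontal (sval M) (sval M'))
  (V W : set (sval M)) (V' W' : set (sval M')) :
  good_lattice_pair V W -> good_lattice_pair V' W' ->
  exists n : nat, (forall v, shift n%:Z V v -> V' (f v)) /\ forall w, shift n%:Z W w -> W' (f w).
Proof.
move=> [lV lW _ _ _] [lV' lW' _ _ _].
have [a ha] := hom_bounded f lV lV'; have [b hb] := hom_bounded f lW lW'.
have aux (L : set (sval M)) (L' : set (sval M')) (c n : nat) : is_lattice L -> is_lattice L' ->
    (forall x, L x -> shift (- c%:Z) L' (f x)) -> (c <= n)%N ->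
    forall v, shift n%:Z L v -> L' (f v).
  move=> lL lL' h cn v /shiftP[x /h Lx ->]; rewrite hfunZ -(shift0 L').
  apply: (@shift_le _ _ _ (n%:Z - c%:Z)); [exact: lattice_submod|lia|].
  rewrite -shift_shift; exact: shiftE.
exists (maxn a b); split; apply: aux; try eassumption; [exact: leq_maxl|exact: leq_maxr].
Qed.

Lemma model_0_inf_sub F p : @model_0_inf F p -> forall (M : nohor_cat k) (V W V' W' : set (sval M)),
  good_lattice_pair V W -> good_lattice_pair V' W' -> V `<=` V' -> W `<=` W' ->
  forall x, series_in (div_unif W) x -> p M V W x = p M V' W' x.
Proof.
move=> [_ h] M V W V' W' g g' VV' WW' x hx.
have := h M M (hid (sval M)) V W V' W' g g' _ _ x hx; rewrite series_map_id => <-.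
- have -> : fmor F (hid (sval M) : mor M M) = idm (F M) by exact: (fmor1 F M).
  by rewrite /= id_lfunE.
- by move=> v Vv; rewrite id_lfunE; apply: VV'.
- by move=> v Vv; rewrite id_lfunE; apply: WW'.
Qed.

Theorem unique_0_inf F1 F2 : @is_local_fourier_0_inf k F1 -> @is_local_fourier_0_inf k F2 ->
  nat_iso F1 F2.
Proof.
move=> [p1 m1] [p2 m2]; pose G (M : nohor_cat k) := svalP (goodF char0 M).
pose Vs (M : nohor_cat k) := (sval (goodF char0 M)).1.
pose Ws (M : nohor_cat k) := (sval (goodF char0 M)).2.
have e1 M := cid (compare_0_inf m1 m2 (G M)); have e2 M := cid (compare_0_inf m2 m1 (G M)).
exists (fun M => projT1 (e1 M)), (fun M => projT1 (e2 M)); split=> [M M' f|M|M].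
- have [n [hV hW]] := shrink_0_inf f (G M) (G M').
  have g1 := good_shift char0 (svalP M) n%:Z (G M).
  have lW : is_lattice (Ws M) by case: (G M).
  have lV : is_lattice (Vs M) by case: (G M).
  have sub (L : set (sval M)) : is_lattice L -> shift n%:Z L `<=` L.
    move=> lL; rewrite -[X in _ `<=` X]shift0 => x; apply: shift_le => //; exact: lattice_submod.
  apply: horizontal_eq => y.
  have [[_ s1 _] _] := m1.1 M _ _ g1; have [x hx <-] := s1 y.
  have hx' : series_in (div_unif (Ws M)) x.
    by move=> i; apply: (sub _ lW); exact: hx.
  rewrite [LHS]comp_lfunE [RHS]comp_lfunE.
  rewrite (m1.2 M M' f _ _ _ _ g1 (G M') hV hW x hx).
  rewrite (model_0_inf_sub m1 g1 (G M) (sub _ lV) (sub _ lW) hx).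
  rewrite (projT2 (e1 M) x hx') -(model_0_inf_sub m2 g1 (G M) (sub _ lV) (sub _ lW) hx).
  rewrite (m2.2 M M' f _ _ _ _ g1 (G M') hV hW x hx).
  apply: (projT2 (e1 M')) => i; rewrite /div_unif /= -hfunZ; apply: hW; exact: hx.
- apply: horizontal_eq => y; rewrite [LHS]comp_lfunE [RHS]id_lfunE.
  have [[_ s1 _] _] := m1.1 M _ _ (G M); have [x hx <-] := s1 y.
  by rewrite (projT2 (e1 M) x hx) (projT2 (e2 M) x hx).
- apply: horizontal_eq => y; rewrite [LHS]comp_lfunE [RHS]id_lfunE.
  have [[_ s2 _] _] := m2.1 M _ _ (G M); have [x hx <-] := s2 y.
  by rewrite (projT2 (e2 M) x hx) (projT2 (e1 M) x hx).
Qed.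

End UniqueF.

(** * The transform F(oo,0) *)

Section CanonicalG.
Variables (k : fieldType) (char0 : [pchar k] =i pred0).
Local Notation Gw h s a := (G_weyl_op char0 h s a).

Section MorG.
Variables (M M' : connection k) (h : no_horizontal_sections M) (h' : no_horizontal_sections M').
Variables (s : all_slopes_lt1 M) (s' : all_slopes_lt1 M').
Variables (V : set M) (a : admissible_inf V) (V' : set M') (a' : admissible_inf V').
Variable f : horizontal M M'.

Lemma G_mor_T m : hklinear f (G_var M m) = G_var M' (hklinear f m).
Proof. by rewrite !hklinearE !G_varE !deltaE hfunZ hfunP. Qed.

Lemma G_mor_D m : hklinear f (G_der M m) = G_der M' (hklinear f m).
Proof. by rewrite !hklinearE !G_derE hfunZ. Qed.

Lemma G_mor_bounded : exists c, forall m, lU (Gw h s a) m ->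
  lU (Gw h' s' a') (iter c (lT (Gw h' s' a')) (hklinear f m)).
Proof.
have [n hn] := hom_bounded f (G_lattice a) (G_lattice a').
by have [d hd] := G_shift char0 s' a' n; exists d => m /hn; apply: hd.
Qed.

Lemma G_bseries_lmap x : bseries (Gw h s a) x -> bseries (Gw h' s' a') (lmap (hklinear f) x).
Proof. exact: (@bseries_lmap k _ _ (Gw h s a) (Gw h' s' a') (hklinear f) G_mor_T G_mor_bounded). Qed.

Lemma G_evT_lmap x : bseries (Gw h s a) x ->
  eval_op (Gw h' s' a') (lmap (hklinear f) x) = hklinear f (eval_op (Gw h s a) x).
Proof. exact: (@evT_lmap k _ _ (Gw h s a) (Gw h' s' a') (hklinear f) G_mor_T G_mor_bounded). Qed.

Definition G_wmor : horizontal (wconn (Gw h s a)) (wconn (Gw h' s' a')) :=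
  @wmor k _ _ (Gw h s a) (Gw h' s' a') (hklinear f) G_mor_T G_mor_D G_mor_bounded.
End MorG.

Definition goodG (N : nohor_lt1_cat k) : {V : set (sval N) | admissible_inf V} :=
  cid (exists_admissible char0 (proj1 (svalP N)) (proj2 (svalP N))).

Definition Gw0 (N : nohor_lt1_cat k) : weyl_op (kspace (sval N)) :=
  Gw (proj1 (svalP N)) (proj2 (svalP N)) (svalP (goodG N)).

Definition Gob (N : nohor_lt1_cat k) : conn_cat k := wconn (Gw0 N).
Definition Gmor (N N' : nohor_lt1_cat k) (f : mor N N') : mor (Gob N) (Gob N') :=
  G_wmor (proj1 (svalP N)) (proj1 (svalP N')) (proj2 (svalP N)) (proj2 (svalP N'))
    (svalP (goodG N)) (svalP (goodG N')) f.

Lemma GmorE (N N' : nohor_lt1_cat k) (f : mor N N') s :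
  (Gmor f : horizontal (wconn (Gw0 N)) (wconn (Gw0 N'))) s = (f : horizontal (sval N) (sval N')) s.
Proof. exact: wmorE. Qed.

Lemma Gmor1 (N : nohor_lt1_cat k) : Gmor (idm N) = idm (Gob N).
Proof. by apply: horizontal_eq => m; rewrite GmorE /= !id_lfunE. Qed.

Lemma GmorM (M N P : nohor_lt1_cat k) (g : mor N P) (f : mor M N) :
  Gmor (comp g f) = comp (Gmor g) (Gmor f).
Proof.
apply: horizontal_eq => m; rewrite GmorE.
have -> : (comp (Gmor g) (Gmor f) : horizontal (wconn (Gw0 M)) (wconn (Gw0 P))) m =
    (Gmor g : horizontal (wconn (Gw0 N)) (wconn (Gw0 P)))
    ((Gmor f : horizontal (wconn (Gw0 M)) (wconn (Gw0 N))) m).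
  by exact: (@hcompE k (wconn (Gw0 M)) (wconn (Gw0 N)) (wconn (Gw0 P)) (Gmor g) (Gmor f) m).
by rewrite !GmorE; exact: (@hcompE k (sval M) (sval N) (sval P) g f m).
Qed.

Definition Gcan : functor (nohor_lt1_cat k) (conn_cat k) := Functor Gmor1 GmorM.

Definition Gproj (N : nohor_lt1_cat k) (V : set (sval N)) (x : laurent (kspace (sval N))) :
  wconn (Gw0 N) := eval_op (Gw0 N) x.

Section SpecG.
Variables (N : nohor_lt1_cat k) (V : set (sval N)) (a : admissible_inf V).
Local Notation w := (Gw (proj1 (svalP N)) (proj2 (svalP N)) a).

Lemma bseries_G x : series_in V x -> bseries w x.
Proof. by move=> hx; exists 0%N. Qed.

Lemma bseries_G_div x : series_in (div_unif V) x -> bseries w x.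
Proof.
have [d hd] := G_shift char0 (proj2 (svalP N)) a 1.
by move=> hx; exists d => n; apply: hd; rewrite /shift /= opprK; exact: hx.
Qed.

Lemma bseries_Gw0 x : bseries w x -> bseries (Gw0 N) x.
Proof.
move=> hx; rewrite -(series_map_id x) series_map_hklinear.
exact: (G_bseries_lmap (proj1 (svalP N)) (proj2 (svalP N)) (svalP (goodG N)) (hid (sval N)) hx).
Qed.

Lemma evT_Gw0 x : bseries w x -> eval_op (Gw0 N) x = eval_op w x.
Proof.
move=> hx; rewrite -{1}(series_map_id x) series_map_hklinear.
rewrite (G_evT_lmap (proj1 (svalP N)) (proj2 (svalP N)) (svalP (goodG N)) (hid (sval N)) hx).
exact: id_lfunE.
Qed.

Lemma phi_inf_0E b : phi_inf_0 b = zmT w b.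
Proof.
apply: laurentP => n; rewrite /phi_inf_0 /zmT [RHS]coefD [LHS]coefD addrC; congr (_ + _).
rewrite !coefN; congr (- _).
suff : lunif ^+ 2 *: nabla (sval N) (b n) = delta (b n : sval N) by [].
by rewrite deltaE.
Qed.

Lemma G_is_coker : is_coker (series_in V) (series_in V) (@phi_inf_0 k (sval N)) (@Gproj N V).
Proof.
split=> [c x y hx hy|s|x hx].
- rewrite /Gproj; have bx := bseries_Gw0 (bseries_G hx); have by_ := bseries_Gw0 (bseries_G hy).
  exact: (@evT_linear k _ (Gw0 N) c x y bx by_).
- have [x hx ex] := evT_surj w s; exists x => //; rewrite /Gproj evT_Gw0 //.
  exact: bseries_G.
have bx := bseries_G hx; rewrite /Gproj (evT_Gw0 bx); split.
  move=> /(evT_eq0 bx)[y hy ey]; exists y; last by rewrite phi_inf_0E.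
  by apply: (zmT_closed hy) => p; rewrite -ey; apply: hx.
by move=> [b Vb ->]; rewrite phi_inf_0E evT_zmT //; apply: bseries_G.
Qed.

(* Since T^d (1/u V) is contained in V, x = z^-d T^d x + (z - T)(-z^-1 x - ...) moves 1/u V((z)) into V((z)). *)
Lemma G_div_reduce x : series_in (div_unif V) x ->
  exists x' y, [/\ series_in V x', series_in (div_unif V) y & x' = x + phi_inf_0 y].
Proof.
move=> hx; have lV := G_lattice a; have sV := lattice_submod lV.
have dV := G_delta_stable a; have sU : submod (div_unif V) := shift_submod (- 1) sV.
have dU : delta_stable (div_unif V) := delta_shift (n := - 1) sV dV.
have [d hd] := G_shift char0 (proj2 (svalP N)) a 1.
have UV m : div_unif V m -> V (iter d (G_var (sval N)) m).
  by move=> hm; apply: hd; rewrite /shift /= opprK.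
suff [y hy ey] : exists2 y, series_in (div_unif V) y &
    forall n, (x + phi_inf_0 y) n = iter d (G_var (sval N)) (x (n + d%:Z)).
  by exists (x + phi_inf_0 y), y; split=> // n; rewrite ey; apply: UV; apply: hx.
elim: (d) => [|e [y hy ey]].
  exists 0 => [n|n]; first by case: sU.
  by rewrite phi_inf_0E zmT0 addr0 /= addr0.
exists (y - lmono 1 (- 1) *: (x + phi_inf_0 y)) => n.
  rewrite coefD coefN scale_lmono scale1r ey; apply: (submodB (V := div_unif V)) => //.
  exact: (@iter_delta_stable k (sval N) (div_unif V) e _ dU (hx _)).
rewrite phi_inf_0E.
set v := x + phi_inf_0 y.
have -> : zmT w (y - lmono 1 (- 1) *: v) = zmT w y - (v - lmap (lT w) (lmono 1 (- 1) *: v)).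
  rewrite addrC -scaleN1r zmTL scaleN1r addrC {2}/zmT; congr (_ - (_ - _)).
  by rewrite scalerA lunifE lmono1M subrr lmono1 scale1r.
rewrite -phi_inf_0E addrA opprB addrCA subrr addr0.
rewrite coef_lmap scale_lmono scale1r ey iterS; congr (G_var _ (iter _ _ (x _))); lia.
Qed.

Lemma G_conn x : series_in V x ->
  exists x' y, [/\ series_in V x', series_in (div_unif V) y,
    x' = conn_inf_0 x + phi_inf_0 y &
    nabla (wconn (Gw0 N)) (Gproj V x) = Gproj V x'].
Proof.
move=> hx; have lV := G_lattice a; have sV := lattice_submod lV.
have sU : submod (div_unif V) := shift_submod (- 1) sV.
have VU m : V m -> div_unif V m by move=> Vm; apply: (submod_mono (V := V)).
have hc : series_in (div_unif V) (conn_inf_0 x).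
  move=> n; have [_ hD _] := sU; rewrite coefD; apply: hD.
    by apply: VU; rewrite coef_lderiv -scaler_int; apply: (submod_mono (V := V)).
  by rewrite /div_unif /= scalerA divff ?scale1r ?lunif_neq0 //; apply: hx.
have [x' [y [hx' hy ex']]] := G_div_reduce hc; exists x', y; split=> //.
have bx := bseries_Gw0 (bseries_G hx); have by_ := bseries_G_div hy; have bc := bseries_G_div hc.
rewrite /Gproj ex' evTD; [|exact: bseries_Gw0|]; last first.
  by apply: bseries_Gw0; rewrite phi_inf_0E; apply: bseriesD; [apply: bseriesZ|apply/bseriesN/bseries_lmapT].
rewrite [X in _ + X]evT_Gw0; last first.
  by rewrite phi_inf_0E; apply: bseriesD; [apply: bseriesZ|apply/bseriesN/bseries_lmapT].
rewrite phi_inf_0E evT_zmT // addr0.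
have -> : conn_inf_0 x = lderiv x + lmap (wD (Gw0 N)) x by apply: laurentP.
exact: (esym (evT_deriv bx)).
Qed.

Lemma G_zmT_closed y : series_in (div_unif V) y -> series_in V (phi_inf_0 y) -> series_in V y.
Proof. by move=> /bseries_G_div by_; rewrite phi_inf_0E; apply: (zmT_closed by_). Qed.

End SpecG.

Theorem Gcan_spec : is_local_fourier_inf_0 Gcan.
Proof.
exists Gproj; split=> [N V a|N N' f V V' a a' _ x hx].
  by split; [exact: G_is_coker|move=> x; exact: G_conn].
have bx := bseries_Gw0 (bseries_G a hx).
rewrite /Gproj series_map_hklinear.
have := G_evT_lmap (proj1 (svalP N')) (proj2 (svalP N')) (svalP (goodG N')) f bx.
by move=> ->; exact: GmorE.
Qed.

Lemma admissible_shift (N : connection k) (h : no_horizontal_sections N) (V : set N) (n : int) :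
  admissible_inf V -> admissible_inf (shift n V).
Proof.
move=> a; have [[W g] _] := a; split; first by exists (shift n W); exact: good_shift.
move=> v hv; rewrite -deltaE; apply: delta_shift hv; first exact: lattice_submod (G_lattice a).
exact: G_delta_stable.
Qed.

Definition model_inf_0 (G : functor (nohor_lt1_cat k) (conn_cat k))
    (p : forall (N : nohor_lt1_cat k) (V : set (sval N)),
      laurent (kspace (sval N)) -> (G N : connection k)) :=
    (forall (N : nohor_lt1_cat k) (V : set (sval N)), admissible_inf V ->
       is_coker (series_in V) (series_in V) (@phi_inf_0 k (sval N)) (p N V)
       /\ forall x, series_in V x ->
            exists x' y, [/\ series_in V x', series_in (div_unif V) y,
              x' = conn_inf_0 x + phi_inf_0 y & nabla (G N) (p N V x) = p N V x'])
    /\ forall (N N' : nohor_lt1_cat k) (f : horizontal (sval N) (sval N'))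
         (V : set (sval N)) (V' : set (sval N')),
         admissible_inf V -> admissible_inf V' ->
         (forall v, V v -> V' (f v)) ->
         forall x, series_in V x ->
           (fmor G (f : mor N N') : horizontal (G N) (G N')) (p N V x) =
           p N' V' (series_map f x).

Lemma compare_inf_0 G1 p1 G2 p2 : @model_inf_0 G1 p1 -> @model_inf_0 G2 p2 ->
  forall (N : nohor_lt1_cat k) (V : set (sval N)), admissible_inf V ->
  exists eta : horizontal (G1 N) (G2 N),
    forall x, series_in V x -> eta (p1 N V x) = p2 N V x.
Proof.
move=> [h1 _] [h2 _] N V a; have [c1 n1] := h1 N V a; have [c2 n2] := h2 N V a.
have sV := lattice_submod (G_lattice a); have lV := series_in_linear sV.
have [psi hpsi] := coker_unique lV c1 c2.
have hor (m : (G1 N : connection k)) : psi (nabla (G1 N : connection k) m) = nabla (G2 N : connection k) (psi m).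
  have [_ s1 _] := c1; have [x hx <-] := s1 m.
  have [x1 [y1 [hx1 hy1 e1 ->]]] := n1 x hx; rewrite hpsi // hpsi //.
  have [x2 [y2 [hx2 hy2 e2 ->]]] := n2 x hx.
  have ed : -1 *: x2 + x1 = phi_inf_0 (-1 *: y2 + y1).
    by rewrite !(phi_inf_0E a) zmTL -!(phi_inf_0E a) e1 e2 !scaleN1r opprD addrACA addNr add0r.
  have Ad : series_in V (-1 *: x2 + x1) by apply: lV.
  have Ay : series_in V (-1 *: y2 + y1).
    apply: (G_zmT_closed a); last by rewrite -ed.
    by apply: series_in_linear => //; exact: (shift_submod (- 1) sV).
  have [l2 _ k2] := c2; have : p2 N V (-1 *: x2 + x1) = 0 by apply/(k2 _ Ad); exists (-1 *: y2 + y1).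
  by rewrite l2 // scaleN1r addrC => /eqP; rewrite subr_eq0 => /eqP.
by exists (Horizontal hor).
Qed.

Lemma shrink_inf_0 (N N' : nohor_lt1_cat k) (f : horizontal (sval N) (sval N'))
  (V : set (sval N)) (V' : set (sval N')) :
  admissible_inf V -> admissible_inf V' -> exists n : nat, forall v, shift n%:Z V v -> V' (f v).
Proof.
move=> /G_lattice lV /G_lattice lV'; have [n hn] := hom_bounded f lV lV'.
exists n => v /shiftP[x /hn Lx ->]; rewrite hfunZ -(shift0 V') -(subrr n%:Z).
rewrite -shift_shift; exact: shiftE.
Qed.

Lemma model_inf_0_sub G p : @model_inf_0 G p -> forall (N : nohor_lt1_cat k) (V V' : set (sval N)),
  admissible_inf V -> admissible_inf V' -> V `<=` V' ->
  forall x, series_in V x -> p N V x = p N V' x.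
Proof.
move=> [_ h] N V V' a a' VV' x hx.
have := h N N (hid (sval N)) V V' a a' _ x hx; rewrite series_map_id => <-.
- have -> : fmor G (hid (sval N) : mor N N) = idm (G N) by exact: (fmor1 G N).
  by rewrite /= id_lfunE.
- by move=> v Vv; rewrite id_lfunE; apply: VV'.
Qed.

Theorem unique_inf_0 G1 G2 : @is_local_fourier_inf_0 k G1 -> @is_local_fourier_inf_0 k G2 ->
  nat_iso G1 G2.
Proof.
move=> [p1 m1] [p2 m2]; pose A (N : nohor_lt1_cat k) := svalP (goodG N).
pose Vs (N : nohor_lt1_cat k) := sval (goodG N).
have e1 N := cid (compare_inf_0 m1 m2 (A N)); have e2 N := cid (compare_inf_0 m2 m1 (A N)).
exists (fun N => projT1 (e1 N)), (fun N => projT1 (e2 N)); split=> [N N' f|N|N].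
- have [n hV] := shrink_inf_0 f (A N) (A N').
  have a1 := admissible_shift (proj1 (svalP N)) n%:Z (A N).
  have lV : is_lattice (Vs N) := G_lattice (A N).
  have sub : shift n%:Z (Vs N) `<=` Vs N.
    rewrite -[X in _ `<=` X]shift0 => x; apply: shift_le => //; exact: lattice_submod.
  apply: horizontal_eq => y.
  have [[_ s1 _] _] := m1.1 N _ a1; have [x hx <-] := s1 y.
  have hx' : series_in (Vs N) x by move=> i; apply: sub; exact: hx.
  rewrite [LHS]comp_lfunE [RHS]comp_lfunE.
  rewrite (m1.2 N N' f _ _ a1 (A N') hV x hx).
  rewrite (model_inf_0_sub m1 a1 (A N) sub hx).
  rewrite (projT2 (e1 N) x hx') -(model_inf_0_sub m2 a1 (A N) sub hx).
  rewrite (m2.2 N N' f _ _ a1 (A N') hV x hx).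
  by apply: (projT2 (e1 N')) => i; apply: hV; exact: hx.
- apply: horizontal_eq => y; rewrite [LHS]comp_lfunE [RHS]id_lfunE.
  have [[_ s1 _] _] := m1.1 N _ (A N); have [x hx <-] := s1 y.
  by rewrite (projT2 (e1 N) x hx) (projT2 (e2 N) x hx).
- apply: horizontal_eq => y; rewrite [LHS]comp_lfunE [RHS]id_lfunE.
  have [[_ s2 _] _] := m2.1 N _ (A N); have [x hx <-] := s2 y.
  by rewrite (projT2 (e2 N) x hx) (projT2 (e1 N) x hx).
Qed.

End CanonicalG.

(** * The composites of the two transforms *)

Section NatIso.
Variables C D E : category.

Lemma nat_iso_refl (F : functor C D) : nat_iso F F.
Proof.
exists (fun x => idm (F x)), (fun x => idm (F x)).
by split=> [x y f|x|x]; rewrite ?comp1m ?compm1.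
Qed.

Lemma nat_iso_sym (F G : functor C D) : nat_iso F G -> nat_iso G F.
Proof.
move=> [eta [eps [h1 h2 h3]]]; exists eps, eta; split=> // x y f.
rewrite -[LHS]compm1 -(h3 x) compA -[comp (comp (eps y) _) _]compA -h1.
by rewrite compA h2 comp1m.
Qed.

Lemma nat_iso_trans (G F H : functor C D) : nat_iso F G -> nat_iso G H -> nat_iso F H.
Proof.
move=> [e [e' [h1 h2 h3]]] [d [d' [k1 k2 k3]]].
exists (fun x => comp (d x) (e x)), (fun x => comp (e' x) (d' x)); split=> [x y f|x|x].
- by rewrite -compA h1 compA k1 compA.
- by rewrite compA -[comp (comp _ (d' x)) _]compA k2 compm1 h2.
- by rewrite compA -[comp (comp _ (e x)) _]compA h3 compm1 k3.
Qed.

Lemma nat_iso_comp (F F' : functor C D) (G G' : functor D E) :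
  nat_iso F F' -> nat_iso G G' -> nat_iso (comp_functor G F) (comp_functor G' F').
Proof.
move=> [e [e' [h1 h2 h3]]] [d [d' [k1 k2 k3]]].
exists (fun x => comp (d (F' x)) (fmor G (e x))), (fun x => comp (fmor G (e' x)) (d' (F' x))).
split=> [x y f|x|x] /=.
- by rewrite -compA -fmorM h1 fmorM compA k1 compA.
- by rewrite compA -[comp (comp _ (d' _)) _]compA k2 compm1 -fmorM h2 fmor1.
- by rewrite compA -[comp (comp _ (fmor G (e x))) _]compA -fmorM h3 fmor1 compm1 k3.
Qed.

Lemma nat_iso_corestrict (P : D -> Prop) (F G : functor C D) (hF : forall x, P (F x))
  (hG : forall x, P (G x)) : nat_iso F G -> nat_iso (corestrict hF) (corestrict hG).
Proof. by move=> [e [e' [h1 h2 h3]]]; exists e, e'; split. Qed.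

End NatIso.

Section Transport.
Variables (k : fieldType) (A B : connection k).

Definition mk_horizontal (phi : A -> B) (lin : linear phi)
  (hor : forall m, phi (nabla A m) = nabla B (phi m)) : horizontal A B.
Proof.
refine (@Horizontal k A B (linfun (mk_linear lin)) _) => m.
by rewrite !(lfunE (mk_linear lin)); apply: hor.
Defined.

Lemma mk_horizontalE phi lin hor m : @mk_horizontal phi lin hor m = phi m.
Proof. exact: (lfunE (mk_linear lin) m). Qed.

Variables (f : horizontal A B) (g : horizontal B A).
Hypotheses (fg : forall m, f (g m) = m) (gf : forall m, g (f m) = m).

Lemma no_hor_iso : no_horizontal_sections B -> no_horizontal_sections A.
Proof.
move=> h m /(congr1 f); rewrite hfunP linear0 => /h /(congr1 g).
by rewrite gf linear0.
Qed.

Lemma iter_theta_hor i m : f (iter i (@theta k A) m) = iter i (@theta k B) (f m).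
Proof. by elim: i => //= i IH; rewrite {1}/theta hfunZ hfunP IH. Qed.

Lemma dim_iso : \dim {:A} = \dim {:B}.
Proof.
have le (A' B' : connection k) (f' : horizontal A' B') (g' : horizontal B' A') :
    (forall m, g' (f' m) = m) -> (\dim {:A'} <= \dim {:B'})%N.
  move=> h; have k0 : lker f' == 0%VS.
    by apply/lker0P => x y e; rewrite -(h x) e h.
  rewrite -(limg_dim_eq (f := f')); first exact/dimvS/subvf.
  by rewrite (eqP k0) capv0.
by apply/eqP; rewrite eqn_leq (le _ _ f g) // (le _ _ g f).
Qed.

Lemma slopes_iso : all_slopes_lt1 B -> all_slopes_lt1 A.
Proof.
move=> h s [e [P [/cyclic_findep ce Pm sP eP ns]]]; apply: h; exists (f e), P; split=> //.
- apply/cyclic_findep; rewrite -dim_iso => a ea; apply: ce.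
  rewrite -[LHS]gf linear_sum -[RHS](linear0 g) -[in RHS]ea; congr (g _).
  by apply: eq_bigr => i _; rewrite linearZ /= iter_theta_hor.
- by rewrite -dim_iso.
- rewrite -[RHS](linear0 f) -eP linear_sum; apply: eq_bigr => i _.
  by rewrite linearZ /= iter_theta_hor.
Qed.

End Transport.

(* Mapping a lattice into a lattice makes phi continuous for the u-adic topology. *)
Lemma bounded_linear (k : fieldType) (A B : connection k) (phi : A -> B) (L1 : set A) (L2 : set B) :
  (forall x y, phi (x + y) = phi x + phi y) ->
  (forall c x, phi (lmono c 0 *: x) = lmono c 0 *: phi x) ->
  (forall x, phi (lunif *: x) = lunif *: phi x) ->
  is_lattice L1 -> is_lattice L2 -> (forall x, L1 x -> L2 (phi x)) -> linear phi.
Proof.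
move=> phiD phiC phiu lL1 lL2 h12 f x y; rewrite phiD; congr (_ + _) => {y}.
have phi0 : phi 0 = 0.
  by have := phiD 0 0; rewrite addr0 => /eqP; rewrite -subr_eq subrr => /eqP.
have phin (n : nat) z : phi (lmono 1 n%:Z *: z) = lmono 1 n%:Z *: phi z.
  elim: n z => [|n IH] z; first by rewrite !lmono1 !scale1r.
  have -> : lmono (1 : k) n.+1%:Z = lunif * lmono 1 n%:Z by rewrite lunifE lmono1M; congr lmono; lia.
  by rewrite -!scalerA phiu IH.
have phim (c : k) (n : nat) z : phi (lmono c n%:Z *: z) = lmono c n%:Z *: phi z.
  have -> : lmono c n%:Z = lmono c 0 * lmono 1 n%:Z by rewrite lmonoM mulr1 add0r.
  by rewrite -!scalerA phiC phin.
have [s1 s2] := (lattice_submod lL1, lattice_submod lL2).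
have main g z : power_series g -> L1 z -> phi (g *: z) = g *: phi z.
  move=> hg Lz; apply/eqP; rewrite -subr_eq0; apply/eqP; apply: (lattice_sep lL2) => n.
  have [r hr eg] := ps_trunc n hg.
  have e1 : phi ((\sum_(i < n) lmono (g i%:Z) i%:Z) *: z) = (\sum_(i < n) lmono (g i%:Z) i%:Z) *: phi z.
    by rewrite !scaler_suml; elim/big_rec2: _ => // i a b _ <-; rewrite phiD phim.
  rewrite eg !scalerDl phiD e1 opprD addrACA subrr add0r -!scalerA phin -scalerBr scalerA lmono1M addNr.
  rewrite lmono1 scale1r; have [_ _ Z1] := s1; have [_ _ Z2] := s2.
  by apply: submodB => //; [apply: h12; apply: Z1|apply: Z2 => //; apply: h12].
have [a ha] := lattice_absorbing lL1 x; have [b hb] := laurent_ps f.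
apply: (scalerI (lmono_neq0 (a%:Z + b%:Z) (oner_neq0 k))).
rewrite -[a%:Z + b%:Z]/((a + b)%N%:Z) -phin PoszD -lmono1M -scalerA [lmono 1 b%:Z *: _]scalerA.
rewrite scalerA mulrC -scalerA main // phin.
by rewrite !scalerA; congr (_ *: _); ring.
Qed.

Section NegLattice.
Variables (k : fieldType) (A : connection k).

Lemma lneg_ps (f : laurent k) : power_series f -> power_series (lneg f).
Proof. by move=> h n n0 /=; rewrite h // mulr0. Qed.

Lemma lneg_mono (c : k) m : lneg (lmono c m) = lmono ((-1) ^ m * c) m.
Proof. by apply: laurentP => n /=; case: eqP => [->|_] //; rewrite mulr0. Qed.

Lemma neg_lattice (L : set A) : is_lattice L -> is_lattice (L : set (neg_connection A)).
Proof.
move=> /latticeP[n [e [fe eL]]]; apply/latticeP; exists n, e; split.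
  move=> m; have [a ea] := fe m; exists (fun i => lneg (a i)).
  by rewrite [LHS]ea; apply: eq_bigr => i _; rewrite neg_scaleE lnegK.
rewrite eL; apply/seteqP; split=> x [a ha ex].
  exists (fun i => lneg (a i)) => [i|]; first exact: lneg_ps.
  by rewrite [LHS]ex; apply: eq_bigr => i _; rewrite neg_scaleE lnegK.
by exists (fun i => lneg (a i)) => [i|]; first exact: lneg_ps.
Qed.

End NegLattice.

Lemma wconn_shift1 (k : fieldType) (X : lmodType k) (w : weyl_op X) (x : wconn w) :
  lU w (lS w x) -> shift 1 (lU w : set (wconn w)) x.
Proof.
move=> h; have -> : x = lmono 1 1 *: (lS w x : wconn w).
  by rewrite -lunifE [RHS]lspace_unif lSK.
exact: (@shiftE k (wconn w) 1 (lU w)).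
Qed.

Lemma wconn_const (k : fieldType) (X : lmodType k) (w : weyl_op X) c (s : wconn w) :
  lmono c 0 *: s = (c *: (s : X)).
Proof. exact: lspace_const. Qed.

Lemma wconn_unif (k : fieldType) (X : lmodType k) (w : weyl_op X) (s : wconn w) : lunif *: s = lT w s.
Proof. exact: lspace_unif. Qed.

Section FourierF.
Variables (k : fieldType) (char0 : [pchar k] =i pred0) (M : connection k).
Variables (h : no_horizontal_sections M) (V W : set M) (g : good_lattice_pair V W).
Local Notation N := (wconn (F_weyl_op char0 h g)).

Lemma wF_const c (m : M) : lmono c 0 *: (m : N) = lmono c 0 *: m :> M.
Proof. exact: (@wconn_const k (kspace M) (F_weyl_op char0 h g) c m). Qed.

Lemma wF_unif (m m' : M) : nabla M m' = - m -> lunif *: (m : N) = m' :> M.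
Proof.
move=> e; have -> : lunif *: (m : N) = - ninv char0 h m :> M.
  exact: (@wconn_unif k (kspace M) (F_weyl_op char0 h g) m).
by apply: (nabla_inj h); rewrite nablaN ninvK e.
Qed.

Lemma wF_nabla (m : M) : nabla N m = - nabla M (nabla M (lunif *: m)) :> M.
Proof. by []. Qed.

Lemma wF_oppE (m : M) : - (m : N) = - m :> M. Proof. by []. Qed.

Lemma wF_unifV (m : M) : - (lunif^-1 *: (m : N)) = nabla M m :> M.
Proof.
suff -> : lunif^-1 *: (m : N) = (- nabla M m : M) :> N by rewrite [LHS]wF_oppE opprK.
apply: (scalerI (lunif_neq0 k)); rewrite scalerA divff ?lunif_neq0 // scale1r.
by apply: esym; apply: (@wF_unif (- nabla M m) m); rewrite opprK.
Qed.

Lemma wF_delta (m : M) : delta (m : N) = - (lunif *: m) :> M.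
Proof. by rewrite deltaE expr2 -scalerA !wconn_unif nabla_wconn; exact: FTTD. Qed.

Lemma wF_delta_opp (m : M) : - delta (m : N) = lunif *: m :> M.
Proof. by rewrite [LHS]wF_oppE [X in - X]wF_delta opprK. Qed.

Lemma wF_no_hor : no_horizontal_sections N.
Proof.
move=> m; suff : - nabla M (nabla M (lunif *: (m : M))) = 0 -> m = 0 :> M by [].
move=> /eqP; rewrite oppr_eq0 => /eqP /h /h /eqP.
by rewrite scaler_eq0 (negPf (lunif_neq0 k)) => /eqP.
Qed.

Lemma wF_iter_delta n (x : M) :
  iter n (@delta k N) (x : N) = lmono ((-1) ^+ n) n%:Z *: x :> M.
Proof.
elim: n => [|n IH]; first by rewrite expr0 lmono1 scale1r.
rewrite iterS [LHS]wF_delta [iter _ _ _]IH scalerA -scaleNr lunifE lmonoM mul1r -lmonoN exprS mulN1r.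
by congr (lmono _ _ *: _); lia.
Qed.

Lemma wF_slopes : all_slopes_lt1 N.
Proof.
have [c hc] := V_comm g; have sU := lattice_submod (F_lattice g).
apply: (@top_nilp_slopes k N (lU (F_weyl_op char0 h g)) c).
- exact: wconn_lattice.
- move=> x Ux; suff : div_unif W (delta (x : N) : M) by [].
  rewrite [delta _]wF_delta; apply: (submodN (V := div_unif W)) => //.
  exact: (submod_mono (V := div_unif W)).
- move=> x Ux; apply: wconn_shift1; suff : div_unif W (F_var_inv (iter c (@delta k N) (x : N) : M)) by [].
  rewrite [iter _ _ _]wF_iter_delta.
  apply: (FS_V g); have -> : lmono ((-1) ^+ c) c%:Z = lmono ((-1) ^+ c : k) 0 * lmono 1 c%:Z.
    by rewrite lmonoM mulr1 add0r.
  rewrite -scalerA; apply: (submod_mono (V := V)) => //; last exact: hc.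
  by apply: lattice_submod; case: g.
Qed.

Lemma wF_shift (n : nat) (x : M) : shift (- n%:Z) (div_unif W) x ->
  shift (- n%:Z) (lU (F_weyl_op char0 h g) : set N) (x : N).
Proof.
move=> hx; rewrite /shift /= opprK.
have e : lmono 1 n%:Z *: (x : N) = iter n (F_var char0 h) x :> M.
  exact: (@wconn_unifn k (kspace M) (F_weyl_op char0 h g) n x).
suff : div_unif W (iter n (F_var char0 h) x : M) by rewrite -e.
move: {e} x hx => x.
elim: n x => [|j IH] y; first by rewrite oppr0 shift0.
move=> /(FT_shift char0 h g); have -> : - j.+1%:Z + 1 = - j%:Z by lia.
by rewrite iterSr; apply: IH.
Qed.

End FourierF.

Section FourierG.
Variables (k : fieldType) (char0 : [pchar k] =i pred0) (N : connection k).
Variables (h : no_horizontal_sections N) (s : all_slopes_lt1 N).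
Variables (V : set N) (a : admissible_inf V).
Local Notation R := (wconn (G_weyl_op char0 h s a)).
Local Notation P := (neg_connection R).

Lemma wG_no_hor : no_horizontal_sections R.
Proof.
move=> m; suff : lunif^-1 *: (m : N) = 0 -> m = 0 :> N by [].
by move=> /eqP; rewrite scaler_eq0 invr_eq0 (negPf (lunif_neq0 k)) => /eqP.
Qed.

Lemma negG_nabla (m : N) : nabla P m = - (lunif^-1 *: m) :> N.
Proof. by []. Qed.

Lemma negG_unif (m : N) : lunif *: (m : P) = - delta m :> N.
Proof.
rewrite [LHS]neg_scaleE lunifE lneg_mono expr1z mulr1 lmonoN scaleNr -lunifE.
suff -> : lunif *: (m : R) = delta m :> N by [].
exact: (@wconn_unif k (kspace N) (G_weyl_op char0 h s a) m).
Qed.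

Lemma negG_const c (m : N) : lmono c 0 *: (m : P) = lmono c 0 *: m :> N.
Proof.
rewrite [LHS]neg_scaleE lneg_mono expr0z mul1r.
exact: (@wconn_const k (kspace N) (G_weyl_op char0 h s a) c m).
Qed.

Lemma negG_oppE (m : N) : - (m : P) = - m :> N. Proof. by []. Qed.

Lemma negG_nabla_unif (m : N) : nabla P (lunif *: m : N) = - (m : P).
Proof.
rewrite [LHS]negG_nabla scalerA mulVf ?lunif_neq0 // scale1r.
by [].
Qed.

Lemma negG_nabla3 (m : N) : - nabla P (nabla P (lunif *: (m : P))) = nabla N m :> N.
Proof.
rewrite [LHS]negG_oppE [nabla P _]negG_nabla [nabla P _]negG_nabla [lunif *: _]negG_unif.
rewrite !scalerN !opprK deltaE !scalerA -invfM -expr2 mulVf ?scale1r //.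
exact: lunif2_neq0.
Qed.

Lemma negG_shift (d : nat) (x : N) : V (iter d (G_var N) x) ->
  shift (- d%:Z) (lU (G_weyl_op char0 h s a) : set P) (x : P).
Proof.
move=> hx; rewrite /shift /= opprK [lmono _ _ *: _]neg_scaleE lneg_mono mulr1.
have -> : lmono ((-1) ^ d%:Z) d%:Z = lmono ((-1) ^ d%:Z : k) 0 * lmono 1 d%:Z.
  by rewrite lmonoM mulr1 add0r.
rewrite -scalerA.
apply: (@submod_mono k R (lU (G_weyl_op char0 h s a)) ((-1) ^ d%:Z) 0 (lmono 1 d%:Z *: (x : R))) => //.
  exact: lattice_submod (wconn_lattice (G_weyl_op char0 h s a)).
have e : lmono 1 d%:Z *: (x : R) = iter d (G_var N) x :> N.
  exact: (@wconn_unifn k (kspace N) (G_weyl_op char0 h s a) d x).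
by rewrite -e in hx.
Qed.

End FourierG.

Section Properties.
Variables (k : fieldType) (char0 : [pchar k] =i pred0).

Lemma hF_can (M : nohor_cat k) : no_horizontal_sections (Fcan char0 M) /\ all_slopes_lt1 (Fcan char0 M).
Proof. by split; [exact: wF_no_hor|exact: wF_slopes]. Qed.

Lemma Gcan_no_hor (N : nohor_lt1_cat k) : no_horizontal_sections (Gcan char0 N).
Proof. exact: wG_no_hor. Qed.

Definition F0c : functor (nohor_cat k) (nohor_lt1_cat k) :=
  @corestrict _ (conn_cat k) (fun M => no_horizontal_sections M /\ all_slopes_lt1 M) (Fcan char0) hF_can.
Definition G0c : functor (nohor_lt1_cat k) (nohor_cat k) :=
  @corestrict _ (conn_cat k) (@no_horizontal_sections k) (Gcan char0) Gcan_no_hor.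

End Properties.

Section NegGF.
Variables (k : fieldType) (char0 : [pchar k] =i pred0) (M : connection k).
Variables (h : no_horizontal_sections M) (V W : set M) (g : good_lattice_pair V W).
Local Notation N := (wconn (F_weyl_op char0 h g)).
Variables (h' : no_horizontal_sections N) (s' : all_slopes_lt1 N).
Variables (V' : set N) (a' : admissible_inf V').
Local Notation P := (neg_connection (wconn (G_weyl_op char0 h' s' a'))).

Definition negGF (m : M) : P := m.

Lemma negGF_nabla m : negGF (nabla M m) = nabla P (negGF m).
Proof.
exact: (@esym M _ _ (@etrans M _ _ _ (negG_nabla char0 h' s' a' m) (wF_unifV char0 h g m))).
Qed.

Lemma negGF_unif m : negGF (lunif *: m) = lunif *: negGF m.
Proof.
exact: (@esym M _ _ (@etrans M _ _ _ (negG_unif char0 h' s' a' m) (wF_delta_opp char0 h g m))).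
Qed.

Lemma negGF_const c m : negGF (lmono c 0 *: m) = lmono c 0 *: negGF m.
Proof.
exact: (@esym M _ _ (@etrans M _ _ _ (negG_const char0 h' s' a' c m) (wF_const char0 h g c m))).
Qed.

Lemma negGF_linear : linear negGF.
Proof.
have lU : is_lattice (div_unif W : set N) := wconn_lattice (F_weyl_op char0 h g).
have lV' := G_lattice a'.
have [n hn] := lattice_comm lU (lattice_submod lV') (lattice_absorbing lV').
have [d hd] := G_shift char0 s' a' n.
have lP := neg_lattice (wconn_lattice (G_weyl_op char0 h' s' a')).
apply: (bounded_linear (L1 := div_unif W) _ negGF_const negGF_unif (F_lattice g)
  (shift_lattice (- d%:Z) lP)) => // x Ux.
by apply: negG_shift; apply: hd; rewrite /shift /= opprK; exact: hn.
Qed.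

End NegGF.

Section FNegG.
Variables (k : fieldType) (char0 : [pchar k] =i pred0) (N : connection k).
Variables (h : no_horizontal_sections N) (s : all_slopes_lt1 N).
Variables (V : set N) (a : admissible_inf V).
Local Notation M := (neg_connection (wconn (G_weyl_op char0 h s a))).
Variables (h' : no_horizontal_sections M) (V' W' : set M) (g' : good_lattice_pair V' W').
Local Notation R := (wconn (F_weyl_op char0 h' g')).

Definition FnegG (m : N) : R := m.

Lemma FnegG_nabla m : FnegG (nabla N m) = nabla R (FnegG m).
Proof. exact: (@esym N _ _ (@etrans N _ _ _ (wF_nabla char0 h' g' m) (negG_nabla3 char0 h s a m))). Qed.

Lemma FnegG_unif m : FnegG (lunif *: m) = lunif *: FnegG m.
Proof. exact: (@esym N _ _ (@wF_unif k char0 M h' _ _ g' m (lunif *: m : N) (negG_nabla_unif char0 h s a m))). Qed.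

Lemma FnegG_const c m : FnegG (lmono c 0 *: m) = lmono c 0 *: FnegG m.
Proof.
exact: (@esym N _ _ (@etrans N _ _ _ (wF_const char0 h' g' c m) (negG_const char0 h s a c m))).
Qed.

Lemma FnegG_linear : linear FnegG.
Proof.
have lV : is_lattice (V : set M) := neg_lattice (wconn_lattice (G_weyl_op char0 h s a)).
have lF := F_lattice g'.
have [n hn] := lattice_comm lV (lattice_submod lF) (lattice_absorbing lF).
apply: (bounded_linear (L1 := V) _ FnegG_const FnegG_unif (G_lattice a)
  (shift_lattice (- n%:Z) (wconn_lattice (F_weyl_op char0 h' g')))) => // x Vx.
by apply: wF_shift; rewrite /shift /= opprK; exact: hn.
Qed.

End FNegG.

Section NegNeg.
Variables (k : fieldType) (A : connection k).
Definition negneg (m : A) : neg_connection (neg_connection A) := m.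
Lemma negneg_linear : linear negneg.
Proof.
move=> f x y; have e : f *: negneg x = f *: x :> A by rewrite [LHS]neg_scaleE [LHS]neg_scaleE lnegK.
by rewrite /negneg -[in LHS]e.
Qed.
Lemma negneg_nabla m : negneg (nabla A m) = nabla (neg_connection (neg_connection A)) (negneg m).
Proof. by apply: esym; exact: (opprK (nabla A m)). Qed.
End NegNeg.

Section QuasiInverse.

Lemma nat_iso_compA (B C D E : category) (H : functor D E) (G : functor C D) (F : functor B C) :
  nat_iso (comp_functor (comp_functor H G) F) (comp_functor H (comp_functor G F)).
Proof.
exists (fun x => idm (H (G (F x)))), (fun x => idm (H (G (F x)))).
by split=> [x y f|x|x] /=; rewrite ?comp1m ?compm1.
Qed.

Lemma nat_iso_comp1l (C D : category) (F : functor C D) : nat_iso (comp_functor (id_functor D) F) F.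
Proof.
exists (fun x => idm (F x)), (fun x => idm (F x)).
by split=> [x y f|x|x] /=; rewrite ?comp1m ?compm1.
Qed.

Lemma quasi_inverse_iso (C D : category) (F F' : functor C D) (G G' : functor D C) :
  nat_iso F F' -> nat_iso G G' -> quasi_inverse F' G' -> quasi_inverse F G.
Proof.
move=> hF hG [h1 h2]; split.
  exact: nat_iso_trans (nat_iso_comp hF hG) h1.
exact: nat_iso_trans (nat_iso_comp hG hF) h2.
Qed.

Lemma quasi_inverse_twist (C D : category) (F : functor C D) (G : functor D C) (S : functor C C) :
  nat_iso (comp_functor S S) (id_functor C) ->
  quasi_inverse F (comp_functor S G) -> quasi_inverse G (comp_functor F S).
Proof.
move=> hS [h1 h2]; split; first exact: nat_iso_trans (nat_iso_compA F S G) h2.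
pose X := comp_functor G (comp_functor F S).
apply: (nat_iso_trans (nat_iso_sym (nat_iso_comp1l X))).
apply: (nat_iso_trans (nat_iso_comp (nat_iso_refl X) (nat_iso_sym hS))).
apply: (nat_iso_trans (nat_iso_compA S S X)); apply: nat_iso_trans hS.
apply: nat_iso_comp (nat_iso_refl S).
apply: (nat_iso_trans (nat_iso_sym (nat_iso_compA S G (comp_functor F S)))).
apply: (nat_iso_trans (nat_iso_sym (nat_iso_compA (comp_functor S G) F S))).
apply: (nat_iso_trans (nat_iso_comp (nat_iso_refl S) h1)).
exact: nat_iso_comp1l.
Qed.

End QuasiInverse.

Section Equivalence.
Variables (k : fieldType) (char0 : [pchar k] =i pred0).
Local Notation neg := (neg_pullback_nohor k).
Local Notation Fc := (F0c char0).
Local Notation Gc := (G0c char0).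

Lemma nat_iso_horizontal (C : category) (F G : functor C (conn_cat k)) : nat_iso F G ->
  forall x, exists (f : horizontal (F x) (G x)) (g : horizontal (G x) (F x)),
    cancel g f /\ cancel f g.
Proof.
move=> [eta [eps [_ h1 h2]]] x; exists (eta x), (eps x); split=> m.
  have e := congr1 (fun f : horizontal (G x) (G x) => f m) (h2 x).
  exact: etrans (esym (hcompE (eta x) (eps x) m)) (etrans e (id_lfunE m)).
have e := congr1 (fun f : horizontal (F x) (F x) => f m) (h1 x).
exact: etrans (esym (hcompE (eps x) (eta x) m)) (etrans e (id_lfunE m)).
Qed.

Lemma mk_horizontal_inv (A B : connection k) (phi : A -> B) (psi : B -> A) :
  linear phi -> (forall m, phi (nabla A m) = nabla B (phi m)) ->
  cancel phi psi -> cancel psi phi ->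
  exists e : horizontal A B * horizontal B A,
    (forall m, e.1 m = phi m) /\ (forall m, e.2 m = psi m).
Proof.
move=> lin hor K1 K2; have linp : linear psi.
  by move=> a x y; apply: (can_inj K1); rewrite K2 lin !K2.
have horp m : psi (nabla B m) = nabla A (psi m).
  by apply: (can_inj K1); rewrite K2 hor K2.
exists (mk_horizontal lin hor, mk_horizontal linp horp).
by split=> m; apply: mk_horizontalE.
Qed.

Lemma nat_iso_of_bij (C : category) (Q : conn_cat k -> Prop) (F G : functor C (@full_subcat (conn_cat k) Q))
  (phi : forall x, (sval (F x) : connection k) -> (sval (G x) : connection k))
  (psi : forall x, (sval (G x) : connection k) -> (sval (F x) : connection k)) :
  (forall x, linear (phi x)) ->
  (forall x m, phi x (nabla (sval (F x)) m) = nabla (sval (G x)) (phi x m)) ->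
  (forall x, cancel (phi x) (psi x)) -> (forall x, cancel (psi x) (phi x)) ->
  (forall x y (f : mor x y) m,
     phi y ((fmor F f : horizontal (sval (F x)) (sval (F y))) m) =
     (fmor G f : horizontal (sval (G x)) (sval (G y))) (phi x m)) ->
  nat_iso F G.
Proof.
move=> lin hor K1 K2 nat.
have e x := cid (mk_horizontal_inv (lin x) (hor x) (K1 x) (K2 x)).
pose eta x : horizontal (sval (F x)) (sval (G x)) := (projT1 (e x)).1.
pose eps x : horizontal (sval (G x)) (sval (F x)) := (projT1 (e x)).2.
have etaE x m : eta x m = phi x m by exact: (projT2 (e x)).1.
have epsE x m : eps x m = psi x m by exact: (projT2 (e x)).2.
exists eta, eps; split=> [x y f|x|x].
- apply: horizontal_eq => m; rewrite [LHS]comp_lfunE [RHS]comp_lfunE.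
  by rewrite [LHS]etaE [X in _ = _ X]etaE; exact: nat.
- apply: horizontal_eq => m; rewrite [LHS]comp_lfunE [RHS]id_lfunE.
  by rewrite [LHS]epsE [X in psi x X]etaE K1.
- apply: horizontal_eq => m; rewrite [LHS]comp_lfunE [RHS]id_lfunE.
  by rewrite [LHS]etaE [X in phi x X]epsE K2.
Qed.

Lemma neg_horizontalE (A B : connection k) (f : horizontal A B) m : neg_horizontal f m = f m.
Proof. by rewrite /= lfunE. Qed.

Lemma nat_iso_negGF : nat_iso (id_functor (nohor_cat k)) (comp_functor (comp_functor neg Gc) Fc).
Proof.
apply: (@nat_iso_of_bij _ _ (id_functor (nohor_cat k)) (comp_functor (comp_functor neg Gc) Fc)
  (fun M m => m) (fun M m => m)) => //.
- move=> M; exact: (@negGF_linear k char0 (sval M)).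
- move=> M; exact: (@negGF_nabla k char0 (sval M)).
- by move=> M M' f m; rewrite neg_horizontalE GmorE FmorE.
Qed.

Lemma nat_iso_FnegG : nat_iso (id_functor (nohor_lt1_cat k)) (comp_functor Fc (comp_functor neg Gc)).
Proof.
apply: (@nat_iso_of_bij _ _ (id_functor (nohor_lt1_cat k)) (comp_functor Fc (comp_functor neg Gc))
  (fun M m => m) (fun M m => m)) => //.
- move=> M; exact: (@FnegG_linear k char0 (sval M)).
- move=> M; exact: (@FnegG_nabla k char0 (sval M)).
- by move=> M M' f m; rewrite FmorE neg_horizontalE GmorE.
Qed.

Lemma nat_iso_negneg : nat_iso (id_functor (nohor_cat k)) (comp_functor neg neg).
Proof.
apply: (@nat_iso_of_bij _ _ (id_functor (nohor_cat k)) (comp_functor neg neg)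
  (fun M m => m) (fun M m => m)) => //.
- move=> M; exact: (@negneg_linear k (sval M)).
- move=> M; exact: (@negneg_nabla k (sval M)).
- by move=> M M' f m; rewrite !neg_horizontalE.
Qed.

Lemma quasi_inverse_can : quasi_inverse Fc (comp_functor neg Gc).
Proof. by split; apply: nat_iso_sym; [exact: nat_iso_negGF|exact: nat_iso_FnegG]. Qed.

End Equivalence.

Theorem proposition3p10 (k : fieldType) (char0 : [pchar k] =i pred0) :
  (exists F, @is_local_fourier_0_inf k F) /\
  (exists G, @is_local_fourier_inf_0 k G) /\
  forall (F : functor (nohor_cat k) (conn_cat k))
         (G : functor (nohor_lt1_cat k) (conn_cat k)),
    is_local_fourier_0_inf F -> is_local_fourier_inf_0 G ->
    exists (hF : forall M : nohor_cat k,
              no_horizontal_sections (F M) /\ all_slopes_lt1 (F M))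
           (hG : forall N : nohor_lt1_cat k, no_horizontal_sections (G N)),
      let F0 : functor (nohor_cat k) (nohor_lt1_cat k) := corestrict hF in
      let G0 : functor (nohor_lt1_cat k) (nohor_cat k) := corestrict hG in
      [/\ is_equivalence F0, is_equivalence G0 &
          quasi_inverse F0 (comp_functor (neg_pullback_nohor k) G0)].
Proof.
split; first by exists (Fcan char0); exact: Fcan_spec.
split; first by exists (Gcan char0); exact: Gcan_spec.
move=> F G sF sG.
have iF := unique_0_inf char0 sF (Fcan_spec char0).
have iG := unique_inf_0 char0 sG (Gcan_spec char0).
have hF (M : nohor_cat k) : no_horizontal_sections (F M) /\ all_slopes_lt1 (F M).
  have [f [g [fg gf]]] := nat_iso_horizontal iF M; have [h1 h2] := hF_can char0 M.
  by split; [exact: no_hor_iso gf h1|exact: slopes_iso fg gf h2].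
have hG (N : nohor_lt1_cat k) : no_horizontal_sections (G N).
  have [f [g [_ gf]]] := nat_iso_horizontal iG N; apply: (no_hor_iso (f := f) gf); exact: Gcan_no_hor.
exists hF, hG => F0 G0.
have iF0 : nat_iso F0 (F0c char0) by exact: nat_iso_corestrict.
have iG0 : nat_iso G0 (G0c char0) by exact: nat_iso_corestrict.
have q : quasi_inverse F0 (comp_functor (neg_pullback_nohor k) G0).
  apply: quasi_inverse_iso iF0 _ (quasi_inverse_can char0).
  exact: nat_iso_comp iG0 (nat_iso_refl _).
split=> //; first by exists (comp_functor (neg_pullback_nohor k) G0).
exists (comp_functor F0 (neg_pullback_nohor k)).
exact: quasi_inverse_twist (nat_iso_sym (nat_iso_negneg k)) q.
Qed.
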